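(* Suppose $F\in M_b(\mathbb{R}^d;\mathbb{R}^d)$ satisfies $\operatorname{div}F=0$ in the sense of distributions. Then there exist positive integers $n_l$ ($l\in\mathbb{N}=\{1,2,\dots\}$) and $k_{i,l}$ ($1\le i\le n_l$), and oriented piecewise $C^1$ closed curves $\Gamma_{i,l,j}$ in $\mathbb{R}^d$ ($l\in\mathbb{N}$, $1\leq i\leq n_l$, $1\leq j\leq k_{i,l}$), for which $$F=\lim_{l\to\infty}\frac{\|F\|(\mathbb{R}^d)}{n_l\cdot l}\sum_{i=1}^{n_l}\sum_{j=1}^{k_{i,l}}\mu_{\Gamma_{i,l,j}}$$ weakly-star as measures, $$\lim_{l\to\infty}\frac{1}{n_l\cdot l}\sum_{i=1}^{n_l}\sum_{j=1}^{k_{i,l}}\|\mu_{\Gamma_{i,l,j}}\|(\mathbb{R}^d)\leq 10,$$ and, for all $i,l,j$, $$\|\mu_{\Gamma_{i,l,j}}\|_{\mathcal{M}^1(\mathbb{R}^d)}:=\sup_{x\in\mathbb{R}^d,\,r>0}\frac{\|\mu_{\Gamma_{i,l,j}}\|(B(x,r))}{r}\leq 1000.$$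
   Context: $M_b(\mathbb{R}^d;\mathbb{R}^d)$ is the space of finite $\mathbb{R}^d$-valued Radon measures on $\mathbb{R}^d$. For such a measure $\nu$, $\|\nu\|$ is its total variation measure, $\|\nu\|(E)=\sup\sum_k|\nu(E_k)|$ over countable Borel partitions $\{E_k\}$ of $E$. Weak-star convergence is convergence when tested against every $\Phi\in C_0(\mathbb{R}^d;\mathbb{R}^d)$ (continuous fields vanishing at infinity). $B(x,r)$ is the ball of radius $r$ centered at $x$. An oriented piecewise $C^1$ curve $\Gamma\subset\mathbb{R}^d$ of length $L$ is identified with its arclength parametrization: a continuous $\gamma:[0,L]\to\mathbb{R}^d$ with $\gamma\in C^1([0,L]\setminus\{s_i\}_{i=1}^k;\mathbb{R}^d)$ for some finite set $\{s_i\}_{i=1}^k$, and $|\dot\gamma(s)|=1$ for all $s\in[0,L]\setminus\{s_i\}_{i=1}^k$. It is closed if $\gamma(0)=\gamma(L)$. The vector measure $\mu_\Gamma$ induced by integration along $\Gamma$ is defined by $$\int_{\mathbb{R}^d}\Phi\cdot d\mu_\Gamma=\int_0^L\Phi(\gamma(t))\cdot\dot\gamma(t)\,dt\qquad\text{for all }\Phi\in C_0(\mathbb{R}^d;\mathbb{R}^d).$$ *)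

(* Defs.v *)
From HB Require Import structures.
From mathcomp Require Import all_boot all_order all_algebra.
From mathcomp Require Import all_classical all_reals all_analysis.

Set Implicit Arguments.
Unset Strict Implicit.
Unset Printing Implicit Defensive.

Import Order.TTheory GRing.Theory Num.Theory.
Import numFieldNormedType.Exports.

Local Open Scope classical_set_scope.
Local Open Scope ring_scope.

(* R^d is 'rV[R]_d.  The library norm (and [ball]) on 'rV[R]_d is the sup norm;
   it only serves through its topology, which is the Euclidean one.  Lengths,
   total variations and balls use the Euclidean norm below. *)
Definition dotv (R : realType) (d : nat) (u v : 'rV[R]_d) : R :=
  \sum_(i < d) u 0 i * v 0 i.

Definition enorm (R : realType) (d : nat) (v : 'rV[R]_d) : R :=
  Num.sqrt (dotv v v).

Definition eball (R : realType) (d : nat) (x : 'rV[R]_d) (r : R) :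
    set 'rV[R]_d :=
  [set y | enorm (y - x) < r].

(* R^d with its Borel sigma-algebra. *)
Definition borel (R : realType) (d : nat) :=
  g_sigma_algebraType (@open 'rV[R]_d).

(* M_b(R^d; R^d), given by its components: library charges are finite-valued,
   and finite Borel measures on R^d are automatically Radon. *)
Definition vmeasure (R : realType) (d : nat) : Type :=
  'I_d -> {charge set (borel R d) -> \bar R}.

Section VectorMeasures.
Context (R : realType) (d : nat).
Implicit Types (mu nu : vmeasure R d).

Definition vzero : vmeasure R d := fun=> czero.

Definition vadd mu nu : vmeasure R d := fun i => cadd (mu i) (nu i).

Definition vscale (c : R) mu : vmeasure R d := fun i => cscale c (mu i).

Definition vvalue mu (A : set (borel R d)) : 'rV[R]_d :=
  \row_(i < d) fine (mu i A).

(* Meaningful for Borel sets [E] only (otherwise the supremum is over the empty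
   set).  The pieces [P k] may be empty, so finite partitions are included. *)
Definition vvariation mu (E : set (borel R d)) : \bar R :=
  ereal_sup [set s | exists P : nat -> set (borel R d),
    [/\ forall k, measurable (P k),
        trivIset [set: nat] P,
        \bigcup_k P k = E
      & s = (\sum_(0 <= k <oo) (enorm (vvalue mu (P k)))%:E)%E]].

(* The supremum of |mu|(B(x, r)) / r. *)
Definition morrey1_norm mu : \bar R :=
  ereal_sup [set s | exists (x : 'rV[R]_d) (r : R),
    0 < r /\ s = (vvariation mu (eball x r) * (r^-1)%:E)%E].

(* Integral against a signed measure, as the difference of the integrals
   against its Jordan parts; those do not depend on the chosen Hahn
   decomposition. *)
Definition charge_integral (nu : {charge set (borel R d) -> \bar R})
    (f : 'rV[R]_d -> R) : R :=
  let P := cid (Hahn_decomposition nu) in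
  let N := cid (projT2 P) in
  Rintegral (jordan_pos (projT2 N)) setT (f : borel R d -> R) -
  Rintegral (jordan_neg (projT2 N)) setT (f : borel R d -> R).

(* The integral of Phi . d mu. *)
Definition vintegral mu (Phi : 'rV[R]_d -> 'rV[R]_d) : R :=
  \sum_(i < d) charge_integral (mu i) (fun x => Phi x 0 i).

Definition C0_field (Phi : 'rV[R]_d -> 'rV[R]_d) : Prop :=
  continuous Phi /\
  forall e : R, 0 < e -> exists M : R,
    forall x, M < enorm x -> enorm (Phi x) < e.

Definition weak_star_cvg (mus : nat -> vmeasure R d) mu : Prop :=
  forall Phi, C0_field Phi ->
    (fun l => vintegral (mus l) Phi) @ \oo --> vintegral mu Phi.

Definition partial (i : 'I_d) (f : 'rV[R]_d -> R) : 'rV[R]_d -> R :=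
  fun x => 'D_(delta_mx 0 i) f x.

Fixpoint partials (s : seq 'I_d) (f : 'rV[R]_d -> R) : 'rV[R]_d -> R :=
  if s is i :: s' then partials s' (partial i f) else f.

Definition smooth (f : 'rV[R]_d -> R) : Prop :=
  forall s : seq 'I_d, continuous (partials s f) /\
    forall (i : 'I_d) x, derivable (partials s f) x (delta_mx 0 i).

Definition test_function (f : 'rV[R]_d -> R) : Prop :=
  smooth f /\ compact (closure [set x | f x != 0]).

Definition gradient (f : 'rV[R]_d -> R) : 'rV[R]_d -> 'rV[R]_d :=
  fun x => \row_(i < d) partial i f x.

Definition divergence_free mu : Prop :=
  forall phi, test_function phi -> vintegral mu (gradient phi) = 0.

End VectorMeasures.

(* The values of [curve_fun] outside [0, L] are irrelevant.  The finite
   exceptional set may always be enlarged by the endpoints, so C^1 regularity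
   on [0, L] minus a finite set amounts to C^1 regularity on ]0, L[ minus a
   finite set, where the two-sided derivative can be used. *)
Record pwC1_curve (R : realType) (d : nat) := PwC1Curve {
  curve_length : R;
  curve_fun : R -> 'rV[R]_d;
  curve_breaks : seq R;
  curve_length_gt0 : 0 < curve_length;
  curve_continuous : {within `[0, curve_length], continuous curve_fun};
  curve_derivable : forall t : R, 0 < t < curve_length -> t \notin curve_breaks ->
    derivable curve_fun t 1;
  curve_C1 : forall t : R, 0 < t < curve_length -> t \notin curve_breaks ->
    {for t, continuous (derive1 curve_fun)};
  curve_speed : forall t : R, 0 < t < curve_length -> t \notin curve_breaks ->
    enorm (derive1 curve_fun t) = 1
}.

Definition closed_curve (R : realType) (d : nat) (G : pwC1_curve R d) : Prop :=
  curve_fun G 0 = curve_fun G (curve_length G).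

(* [mu] is the vector measure mu_G; the identity determines it (Riesz). *)
Definition induced_measure (R : realType) (d : nat) (G : pwC1_curve R d)
    (mu : vmeasure R d) : Prop :=
  forall Phi, C0_field Phi ->
    vintegral mu Phi =
    \int[lebesgue_measure]_(t in `[0, curve_length G])
       dotv (Phi (curve_fun G t)) (derive1 (curve_fun G) t).

(* Main.v *)
(* Call a closed polygon good if its length inside every ball of radius [r] is at
   most [1000 * r].  Cutting a closed polygon repeatedly along its shortest
   shortcuts splits off good loops of total length at most three times the length
   of the polygon.  Hence, if the integral of a field [Phi] along every good loop
   is at most [lam] times its length, then along every closed polygon it is at
   most [kappa = 3 * lam] times the length, and the infimum [w x] of [kappa] times
   the length minus the integral of [Phi] over the polygonal paths ending at [x]
   satisfies [w y - w x <= kappa * |y - x|] minus the integral of [Phi] from [x]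
   to [y].  Smoothing [w] gives a test function [f] with [|Phi + grad f|] at most
   nearly [kappa], so that [div F = 0] yields [F(Phi) <= 3 * lam * |F|].
   By separation in finite dimension, the values of [F] on finitely many fields
   are then nearly those of a nonnegative combination of good loops of total
   length at most [3 * |F|].  Rounding the weights to integers, and interpolating
   general fields on finer and finer lattices, gives the approximating curves;
   their total masses stay in a compact interval, so they converge along a
   suitable choice of the scales.  The rows [i > 1] and the remaining place in
   the first one are filled by curves inducing the zero measure. *)
Require Import Defs.
From HB Require Import structures.
From mathcomp Require Import all_boot all_order all_algebra.
From mathcomp Require Import all_classical all_reals all_analysis.
From mathcomp Require Import measurable_realfun.
From mathcomp Require Import ring lra zify.
Set Implicit Arguments.
Unset Strict Implicit.
Unset Printing Implicit Defensive.
Import Order.TTheory GRing.Theory Num.Theory.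
Import numFieldNormedType.Exports.
Local Open Scope classical_set_scope.
Local Open Scope ring_scope.

(** * Euclidean norm and line integrals *)

(** Duality replaces a decomposition of [F] itself into curves, which by itself would not control
    the length of the curves in balls. Only test fields are handled: the integrand [kappa] times
    length minus [Phi] is a weight without negative cycles, and [w] is the shortest-path distance
    for this weight with a free starting point. The delicate point is to turn [w] into a smooth
    function of compact support without losing a factor in the gradient bound.

    The factor 3 comes from the cut. If an arc of length [A] is cut off along a shortcut of length
    [D], the loop costs [lam * (A + D)], the rest gains [c * lam * D], and [c * lam * A] is saved;
    so a rate [c * lam] survives when [(c + 1) * D <= (c - 1) * A]. For [2 * D < A] the value
    [c = 3] works. Paths without such shortcuts cover at most [12 * r] of a ball of radius [r], and
    the loops closed from them at most [24 * r]. So both permitted constants, 10 and 1000, leave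
    room. *)

Section EuclideanNorm.
Context (R : realType) (d : nat).
Implicit Types (u v w : 'rV[R]_d) (c : R).

Lemma dotvC u v : dotv u v = dotv v u.
Proof. by apply: eq_bigr => i _; rewrite mulrC. Qed.

Lemma dotvDl u v w : dotv (u + v) w = dotv u w + dotv v w.
Proof. by rewrite -big_split; apply: eq_bigr => i _ /=; rewrite mxE mulrDl. Qed.

Lemma dotvZl c u v : dotv (c *: u) v = c * dotv u v.
Proof. by rewrite mulr_sumr; apply: eq_bigr => i _; rewrite mxE mulrA. Qed.

Lemma dotvDr u v w : dotv w (u + v) = dotv w u + dotv w v.
Proof. by rewrite dotvC dotvDl !(dotvC w). Qed.

Lemma dotvZr c u v : dotv u (c *: v) = c * dotv u v.
Proof. by rewrite dotvC dotvZl dotvC. Qed.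

Lemma dotvNl u v : dotv (- u) v = - dotv u v.
Proof. by rewrite -scaleN1r dotvZl mulN1r. Qed.

Lemma dotvNr u v : dotv u (- v) = - dotv u v.
Proof. by rewrite dotvC dotvNl dotvC. Qed.

Lemma dotv0l v : dotv 0 v = 0.
Proof. by rewrite -(scale0r 0) dotvZl mul0r. Qed.

Lemma dotv0r v : dotv v 0 = 0.
Proof. by rewrite dotvC dotv0l. Qed.

Lemma dotv_ge0 v : 0 <= dotv v v.
Proof. by apply: sumr_ge0 => i _; rewrite -expr2 sqr_ge0. Qed.

Lemma enorm_ge0 v : 0 <= enorm v.
Proof. exact: sqrtr_ge0. Qed.

Lemma sqr_enorm v : enorm v ^+ 2 = dotv v v.
Proof. by rewrite sqr_sqrtr // dotv_ge0. Qed.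

Lemma enorm0 : enorm (0 : 'rV[R]_d) = 0.
Proof. by rewrite /enorm dotv0l sqrtr0. Qed.

Lemma enormZ c v : enorm (c *: v) = `|c| * enorm v.
Proof.
by rewrite /enorm dotvZl dotvZr mulrA -expr2 sqrtrM ?sqr_ge0 // sqrtr_sqr.
Qed.

Lemma enormN v : enorm (- v) = enorm v.
Proof. by rewrite -scaleN1r enormZ normrN normr1 mul1r. Qed.

Lemma enormC u v : enorm (u - v) = enorm (v - u).
Proof. by rewrite -enormN opprB. Qed.

Lemma coord_le_enorm v i : `|v 0 i| <= enorm v.
Proof.
rewrite -(ger0_norm (enorm_ge0 v)) -ler_sqr ?nnegrE // -!normrX.
rewrite ger0_norm ?sqr_ge0 // sqr_enorm ger0_norm ?dotv_ge0 //.
by rewrite /dotv (bigD1 i) //= -expr2 lerDl sumr_ge0 // => j _; rewrite -expr2 sqr_ge0.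
Qed.

Lemma enorm_eq0 v : (enorm v == 0) = (v == 0).
Proof.
apply/eqP/eqP => [v0|->]; last exact: enorm0.
apply/rowP => i; apply/eqP; rewrite mxE -normr_le0 -v0.
exact: coord_le_enorm.
Qed.

Lemma enorm_gt0 v : (0 < enorm v) = (v != 0).
Proof. by rewrite lt0r enorm_eq0 enorm_ge0 andbT. Qed.

Lemma dotv_le u v : dotv u v <= enorm u * enorm v.
Proof.
have [->|u0] := eqVneq u 0; first by rewrite dotv0l enorm0 mul0r.
have [->|v0] := eqVneq v 0; first by rewrite dotv0r enorm0 mulr0.
have := dotv_ge0 (enorm v *: u - enorm u *: v).
rewrite !(dotvDl, dotvDr, dotvNl, dotvNr, dotvZl, dotvZr) -!sqr_enorm (dotvC v u).
move: u0 v0; rewrite -!enorm_gt0.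
move: (enorm u) (enorm v) (dotv u v) => a b c a0 b0 H.
have ab : 0 < a * b by apply: mulr_gt0.
have : 0 <= (a * b) * (a * b - c) by nra.
by rewrite pmulr_rge0 // subr_ge0.
Qed.

Lemma normr_dotv_le u v : `|dotv u v| <= enorm u * enorm v.
Proof. by rewrite ler_norml dotv_le andbT lerNl -dotvNl -(enormN u) dotv_le. Qed.

Lemma enormD u v : enorm (u + v) <= enorm u + enorm v.
Proof.
rewrite -ler_sqr ?nnegrE ?addr_ge0 ?enorm_ge0 //.
rewrite sqr_enorm !(dotvDl, dotvDr) -!sqr_enorm (dotvC v u).
have := dotv_le u v; nra.
Qed.

Lemma enormB u v : enorm u - enorm v <= enorm (u - v).
Proof. by rewrite lerBlDr -{1}(subrK v u) enormD. Qed.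

Lemma enorm_triangle u v w : enorm (u - w) <= enorm (u - v) + enorm (v - w).
Proof. by rewrite -{1}(subrK v u) -addrA enormD. Qed.

Lemma enorm_sum I (r : seq I) (P : pred I) (F : I -> 'rV[R]_d) :
  enorm (\sum_(i <- r | P i) F i) <= \sum_(i <- r | P i) enorm (F i).
Proof.
elim/big_ind2 : _ => //; first by rewrite enorm0.
by move=> x1 x2 y1 y2 h1 h2; apply: le_trans (enormD _ _) (lerD h1 h2).
Qed.

Lemma enorm_le_sum v : enorm v <= \sum_(i < d) `|v 0 i|.
Proof.
rewrite [v in enorm v](row_sum_delta v); apply: (le_trans (enorm_sum _ _ _)).
apply: ler_sum => i _; rewrite enormZ ler_piMr //.
rewrite /enorm /dotv (bigD1 i) //= big1 ?addr0 ?mxE ?eqxx ?mulr1 ?sqrtr1 //.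
by move=> j ji; rewrite mxE (negPf ji) andbF mulr0.
Qed.

Lemma coord_le_norm v i : `|v 0 i| <= `|v|.
Proof.
have [->|/eqP ] := eqVneq v 0; first by rewrite mxE normr0.
move=> _; rewrite [`|v|]mx_normrE.
exact: (le_trans _ (le_bigmax _ _ (ord0, i))).
Qed.

Lemma enorm_le_norm v : enorm v <= d%:R * `|v|.
Proof.
apply: le_trans (enorm_le_sum v) _.
rewrite -[d in d%:R]card_ord -sum1_card natr_sum mulr_suml.
by apply: ler_sum => i _; rewrite mul1r coord_le_norm.
Qed.

Lemma norm_le_enorm v : `|v| <= enorm v.
Proof.
rewrite [`|v|]mx_normrE; apply/bigmax_leP; split; first exact: enorm_ge0.
by move=> [i j] _ /=; rewrite ord1 coord_le_enorm.
Qed.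

Lemma enorm_continuous : continuous (@enorm R d).
Proof.
move=> x; apply/(@cvgrPdist_le _ _ _ (nbhs x) (nbhs_filter x)) => e e0; near=> y.
have : enorm (x - y) <= e.
  apply: le_trans (enorm_le_norm _) _.
  apply: (@le_trans _ _ (d.+1%:R * `|x - y|)).
    by rewrite ler_wpM2r // ler_nat.
  rewrite -ler_pdivlMl //.
  apply: ltW; near: y; apply/nbhs_ballP; exists (d.+1%:R^-1 * e).
    by rewrite /= mulr_gt0 // invr_gt0.
  by move=> y; rewrite -ball_normE.
apply: le_trans.
by rewrite ler_norml lerNl opprB enormC enormB enormC enormB.
Unshelve. all: by end_near. Qed.

Lemma dotv_continuous (T : topologicalType) (f g : T -> 'rV[R]_d) x :
  {for x, continuous f} -> {for x, continuous g} ->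
  {for x, continuous (fun y => dotv (f y) (g y))}.
Proof.
move=> cf cg; rewrite /dotv.
apply: cvg_big => [|i _]; first exact: add_continuous.
by apply: cvgM; apply: (@continuous_comp _ _ _ _ (fun z : 'rV[R]_d => z 0 i)) => //;
  exact: coord_continuous.
Qed.

Lemma enorm_delta (i : 'I_d) : enorm (delta_mx 0 i : 'rV[R]_d) = 1.
Proof.
rewrite /enorm /dotv (bigD1 i) //= big1 => [|j ji]; rewrite !mxE eqxx.
  by rewrite eqxx mulr1 addr0 sqrtr1.
by rewrite (negbTE ji) mulr0.
Qed.

Lemma closed_enorm_ball (M : R) : closed [set x : 'rV[R]_d | enorm x <= M].
Proof.
apply: (@preimage_closed _ _ (@enorm R d) [set t : R | t <= M]); last exact: closed_le.
by move=> x _; exact: enorm_continuous.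
Qed.

Lemma compact_enorm_ball (M : R) : compact [set x : 'rV[R]_d | enorm x <= M].
Proof.
apply: bounded_closed_compact; last exact: closed_enorm_ball.
exists M; split; first exact: num_real.
move=> y My x /= xM; apply: le_trans (norm_le_enorm _) _.
by apply: le_trans xM (ltW My).
Qed.

End EuclideanNorm.

Section IntervalIntegral.
Context (R : realType).
Implicit Types (f g : R -> R) (a b c : R).

Let mu := @lebesgue_measure R.

Lemma continuous_itv_integrable f a b :
  continuous f -> mu.-integrable `[a, b] (EFin \o f).
Proof.
move=> cf; apply: continuous_compact_integrable; first exact: segment_compact.
exact: continuous_subspaceT.
Qed.

Definition itv_int f a b : R := \int[mu]_(x in `[a, b]) f x.

Lemma eq_itv_int f g a b : {in `[a, b], f =1 g} -> itv_int f a b = itv_int g a b.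
Proof.
by move=> fg; apply: eq_Rintegral => x; rewrite inE /= => xab; apply: fg.
Qed.

Lemma itv_intZl f a b c : continuous f ->
  itv_int (fun x => c * f x) a b = c * itv_int f a b.
Proof. by move=> cf; apply: RintegralZl => //; exact: continuous_itv_integrable. Qed.

Lemma itv_intD f g a b : continuous f -> continuous g ->
  itv_int (fun x => f x + g x) a b = itv_int f a b + itv_int g a b.
Proof. by move=> cf cg; apply: RintegralD => //; exact: continuous_itv_integrable. Qed.

Lemma itv_intxx f a : itv_int f a a = 0.
Proof. by rewrite /itv_int set_itv1 Rintegral_set1. Qed.

Lemma itv_int_shift f a b c : continuous f -> a <= b ->
  itv_int (fun x => f (x + c)) a b = itv_int f (a + c) (b + c).
Proof.
rewrite /itv_int.
move=> cf ab.
have dF : derive1 (fun x : R => x + c) = cst 1.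
  by apply/funext => x; rewrite derive1E deriveD ?derive_val ?addr0.
rewrite /Rintegral.
rewrite (@integration_by_substitution_increasing R (fun x => x + c) f a b) //.
- by congr fine; apply: eq_integral => x _ /=; rewrite !fctE dF mulr1.
- by move=> x y _ _; rewrite ltrD2r.
- by rewrite dF => x _; exact: cvg_cst.
- by rewrite dF; exact: is_cvg_cst.
- by rewrite dF; exact: is_cvg_cst.
- split => /=.
  + by move=> x _; apply: derivableD.
  + by apply: cvg_at_right_filter; apply: cvgD; [exact: cvg_id|exact: cvg_cst].
  + by apply: cvg_at_left_filter; apply: cvgD; [exact: cvg_id|exact: cvg_cst].
- exact: continuous_subspaceT.
Qed.

Lemma itv_int_refl f b : continuous f -> 0 <= b ->
  itv_int (fun x => f (b - x)) 0 b = itv_int f 0 b.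
Proof.
move=> cf b0.
have cfo : continuous (fun x => f (b - x)).
  move=> x; apply: continuous_comp; last exact: cf.
  by apply: continuousB; [exact: cvg_cst|exact: cvg_id].
have H := @itv_int_shift f (- b) 0 b cf; rewrite addNr add0r in H.
rewrite -H ?oppr_le0 // /itv_int /Rintegral.
have := @integration_by_substitution_oppr R (fun x => f (x + b)) 0 b b0.
rewrite oppr0 => -> //.
  by congr fine; apply: eq_integral => x _ /=; rewrite addrC.
apply: continuous_subspaceT => x; apply: continuous_comp; last exact: cf.
by apply: continuousD; [exact: cvg_id|exact: cvg_cst].
Qed.

Lemma itv_int_split f a b c : continuous f -> a <= c -> c <= b ->
  itv_int f a b = itv_int f a c + itv_int f c b.
Proof.
move=> cf ac cb; rewrite /itv_int.
have := @Rintegral_itvB R f (BLeft a) (BRight b) c (continuous_itv_integrable _ _ cf).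
rewrite !bnd_simp => /(_ ac cb) /eqP.
rewrite subr_eq addrC => /eqP ->; congr (_ + _).
apply: Rintegral_itv_obnd_cbnd.
apply: integrableS (continuous_itv_integrable c b cf) => //.
exact: subset_itv_oc_cc.
Qed.

Lemma itv_int_near f a b y e : continuous f -> a <= b ->
  (forall x, a <= x <= b -> `|f x - y| <= e) ->
  `|itv_int f a b - y * (b - a)| <= e * (b - a).
Proof.
move=> cf ab fy; rewrite /itv_int.
have mab : fine (mu `[a, b]%classic) = b - a.
  by rewrite /mu lebesgue_measure_itv /= lte_fin; case: ltgtP ab => //= -> _; rewrite subrr.
have icst r : mu.-integrable `[a, b] (EFin \o (fun=> r)).
  by apply: (@continuous_itv_integrable (fun=> r)) => x; exact: cvg_cst.
rewrite -mab -Rintegral_cst // -RintegralB //; last exact: continuous_itv_integrable.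
apply: le_trans (le_normr_Rintegral _ _) _ => //.
  by apply: (@continuous_itv_integrable (fun x => f x - y)) => x;
    apply: continuousB; [exact: cf|exact: cvg_cst].
rewrite -Rintegral_cst //; apply: le_Rintegral => //=.
  apply: (@continuous_itv_integrable (fun x => `|f x - y|)) => x.
  apply: (@continuous_comp _ _ _ (fun x => f x - y) Num.norm); last exact: norm_continuous.
  by apply: continuousB; [exact: cf|exact: cvg_cst].
Qed.

End IntervalIntegral.

Section LineIntegral.
Context (R : realType) (d : nat).
Implicit Types (Phi : 'rV[R]_d -> 'rV[R]_d) (a b c : 'rV[R]_d).

(* Zero when [a = b], since [0^-1 = 0]. *)
Definition dir a b : 'rV[R]_d := (enorm (b - a))^-1 *: (b - a).

Definition edge a b (t : R) : 'rV[R]_d := a + t *: dir a b.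

Definition line_int Phi a b : R :=
  itv_int (fun t => dotv (Phi (edge a b t)) (dir a b)) 0 (enorm (b - a)).

Lemma dirE a b : b - a = enorm (b - a) *: dir a b.
Proof.
have [->|ab] := eqVneq a b; first by rewrite subrr enorm0 scale0r.
by rewrite scalerA mulfV ?scale1r // enorm_eq0 subr_eq0 eq_sym.
Qed.

Lemma enorm_dir a b : a != b -> enorm (dir a b) = 1.
Proof.
move=> ab; rewrite enormZ ger0_norm ?invr_ge0 ?enorm_ge0 // mulVf //.
by rewrite enorm_eq0 subr_eq0 eq_sym.
Qed.

Lemma enorm_dir_le1 a b : enorm (dir a b) <= 1.
Proof.
have [->|ab] := eqVneq a b; last by rewrite enorm_dir.
by rewrite /dir subrr scaler0 enorm0 ler01.
Qed.

Lemma edge0 a b : edge a b 0 = a.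
Proof. by rewrite /edge scale0r addr0. Qed.

Lemma edge1 a b : edge a b (enorm (b - a)) = b.
Proof. by rewrite /edge -dirE addrC subrK. Qed.

Lemma dirN a b : dir b a = - dir a b.
Proof. by rewrite /dir enormC -scalerN opprB. Qed.

Lemma edge_continuous a b : continuous (edge a b).
Proof.
by move=> t; apply: cvgD; [exact: cvg_cst|apply: cvgZr_tmp; exact: cvg_id].
Qed.

Lemma line_continuous Phi a b : continuous Phi ->
  continuous (fun t => dotv (Phi (edge a b t)) (dir a b)).
Proof.
move=> cPhi t.
apply: (@dotv_continuous R d _ (Phi \o edge a b) (fun=> dir a b)); last exact: cvg_cst.
by apply: continuous_comp; [exact: edge_continuous|exact: cPhi].
Qed.

Lemma line_int_rev Phi a b : continuous Phi -> line_int Phi b a = - line_int Phi a b.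
Proof.
move=> cPhi; rewrite /line_int enormC.
rewrite -[in RHS]itv_int_refl ?enorm_ge0 //; last exact: line_continuous.
rewrite -[RHS]mulN1r -itv_intZl; last first.
  move=> t; apply: (@continuous_comp _ _ _ (fun t => enorm (b - a) - t)
    (fun t => dotv (Phi (edge a b t)) (dir a b))); last exact: line_continuous.
  by apply: continuousB; [exact: cvg_cst|exact: cvg_id].
apply: eq_itv_int => t _; rewrite mulN1r -dotvNr -dirN; congr (dotv (Phi _) _).
by rewrite /edge scalerBl -dirE addrA [a + _]addrC subrK dirN scalerN.
Qed.

(** The directions are compared for nondegenerate pieces only, because [dir] vanishes on degenerate
    ones. *)
Lemma on_segment a b c (t : R) : 0 <= t <= enorm (b - a) -> c = edge a b t ->
  [/\ enorm (c - a) = t, enorm (b - c) = enorm (b - a) - t,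
     c != a -> dir a c = dir a b & b != c -> dir c b = dir a b].
Proof.
move=> /andP[t0 tb] ->.
have [ab|ab] := eqVneq a b.
  move: tb; rewrite ab subrr enorm0 => tb.
  have -> : t = 0 by apply/le_anti/andP.
  by rewrite edge0 subrr enorm0 subr0 eqxx.
have ca : edge a b t - a = t *: dir a b by rewrite /edge addrC addKr.
have bc : b - edge a b t = (enorm (b - a) - t) *: dir a b.
  by rewrite scalerBl -dirE /edge opprD addrA.
have nca : enorm (edge a b t - a) = t by rewrite ca enormZ enorm_dir // mulr1 ger0_norm.
have nbc : enorm (b - edge a b t) = enorm (b - a) - t.
  by rewrite bc enormZ enorm_dir // mulr1 ger0_norm // subr_ge0.
split => // h.
- rewrite {1}/dir nca ca scalerA mulVf ?scale1r //.
  by rewrite -nca enorm_eq0 subr_eq0.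
- rewrite {1}/dir nbc bc scalerA mulVf ?scale1r //.
  by rewrite -nbc enorm_eq0 subr_eq0.
Qed.

Lemma line_intxx Phi a : line_int Phi a a = 0.
Proof. by rewrite /line_int subrr enorm0 itv_intxx. Qed.

Lemma line_intE Phi a b e l : dir a b = e -> enorm (b - a) = l ->
  line_int Phi a b = itv_int (fun t => dotv (Phi (a + t *: e)) e) 0 l.
Proof. by move=> <- <-. Qed.

Lemma line_int_split Phi a b (t : R) : continuous Phi -> 0 <= t <= enorm (b - a) ->
  line_int Phi a b = line_int Phi a (edge a b t) + line_int Phi (edge a b t) b.
Proof.
move=> cPhi tb; have /andP[t0 tl] := tb.
move: (on_segment tb erefl); set c := edge a b t => -[n1 n2 d1 d2].
have cE : c = a + t *: dir a b by [].
have [e|ne] := eqVneq c a; first by rewrite e line_intxx add0r.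
have [e|ne'] := eqVneq b c; first by rewrite -e line_intxx addr0.
have g1 : continuous (fun s : R => dotv (Phi (a + s *: dir a b)) (dir a b)).
  exact: line_continuous.
rewrite (line_intE _ erefl erefl) (line_intE _ (d1 ne) n1) (line_intE _ (d2 ne') n2).
move: {d1 d2 n1 n2 ne ne' tb} (dir a b) (enorm (b - a)) cE t0 tl g1 => e l cE t0 tl g1.
rewrite (@itv_int_split _ _ _ _ t) //; congr (_ + _).
have := @itv_int_shift R _ 0 (l - t) t g1.
rewrite subr_ge0 add0r subrK => <- //.
by apply: eq_itv_int => s _; rewrite cE -addrA -scalerDl (addrC t).
Qed.

(** Serves three purposes: [y = 0] bounds a line integral, [y = 0] with [e = 0] makes it vanish, and
    [y = Phi a] gives its first-order expansion. *)
Lemma line_int_near Phi a b y (e : R) : continuous Phi ->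
  (forall t, 0 <= t <= enorm (b - a) -> `|dotv (Phi (edge a b t) - y) (dir a b)| <= e) ->
  `|line_int Phi a b - dotv y (b - a)| <= e * enorm (b - a).
Proof.
move=> cPhi h.
have g1 : continuous (fun s : R => dotv (Phi (a + s *: dir a b)) (dir a b)).
  exact: line_continuous.
rewrite (line_intE _ erefl erefl) dirE dotvZr mulrC -dirE -[X in _ - _ * X]subr0.
rewrite -[X in e * X]subr0; apply: itv_int_near => //; first exact: enorm_ge0.
by move=> t ht; rewrite -dotvNl -dotvDl h.
Qed.

End LineIntegral.

(** * Closed polygons and good loops *)

Section PolygonalPaths.
Context (R : realType) (d : nat).
Notation V := 'rV[R]_d.
Local Opaque enorm dotv line_int itv_int.
Implicit Types (a b u w p q x : V) (s m : seq V) (r t : R).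

Fixpoint psum (f : V -> V -> R) a s : R :=
  if s is b :: s' then f a b + psum f b s' else 0.

Lemma psum_cat f a s1 s2 : psum f a (s1 ++ s2) = psum f a s1 + psum f (last a s1) s2.
Proof. by elim: s1 a => [|b s IH] a /=; rewrite ?add0r // IH addrA. Qed.

Lemma psum_ge0 f a s : (forall b c, 0 <= f b c) -> 0 <= psum f a s.
Proof. by move=> f0; elim: s a => //= b s IH a; rewrite addr_ge0. Qed.

Lemma ler_psum f g a s : (forall b c, f b c <= g b c) -> psum f a s <= psum g a s.
Proof. by move=> fg; elim: s a => //= b s IH a; rewrite lerD. Qed.

Definition plen := psum (fun a b => enorm (b - a)).

Definition pint Phi := psum (line_int Phi).

(** The length of the part of the edge inside [B], because [edge] has unit speed; it is zero for
    [a = b], where the interval is a point. *)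
Definition ecov (B : set V) a b : R :=
  fine (lebesgue_measure (`[0, enorm (b - a)] `&` edge a b @^-1` B)).

Definition pcov B := psum (ecov B).

Lemma plen_cat a s1 b s2 :
  plen a (s1 ++ b :: s2) = plen a s1 + (enorm (b - last a s1) + plen b s2).
Proof. exact: psum_cat. Qed.

Lemma pint_cat Phi a s1 b s2 :
  pint Phi a (s1 ++ b :: s2) = pint Phi a s1 + (line_int Phi (last a s1) b + pint Phi b s2).
Proof. exact: psum_cat. Qed.

Lemma pcov_cat B a s1 b s2 :
  pcov B a (s1 ++ b :: s2) = pcov B a s1 + (ecov B (last a s1) b + pcov B b s2).
Proof. exact: psum_cat. Qed.

Lemma plen_cons a b s : plen a (b :: s) = enorm (b - a) + plen b s.
Proof. by []. Qed.

Lemma pint_cons Phi a b s : pint Phi a (b :: s) = line_int Phi a b + pint Phi b s.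
Proof. by []. Qed.

Lemma pcov_cons B a b s : pcov B a (b :: s) = ecov B a b + pcov B b s.
Proof. by []. Qed.

Lemma plen_nil a : plen a [::] = 0. Proof. by []. Qed.

Lemma pint_nil Phi a : pint Phi a [::] = 0. Proof. by []. Qed.

Lemma pcov_nil B a : pcov B a [::] = 0. Proof. by []. Qed.

Definition touches (B : set V) a b :=
  exists2 t : R, 0 <= t <= enorm (b - a) & B (edge a b t).

Lemma plen_ge0 a s : 0 <= plen a s.
Proof. by apply: psum_ge0 => b c; exact: enorm_ge0. Qed.

Lemma eball_open x r : open (eball x r).
Proof.
have c : continuous (fun y : V => enorm (y - x)).
  move=> y; apply: (@continuous_comp _ _ _ (fun y : V => y - x) (@enorm R d)).
    apply: (@cvgB _ _ _ (nbhs y) (nbhs_filter y) id (fun=> x)); [exact: cvg_id|exact: cvg_cst].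
  exact: enorm_continuous.
by apply: (@open_comp _ _ _ [set t : R | t < r]) => [y _|]; [exact: c|exact: open_lt].
Qed.

Lemma edge_preimage_open (B : set V) a b : open B ->
  measurable (edge a b @^-1` B : set (measurableTypeR R)).
Proof.
move=> oB; apply: measurable_realfun.open_measurable; apply: open_comp => // t _.
exact: edge_continuous.
Qed.

Lemma ecov_ge0 B a b : 0 <= ecov B a b.
Proof. exact: fine_ge0. Qed.

Lemma fine_leb_itv (t1 t2 : R) : t1 <= t2 ->
  fine (lebesgue_measure (`[t1, t2]%classic : set (measurableTypeR R))) = t2 - t1.
Proof.
move=> t12; rewrite lebesgue_measure_itv /= lte_fin.
by case: ltgtP t12 => //= -> _; rewrite subrr.
Qed.

Lemma fine_leb_le (A : set (measurableTypeR R)) (t1 t2 : R) : t1 <= t2 ->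
  measurable A -> A `<=` `[t1, t2] -> fine (lebesgue_measure A) <= t2 - t1.
Proof.
move=> t12 mA sA; rewrite -fine_leb_itv //.
have lty : (lebesgue_measure (`[t1, t2]%classic : set (measurableTypeR R)) < +oo)%E.
  by rewrite lebesgue_measure_itv; case: ifP => //= _; rewrite ltry.
have leA : (lebesgue_measure A <= lebesgue_measure (`[t1, t2]%classic : set (measurableTypeR R)))%E.
  by apply: le_measure; rewrite ?inE.
by apply: fine_le => //; rewrite ge0_fin_numE // (le_lt_trans leA).
Qed.

Lemma ecov_le_len B a b : measurable (edge a b @^-1` B : set (measurableTypeR R)) ->
  ecov B a b <= enorm (b - a).
Proof.
move=> mB; rewrite -[leRHS]subr0; apply: fine_leb_le; first exact: enorm_ge0.
  exact: measurableI.
exact: subIsetl.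
Qed.

Lemma ecov_untouched B a b : ~ touches B a b -> ecov B a b = 0.
Proof.
move=> nt; rewrite /ecov (_ : _ `&` _ = set0) ?measure0 //.
rewrite -subset0 => t /= []; rewrite in_itv /= => tab Bt.
by apply: nt; exists t.
Qed.

Lemma edgeB a b t t' : edge a b t - edge a b t' = (t - t') *: dir a b.
Proof. by rewrite /edge scalerBl opprD addrACA subrr add0r. Qed.

(** Two points of the ball are less than [2 * r] apart, so by unit speed all parameters in question
    lie within [2 * r] of a single one. *)
Lemma ecov_eball a b x r : 0 < r -> ecov (eball x r) a b <= 4 * r.
Proof.
move=> r0; have [[t0 ht0 Bt0]|/ecov_untouched ->] := pselect (touches (eball x r) a b); last first.
  by rewrite mulr_ge0 // ltW.
have -> : 4 * r = (t0 + 2 * r) - (t0 - 2 * r) by ring.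
apply: fine_leb_le; first by lra.
  by apply: measurableI => //; apply: edge_preimage_open; exact: eball_open.
move=> t /= []; rewrite !in_itv /= => ht Bt.
have h : `|t - t0| <= 2 * r.
  have [ab|ab] := eqVneq a b.
    move: ht ht0; rewrite ab subrr enorm0 => /le_anti <- /le_anti <-.
    by rewrite subrr normr0 mulr_ge0 // ltW.
  have -> : `|t - t0| = enorm (edge a b t - edge a b t0).
    by rewrite edgeB enormZ enorm_dir // mulr1.
  have := enorm_triangle (edge a b t) x (edge a b t0).
  move: Bt Bt0; rewrite /eball /= [enorm (x - _)]enormC; lra.
by move: h; rewrite ler_norml; lra.
Qed.

Lemma first_touched B a s : pcov B a s = 0 \/
  exists s1 b s2, [/\ s = s1 ++ b :: s2, pcov B a s1 = 0 & touches B (last a s1) b].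
Proof.
elim: s a => [|b s IH] a; first by left.
have [t|nt] := pselect (touches B a b).
  by right; exists [::], b, s.
have [h|[s1 [c [s2 [-> h1 h2]]]]] := IH b.
  by left; rewrite /pcov /= ecov_untouched // add0r.
right; exists (b :: s1), c, s2; split => //.
by rewrite /pcov /= ecov_untouched // add0r.
Qed.

Lemma last_touched B a s : pcov B a s = 0 \/
  exists s1 b s2, [/\ s = s1 ++ b :: s2, pcov B b s2 = 0 & touches B (last a s1) b].
Proof.
elim: s a => [|b s IH] a; first by left.
have [h|[s1 [c [s2 [-> h1 h2]]]]] := IH b; last by right; exists (b :: s1), c, s2.
have [t|nt] := pselect (touches B a b); first by right; exists [::], b, s.
by left; rewrite /pcov /= ecov_untouched // add0r.
Qed.

(* Two points of non-neighbouring edges that are much closer to each other than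
   the part of the path between these edges is long. *)
Definition shortcut a s (n : nat) := exists s1 u m w s2 (t t' : R),
  [/\ s = s1 ++ u :: m ++ w :: s2, size m = n.+2,
      0 <= t <= enorm (u - last a s1), 0 <= t' <= enorm (w - last u m)
    & 2 * enorm (edge (last a s1) u t - edge (last u m) w t') < plen u m].

Lemma pcov_le_plen B a s : open B -> pcov B a s <= plen a s.
Proof. by move=> oB; apply: ler_psum => b c; apply: ecov_le_len; exact: edge_preimage_open. Qed.

Local Opaque ecov pcov plen pint edge dir.

(** The first and the last edge that touch [B] contribute at most [4 * r] each. They contain points
    less than [2 * r] apart, so the path between them is at most [4 * r] long, since otherwise these
    points would span a shortcut. *)
Lemma pcov_no_shortcut (B : set V) a s r : open B -> 0 < r ->
  (forall b c, ecov B b c <= 4 * r) ->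
  (forall p q, B p -> B q -> enorm (p - q) < 2 * r) ->
  (forall n, ~ shortcut a s n) -> pcov B a s <= 12 * r.
Proof.
move=> oB r0 eB dB ns.
have r12 : 0 <= 12 * r by rewrite mulr_ge0 // ltW.
have [->|[s1 [u [rest [es h1 [t ht Bt]]]]]] := first_touched B a s; first exact: r12.
rewrite es pcov_cat h1 add0r.
have eu := eB (last a s1) u.
have [->|[m [w [s2 [er h2 [t' ht' Bt']]]]]] := last_touched B u rest.
  by rewrite addr0 (le_trans eu) // ler_pM2r // ler_nat.
rewrite er pcov_cat h2 addr0.
have ew := eB (last u m) w.
suff : pcov B u m <= 4 * r by move: eu ew; lra.
(* With at most one edge in between, the bound for a single edge suffices, so [shortcut] can insist
   on two or more. *)
have [sm|] := ltnP (size m) 2.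
  case: m sm {er ht' Bt' ew} => [|c [|//]] _; first by rewrite mulr_ge0 // ltW.
  by rewrite pcov_cons pcov_nil addr0 eB.
case em : (size m) => [|[|n]] // _.
apply: (@le_trans _ _ (plen u m)); first exact: pcov_le_plen.
rewrite leNgt; apply/negP => lm; apply: (ns n).
exists s1, u, m, w, s2, t, t'; split => //; first by rewrite es er.
by apply: le_lt_trans lm; have := dB _ _ Bt Bt'; lra.
Qed.

Lemma pcov_ball_no_shortcut a s x r : 0 < r -> (forall n, ~ shortcut a s n) ->
  pcov (eball x r) a s <= 12 * r.
Proof.
move=> r0; apply: pcov_no_shortcut => //; first exact: eball_open.
  by move=> b c; apply: ecov_eball.
move=> p q; rewrite /eball /= => hp hq.
by have := enorm_triangle p x q; rewrite [enorm (x - q)]enormC; lra.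
Qed.

Definition good a s := forall x r, 0 < r -> pcov (eball x r) a s <= 1000 * r.

(** The three edges that close the path add at most [4 * r] each to its [12 * r]. *)
Lemma good_loop p q u m : (forall n, ~ shortcut u m n) -> good p (u :: m ++ [:: q; p]).
Proof.
move=> ns x r r0; rewrite pcov_cons (pcov_cat _ _ m q [:: p]) pcov_cons.
have e1 := ecov_eball p u x r0.
have e2 := ecov_eball (last u m) q x r0.
have e3 := ecov_eball q p x r0.
have e4 := pcov_ball_no_shortcut x r0 ns.
rewrite pcov_nil; apply: (@le_trans _ _ (24 * r)); last by rewrite ler_pM2r // ler_nat.
move: e1 e2 e3 e4; move: (ecov _ p u) (ecov _ (last u m) q) (ecov _ q p) (pcov _ u m).
by move=> x1 x2 x3 x4; lra.
Qed.

Lemma shortcut_sub a s1 u m s2 n : shortcut u m n -> shortcut a (s1 ++ u :: m ++ s2) n.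
Proof.
move=> [s1' [u' [m' [w' [s2' [z [z' [em sm' hz hz' sc']]]]]]]].
exists (s1 ++ u :: s1'), u', m', w', (s2' ++ s2), z, z'; split => //.
- by rewrite em -!catA /= -!catA /=.
- by rewrite last_cat.
- by rewrite last_cat.
Qed.

Lemma shortcut_size a s n : shortcut a s n -> (n.+3 < size s)%N.
Proof.
move=> [s1' [u' [m' [w' [s2' [z [z' [-> sm' _ _ _]]]]]]]].
by rewrite size_cat /= size_cat /= sm'; lia.
Qed.

Context (Phi : V -> V) (lam : R).
Hypothesis cPhi : continuous Phi.
Hypothesis lam0 : 0 <= lam.
Hypothesis good_le : forall a s, last a s = a -> good a s -> pint Phi a s <= lam * plen a s.

(* The loop cut off along a shortcut with the fewest intermediate edges has no
   shortcut between intermediate edges, hence is good; its length, at most 3/2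
   of the arc [l] it replaces, is paid for by the decrease, at least [l / 2], of
   the length of what remains. *)
Lemma closed_pint_le a s : last a s = a -> pint Phi a s <= 3 * lam * plen a s.
Proof.
move: {2}(size s).+1 (ltnSn (size s)) => N; elim: N a s => // N IH a s sN cl.
have [ex|nex] := pselect (exists n, `[< shortcut a s n >]); last first.
  apply: le_trans (good_le cl _) _.
    move=> x r r0; apply: le_trans (pcov_ball_no_shortcut x r0 _) _.
      by move=> n sn; apply: nex; exists n; apply/asboolP.
    by rewrite ler_pM2r // ler_nat.
  by rewrite ler_wpM2r ?plen_ge0 // ler_peMl // ler1n.
case: (ex_minnP ex) => n /asboolP [s1 [u [m [w [s2 [t [t' [es sm ht ht' sc]]]]]]]] min.
have loop_good p q : good p (u :: m ++ [:: q; p]).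
  apply: good_loop => k sk.
  have : (n <= k)%N.
    by apply: min; apply/asboolP; rewrite es; exact: shortcut_sub.
  by have := shortcut_size sk; rewrite sm; lia.
have [l1 l2 _ _] := on_segment ht erefl.
have [l1' l2' _ _] := on_segment ht' erefl.
have i1 := line_int_split cPhi ht.
have i2 := line_int_split cPhi ht'.
move: (edge (last a s1) u t) (edge (last u m) w t') l1 l2 l1' l2' i1 i2 sc => p q l1 l2 l1' l2' i1 i2 sc.
have i3 : line_int Phi q p = - line_int Phi p q by apply: line_int_rev.
have loop_closed : last p (u :: m ++ [:: q; p]) = p by rewrite /= last_cat.
have H1 := good_le loop_closed (loop_good p q).
have rest_closed : last a (s1 ++ [:: p, q, w & s2]) = a.
  by rewrite last_cat /= -[RHS]cl es last_cat /= last_cat.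
have H2 : pint Phi a (s1 ++ [:: p, q, w & s2]) <= 3 * lam * plen a (s1 ++ [:: p, q, w & s2]).
  (* The [n + 4] vertices from [u] to [w] give way to [p], [q], [w]. The list becomes shorter
     because a shortcut skips at least two edges. *)
  apply: IH rest_closed.
  by move: sN; rewrite es !size_cat /= size_cat /= sm; lia.
move: H1 H2; rewrite es !pint_cat !plen_cat !pint_cons !plen_cons !pint_cat !plen_cat !pint_cons !plen_cons.
rewrite i1 i2 i3 l1 l2 l1' l2'.
rewrite pint_nil plen_nil.
move: sc; rewrite [enorm (p - q)]enormC.
move: ht ht' => /andP[ht1 ht2] /andP[ht1' ht2'].
move: {i1 i2 i3 l1 l2 l1' l2'} (plen u m) (enorm (q - p)) (plen a s1) (plen w s2) (enorm (u - last a s1)) (enorm (w - last u m)) ht2 ht2' => M D L1 L2 A B ht2 ht2' sc.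
(* Twice this quantity is the slack left when the loop is paid at rate [lam] and the rest, with the
   shortcut inserted, at rate [3 * lam]. *)
have : 0 <= lam * (M - 2 * D + (A - t) + t') by apply: mulr_ge0 => //; lra.
move: (line_int _ _ _) (line_int _ _ _) (line_int _ _ _) => x1 x2 x3.
lra.
Qed.

End PolygonalPaths.

(** * Integrals against vector measures *)

Lemma fin_num_subC (R : realDomainType) (x y a b : \bar R) :
  x \is a fin_num -> y \is a fin_num -> a \is a fin_num -> b \is a fin_num ->
  (a - b = x - y -> x + b = y + a)%E.
Proof.
case: x y a b => [x||] [y||] [a||] [b||] // _ _ _ _ [H].
by congr EFin; lra.
Qed.

Lemma fine_addC (R : realDomainType) (x y a b : \bar R) :
  x \is a fin_num -> y \is a fin_num -> a \is a fin_num -> b \is a fin_num ->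
  (x + b = y + a)%E -> fine x - fine y = fine a - fine b.
Proof. by case: x y a b => [x||] [y||] [a||] [b||] // _ _ _ _ [H] /=; lra. Qed.

Section ChargeIntegral.
Context (R : realType) (d : nat).
Notation V := 'rV[R]_d.
Notation T := (borel R d).
Implicit Types (nu : {charge set T -> \bar R}) (m : {finite_measure set T -> \bar R}).
Implicit Types (f g : T -> R) (c M : R).

Definition bmeas f := measurable_fun setT f /\ exists M, forall x, `|f x| <= M.

Lemma bmeas_integrable f (m : {measure set T -> \bar R}) : (m setT < +oo)%E -> bmeas f ->
  m.-integrable setT (EFin \o f).
Proof.
move=> moo [mf [M fM]]; apply: measurable_bounded_integrable => //.
exists M; split; first exact: num_real.
by move=> x Mx y _ /=; apply: le_trans (fM _) (ltW Mx).
Qed.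

Lemma bmeasD f g : bmeas f -> bmeas g -> bmeas (fun x => f x + g x).
Proof.
move=> [mf [M fM]] [mg [N gN]]; split; first exact: measurable_funD.
by exists (M + N) => x; apply: le_trans (ler_normD _ _) (lerD _ _).
Qed.

Lemma bmeasZ c f : bmeas f -> bmeas (fun x => c * f x).
Proof.
move=> [mf [M fM]]; split; first exact: measurable_funM.
by exists (`|c| * M) => x; rewrite normrM ler_wpM2l.
Qed.

Lemma bmeas_indic (A : set T) : measurable A -> bmeas (\1_A : T -> R).
Proof.
move=> mA; split; first exact: measurable_indic.
by exists 1 => x; rewrite indicE; case: (_ \in _); rewrite ?normr1 ?normr0.
Qed.

Lemma continuous_borel_measurable (f : V -> R) : continuous f ->
  measurable_fun setT (f : T -> R).
Proof.
move=> cf; apply: (measurability (@RGenOInfty.G R)); first exact: RGenOInfty.measurableE.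
move=> _ [_ [x ->] <-]; rewrite setTI; apply: sub_sigma_algebra.
by move/continuousP : cf; apply; rewrite set_itvE; exact: open_gt.
Qed.

(** From [p - n = m1 - m2] follows [p + m2 = n + m1], an identity between measures, which can be
    integrated. So the Jordan parts may be replaced by any two finite measures with difference [nu],
    and linearity in [nu] becomes easy. *)
Lemma charge_integralE nu (m1 m2 : {measure set T -> \bar R}) f :
  (m1 setT < +oo)%E -> (m2 setT < +oo)%E ->
  (forall A, measurable A -> nu A = (m1 A - m2 A)%E) -> bmeas f ->
  charge_integral nu (f : V -> R) = Rintegral m1 setT f - Rintegral m2 setT f.
Proof.
move=> m1y m2y nuE bf; rewrite /charge_integral.
cbv zeta; move: (projT2 (cid (projT2 (cid (Hahn_decomposition nu))))) => h.
pose p : {finite_measure set T -> \bar R} := jordan_pos h.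
pose n : {finite_measure set T -> \bar R} := jordan_neg h.
have fin (m : {measure set T -> \bar R}) : (m setT < +oo)%E ->
    (\int[m]_x (f x)%:E)%E \is a fin_num.
  by move=> my; apply: integrable_fin_num => //; exact: bmeas_integrable.
have finm (m : {measure set T -> \bar R}) A : (m setT < +oo)%E -> measurable A -> m A \is a fin_num.
  move=> my mA; rewrite ge0_fin_numE //; apply: le_lt_trans my.
  by apply: le_measure; rewrite ?inE.
have py : (p setT < +oo)%E by rewrite -ge0_fin_numE // fin_num_measure.
have ny : (n setT < +oo)%E by rewrite -ge0_fin_numE // fin_num_measure.
have pn A : measurable A -> measure_add p m2 A = measure_add n m1 A.
  move=> mA; rewrite !measure_addE.
  have := jordan_decomp h mA; rewrite /cadd /= cscaleN1 nuE //.
  rewrite -[jordan_pos h A]/(p A) -[jordan_neg h A]/(n A).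
  by apply: fin_num_subC; rewrite ?finm.
have H : (\int[measure_add p m2]_x (f x)%:E = \int[measure_add n m1]_x (f x)%:E)%E.
  by apply: eq_measure_integral => A mA _; exact: pn.
have mf : measurable_fun setT (EFin \o f) by apply/measurable_EFinP; case: bf.
rewrite !integral_measure_add // in H; try exact: bmeas_integrable.
rewrite /Rintegral -/p -/n.
by apply: fine_addC H; apply: fin.
Qed.

Lemma charge_decomp nu : exists m1 m2 : {finite_measure set T -> \bar R},
  [/\ (m1 setT < +oo)%E, (m2 setT < +oo)%E &
    forall A, measurable A -> nu A = (m1 A - m2 A)%E].
Proof.
have [P [N h]] := Hahn_decomposition nu.
exists (jordan_pos h), (jordan_neg h); split => [||A mA].
- by rewrite -ge0_fin_numE // fin_num_measure.
- by rewrite -ge0_fin_numE // fin_num_measure.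
by rewrite (jordan_decomp h mA) /cadd /= cscaleN1.
Qed.

Lemma charge_integralD nu f g : bmeas f -> bmeas g ->
  charge_integral nu (fun x => f x + g x : R) =
  charge_integral nu (f : V -> R) + charge_integral nu (g : V -> R).
Proof.
move=> bf bg; have [m1 [m2 [m1y m2y nuE]]] := charge_decomp nu.
rewrite !(charge_integralE m1y m2y nuE) //; last exact: bmeasD.
rewrite !RintegralD //; try exact: bmeas_integrable.
by rewrite opprD addrACA.
Qed.

Lemma charge_integralZ nu f c : bmeas f ->
  charge_integral nu (fun x => c * f x : R) = c * charge_integral nu (f : V -> R).
Proof.
move=> bf; have [m1 [m2 [m1y m2y nuE]]] := charge_decomp nu.
rewrite !(charge_integralE m1y m2y nuE) //; last exact: bmeasZ.
rewrite !RintegralZl //; try exact: bmeas_integrable.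
by rewrite mulrBr.
Qed.

Lemma charge_integral_indic nu (A : set T) : measurable A ->
  charge_integral nu (\1_A : V -> R) = fine (nu A).
Proof.
move=> mA; have [m1 [m2 [m1y m2y nuE]]] := charge_decomp nu.
rewrite (charge_integralE m1y m2y nuE); last exact: bmeas_indic.
rewrite /Rintegral !integral_indic // !setIT nuE // fineB //; exact: fin_num_measure.
Qed.

(** A crude bound by the masses of two measures with difference [nu]. It controls uniform
    approximation errors before the sharp bound by the total variation is available. *)
Lemma charge_integral_bound nu : exists2 C : R, 0 <= C &
  forall f M, bmeas f -> (forall x, `|f x| <= M) -> `|charge_integral nu (f : V -> R)| <= M * C.
Proof.
have [m1 [m2 [m1y m2y nuE]]] := charge_decomp nu.
exists (fine (m1 setT) + fine (m2 setT)); first by rewrite addr_ge0 // fine_ge0.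
move=> f M bf fM; rewrite (charge_integralE m1y m2y nuE) //.
have B (m : {finite_measure set T -> \bar R}) : (m setT < +oo)%E -> `|Rintegral m setT f| <= M * fine (m setT).
  move=> my; apply: le_trans (le_normr_Rintegral _ _) _ => //; first exact: bmeas_integrable.
  rewrite -Rintegral_cst //; apply: le_Rintegral => //.
    apply: (@bmeas_integrable (fun x => `|f x|)) => //; case: bf => mf _; split.
      exact: measurableT_comp.
    by exists M => x; rewrite normr_id.
  apply: (@bmeas_integrable (fun x => M)) => //; split; first exact: measurable_cst.
  by exists `|M|.
by rewrite mulrDr (le_trans (ler_normB _ _)) // lerD // B.
Qed.

Lemma charge_integral_cadd (nu1 nu2 : {charge set T -> \bar R}) f : bmeas f ->
  charge_integral (cadd nu1 nu2) (f : V -> R) =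
  charge_integral nu1 (f : V -> R) + charge_integral nu2 (f : V -> R).
Proof.
move=> bf; have [p1 [n1 [p1y n1y E1]]] := charge_decomp nu1.
have [p2 [n2 [p2y n2y E2]]] := charge_decomp nu2.
have bi (m : {finite_measure set T -> \bar R}) : m.-integrable setT (EFin \o f).
  by apply: bmeas_integrable => //; rewrite -ge0_fin_numE // fin_num_measure.
have mf : measurable_fun setT (EFin \o f) by apply/measurable_EFinP; case: bf.
have Rm (m m' : {finite_measure set T -> \bar R}) :
    Rintegral (measure_add m m') setT f = Rintegral m setT f + Rintegral m' setT f.
  rewrite /Rintegral (integral_measure_add measurableT (bi m) (bi m')).
  by rewrite fineD //; exact: (integrable_fin_num measurableT (bi _)).
rewrite (@charge_integralE _ (measure_add p1 p2) (measure_add n1 n2)) //.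
- rewrite (charge_integralE p1y n1y E1) // (charge_integralE p2y n2y E2) //.
  by rewrite !Rm opprD addrACA.
- by change (measure_add p1 p2 setT < +oo)%E; rewrite measure_addE; apply: lte_add_pinfty.
- by change (measure_add n1 n2 setT < +oo)%E; rewrite measure_addE; apply: lte_add_pinfty.
- move=> A mA; change (cadd nu1 nu2 A = measure_add p1 p2 A - measure_add n1 n2 A)%E.
  rewrite (measure_addE p1 p2) (measure_addE n1 n2).
  rewrite /cadd E1 // E2 // fin_num_oppeD ?fin_num_measure //.
  by rewrite addeACA.
Qed.

Lemma Rintegral_mscale (c : {nonneg R}) (m : {finite_measure set T -> \bar R}) f : bmeas f ->
  Rintegral (mscale c m) setT f = c%:num * Rintegral m setT f.
Proof.
move=> bf.
have my : (m setT < +oo)%E by rewrite -ge0_fin_numE // fin_num_measure.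
have mf : measurable_fun setT (EFin \o f) by apply/measurable_EFinP; case: bf.
have bi := bmeas_integrable my bf.
rewrite /Rintegral integralE [in RHS]integralE.
rewrite !ge0_integral_mscale //; [|exact: measurable_funeneg|exact: measurable_funepos].
have fp := integrable_pos_fin_num measurableT bi.
have fn := integrable_neg_fin_num measurableT bi.
by rewrite -muleBr ?fin_num_adde_defl ?fin_numN // fineM // fin_numD fp fin_numN.
Qed.

Lemma charge_integral_cscale c nu f : bmeas f ->
  charge_integral (cscale c nu) (f : V -> R) = c * charge_integral nu (f : V -> R).
Proof.
move=> bf; have [p [n [py ny E]]] := charge_decomp nu.
have my (k : {nonneg R}) (m : {finite_measure set T -> \bar R}) : (mscale k m setT < +oo)%E.
  by rewrite /mscale /= -ge0_fin_numE ?mule_ge0 // fin_numM // fin_num_measure.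
have fm (m : {finite_measure set T -> \bar R}) A : measurable A -> m A \is a fin_num.
  exact: fin_num_measure.
have [c0|c0] := leP 0 c.
  rewrite (@charge_integralE _ (mscale (NngNum c0) p) (mscale (NngNum c0) n) f (my _ _) (my _ _)) //.
    by rewrite (charge_integralE py ny E) // !Rintegral_mscale //= mulrBr.
  move=> A mA; change (c%:E * nu A = c%:E * p A - c%:E * n A)%E; rewrite E //.
  move: (fm p A mA) (fm n A mA); case: (p A) => [x||] //; case: (n A) => [y||] // _ _.
  exact: (congr1 EFin (mulrBr c x y)).
have c1 : 0 <= - c by rewrite oppr_ge0 ltW.
rewrite (@charge_integralE _ (mscale (NngNum c1) n) (mscale (NngNum c1) p) f (my _ _) (my _ _)) //.
  by rewrite (charge_integralE py ny E) // !Rintegral_mscale //=; ring.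
move=> A mA; change (c%:E * nu A = (- c)%:E * n A - (- c)%:E * p A)%E; rewrite E //.
move: (fm p A mA) (fm n A mA); case: (p A) => [x||] //; case: (n A) => [y||] // _ _.
have H : c * (x - y) = - c * y - - c * x by ring.
exact: (congr1 EFin H).
Qed.

Lemma charge_integral_finite_measure m f : bmeas f ->
  charge_integral (charge_of_finite_measure m) (f : V -> R) = Rintegral m setT f.
Proof.
move=> bf.
have zy : ((mzero : {measure set T -> \bar R}) setT < +oo)%E by exact: ltry.
have my : (m setT < +oo)%E by rewrite -ge0_fin_numE // fin_num_measure.
rewrite (@charge_integralE _ m mzero f my zy) //.
  by rewrite /Rintegral integral_measure_zero /= subr0.
by move=> A mA; change (m A = m A - 0)%E; rewrite sube0.
Qed.

Lemma charge_integral_czero f : bmeas f ->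
  charge_integral (czero : {charge set T -> \bar R}) (f : V -> R) = 0.
Proof.
move=> bf.
have zy : ((mzero : {measure set T -> \bar R}) setT < +oo)%E by exact: ltry.
rewrite (@charge_integralE _ mzero mzero f zy zy) ?subrr //.
by move=> A mA; change (0 = 0 - 0 :> \bar R)%E; rewrite sube0.
Qed.

End ChargeIntegral.

Section VectorIntegral.
Context (R : realType) (d : nat).
Notation V := 'rV[R]_d.
Notation T := (borel R d).
Implicit Types (mu nu F : vmeasure R d) (Phi Psi : V -> V) (c K : R).

Local Opaque charge_integral.

Definition bfield Phi := forall i, bmeas (fun x : T => Phi x 0 i).

Lemma bfield_continuous Phi K : continuous Phi -> (forall x, enorm (Phi x) <= K) ->
  bfield Phi.
Proof.
move=> cPhi PhiK i; split.
  apply: continuous_borel_measurable => x.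
  apply: (@continuous_comp _ _ _ Phi (fun z : V => z 0 i)); first exact: cPhi.
  exact: coord_continuous.
by exists K => x; apply: le_trans (coord_le_enorm _ _) (PhiK x).
Qed.

Lemma bfieldD Phi Psi : bfield Phi -> bfield Psi -> bfield (fun x => Phi x + Psi x).
Proof.
move=> b1 b2 i; have := bmeasD (b1 i) (b2 i).
by congr bmeas; apply/funext => x; rewrite mxE.
Qed.

Lemma bfieldZ c Phi : bfield Phi -> bfield (fun x => c *: Phi x).
Proof.
move=> b i; have := bmeasZ c (b i).
by congr bmeas; apply/funext => x; rewrite mxE.
Qed.

Lemma vintegralD mu Phi Psi : bfield Phi -> bfield Psi ->
  vintegral mu (fun x => Phi x + Psi x) = vintegral mu Phi + vintegral mu Psi.
Proof.
move=> b1 b2; rewrite /vintegral -big_split; apply: eq_bigr => i _ /=.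
rewrite -charge_integralD //; congr charge_integral.
by apply/funext => x; rewrite mxE.
Qed.

Lemma vintegralZ mu c Phi : bfield Phi ->
  vintegral mu (fun x => c *: Phi x) = c * vintegral mu Phi.
Proof.
move=> b; rewrite /vintegral mulr_sumr; apply: eq_bigr => i _ /=.
rewrite -charge_integralZ //; congr charge_integral.
by apply/funext => x; rewrite mxE.
Qed.

Lemma vintegralN mu Phi : bfield Phi ->
  vintegral mu (fun x => - Phi x) = - vintegral mu Phi.
Proof.
move=> b; rewrite -mulN1r -vintegralZ //; congr vintegral.
by apply/funext => x; rewrite scaleN1r.
Qed.

Lemma bfield0 : bfield (fun=> 0).
Proof. by apply: (@bfield_continuous _ 0) => [|x]; [exact: cst_continuous|rewrite enorm0]. Qed.

Lemma vintegral0 mu : vintegral mu (fun=> 0) = 0.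
Proof.
have := vintegralZ mu 0 bfield0; rewrite mul0r => <-; congr vintegral.
by apply/funext => x; rewrite scale0r.
Qed.

Lemma bfield_sum (I : Type) (r : seq I) (P : I -> V -> V) :
  (forall i, bfield (P i)) -> bfield (fun x => \sum_(i <- r) P i x).
Proof.
move=> b; elim: r => [|i r IH].
  by have := bfield0; congr bfield; apply/funext => x; rewrite big_nil.
have := bfieldD (b i) IH; congr bfield.
by apply/funext => x; rewrite big_cons.
Qed.

Lemma vintegral_sum mu (I : Type) (r : seq I) (P : I -> V -> V) :
  (forall i, bfield (P i)) ->
  vintegral mu (fun x => \sum_(i <- r) P i x) = \sum_(i <- r) vintegral mu (P i).
Proof.
move=> b; elim: r => [|i r IH].
  rewrite big_nil -(vintegral0 mu); congr vintegral.
  by apply/funext => x; rewrite big_nil.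
rewrite big_cons -IH -vintegralD //; last exact: bfield_sum.
by congr vintegral; apply/funext => x; rewrite big_cons.
Qed.

Lemma vintegral_vadd mu nu Phi : bfield Phi ->
  vintegral (vadd mu nu) Phi = vintegral mu Phi + vintegral nu Phi.
Proof.
move=> b; rewrite /vintegral -big_split; apply: eq_bigr => i _ /=.
exact: charge_integral_cadd.
Qed.

Lemma vintegral_vscale c mu Phi : bfield Phi ->
  vintegral (vscale c mu) Phi = c * vintegral mu Phi.
Proof.
move=> b; rewrite /vintegral mulr_sumr; apply: eq_bigr => i _.
exact: charge_integral_cscale.
Qed.

Lemma vintegral_vzero Phi : bfield Phi -> vintegral (@vzero R d) Phi = 0.
Proof. by move=> b; apply: big1 => i _; apply: charge_integral_czero; exact: (b i). Qed.

Lemma vvariation_ge0 F : (0 <= vvariation F setT)%E.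
Proof.
pose P (k : nat) : set T := if k is 0%N then setT else set0.
apply: (@le_trans _ _ (\sum_(0 <= k <oo) (enorm (vvalue F (P k)))%:E)%E).
  by apply: nneseries_ge0 => k _ _; rewrite lee_fin enorm_ge0.
apply: ereal_sup_ubound; exists P; split => //.
- by move=> [|k]; [exact: measurableT|exact: measurable0].
- by apply/trivIsetP => -[|i] [|j] // _ _ _; rewrite /P ?set0I ?setI0.
- by rewrite -subTset => x _; exists 0%N.
Qed.

(** The norm of a value of [F] is at most the sum of its coordinates in absolute value, hence at
    most the value of a finite measure, which is countably additive over partitions. *)
Lemma vvariation_lty F : (vvariation F setT < +oo)%E.
Proof.
pose m i := sval (cid (charge_decomp (F i))).
pose n i := sval (cid (svalP (cid (charge_decomp (F i))))).
have mn i : [/\ (m i setT < +oo)%E, (n i setT < +oo)%E &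
    forall A, measurable A -> F i A = (m i A - n i A)%E].
  exact: (svalP (cid (svalP (cid (charge_decomp (F i)))))).
apply: (@le_lt_trans _ _ (\sum_(i < d) (m i setT + n i setT))%E); last first.
  by apply/lte_sum_pinfty => i _; have [? ? _] := mn i; apply: lte_add_pinfty.
apply: ge_ereal_sup => _ [P [mP tP PT ->]].
have fm i k : m i (P k) \is a fin_num by apply: fin_num_measure.
have fn i k : n i (P k) \is a fin_num by apply: fin_num_measure.
have le k : ((enorm (vvalue F (P k)))%:E <= \sum_(i < d) (m i (P k) + n i (P k)))%E.
  apply: (@le_trans _ _ (\sum_(i < d) `|vvalue F (P k) 0 i|%:E)%E).
    by rewrite sumEFin lee_fin; apply: enorm_le_sum.
  apply: lee_sum => i _; rewrite mxE; have [_ _ ->] := mn i; last exact: mP.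
  have x0 : (0 <= m i (P k))%E := measure_ge0 _ _.
  have y0 : (0 <= n i (P k))%E := measure_ge0 _ _.
  move: x0 y0; move: (fm i k) (fn i k); case: (m i (P k)) => [x||] //; case: (n i (P k)) => [y||] //= _ _.
  rewrite -EFinD !lee_fin => x0 y0.
  by apply: le_trans (ler_normB _ _) _; rewrite (ger0_norm x0) (ger0_norm y0).
apply: (le_trans (lee_nneseries _ (fun k _ => le k))) => [k _ _|].
  by rewrite lee_fin enorm_ge0.
rewrite nneseries_sum; last by move=> i k _; rewrite adde_ge0.
apply: lee_sum => i _; rewrite nneseriesD //.
apply: leeD.
  have := @measure_semi_sigma_additive _ _ _ (m i) P mP tP.
  by rewrite PT => /(_ measurableT) /cvg_lim <- //.
have := @measure_semi_sigma_additive _ _ _ (n i) P mP tP.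
by rewrite PT => /(_ measurableT) /cvg_lim <- //.
Qed.

Definition vmass F : R := fine (vvariation F setT).

Lemma vmass_ge0 F : 0 <= vmass F.
Proof. exact: fine_ge0 (vvariation_ge0 F). Qed.

(** The pieces are enumerated and continued by empty sets, to fit the sequences in [vvariation]. *)
Lemma finite_partition_le (J : finType) (P : J -> set T) F :
  (forall k, measurable (P k)) -> (forall j k, j != k -> P j `&` P k = set0) ->
  (forall x, exists k, P k x) -> \sum_(k : J) enorm (vvalue F (P k)) <= vmass F.
Proof.
move=> mP tP cP.
pose Q n := nth set0 [seq P k | k <- enum J] n.
have Qsz n : (size (enum J) <= n)%N -> Q n = set0.
  by move=> h; rewrite /Q nth_default // size_map.
have QE x0 n : (n < size (enum J))%N -> Q n = P (nth x0 (enum J) n).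
  by move=> h; rewrite /Q (nth_map x0).
have mQ n : measurable (Q n).
  have [h|h] := ltnP n (size (enum J)); last by rewrite Qsz.
  case: (enum J) h (QE^~ n) => // x0 s h /(_ x0 h) ->; exact: mP.
have le1 : (\sum_(0 <= n <oo) (enorm (vvalue F (Q n)))%:E <= vvariation F setT)%E.
  apply: ereal_sup_ubound; exists Q; split => //.
  - apply/trivIsetP => i j _ _ ij.
    have [hi|/Qsz ->] := ltnP i (size (enum J)); last by rewrite set0I.
    have [hj|/Qsz ->] := ltnP j (size (enum J)); last by rewrite setI0.
    have [x0 _] : exists x0 : J, true by case: (enum J) hi => // x0 s _; exists x0.
    by rewrite !(QE x0) // tP // nth_uniq // enum_uniq.
  - rewrite -subTset => x _; have [k Pkx] := cP x.
    exists (index k (enum J)) => //.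
    by rewrite (QE k) ?index_mem ?mem_enum // nth_index ?mem_enum.
have le2 : ((\sum_(k : J) enorm (vvalue F (P k)))%:E <=
    \sum_(0 <= n <oo) (enorm (vvalue F (Q n)))%:E)%E.
  apply: le_trans (nneseries_lim_ge (size (enum J)) _); last first.
    by move=> n _ _; rewrite lee_fin enorm_ge0.
  rewrite sumEFin lee_fin.
  have -> : \sum_(0 <= n < size (enum J)) enorm (vvalue F (Q n)) =
      \sum_(A <- [seq P k | k <- enum J]) enorm (vvalue F A).
    by rewrite (big_nth set0) size_map.
  by rewrite big_map big_enum.
rewrite -lee_fin /vmass fineK; first exact: le_trans le2 le1.
by rewrite ge0_fin_numE ?vvariation_ge0 // vvariation_lty.
Qed.

Lemma vintegral_step_le (J : finType) (P : J -> set T) (a : J -> V) F K :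
  (forall k, measurable (P k)) -> (forall j k, j != k -> P j `&` P k = set0) ->
  (forall x, exists k, P k x) -> (forall k, enorm (a k) <= K) -> 0 <= K ->
  vintegral F (fun x => \sum_(k : J) (\1_(P k) x : R) *: a k) <= K * vmass F.
Proof.
move=> mP tP cP aK K0.
rewrite vintegral_sum; last first.
  move=> k i; have := bmeasZ (a k 0 i) (bmeas_indic (mP k)).
  by congr bmeas; apply/funext => x; rewrite mxE mulrC.
apply: (@le_trans _ _ (\sum_(k : J) K * enorm (vvalue F (P k)))); last first.
  by rewrite -mulr_sumr ler_wpM2l // finite_partition_le.
apply: ler_sum => k _.
have -> : vintegral F (fun x => (\1_(P k) x : R) *: a k) = dotv (a k) (vvalue F (P k)).
  apply: eq_bigr => i _; rewrite mxE -charge_integral_indic //.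
  rewrite -charge_integralZ; last exact: bmeas_indic.
  by congr charge_integral; apply/funext => x; rewrite mxE mulrC.
by apply: le_trans (dotv_le _ _) _; rewrite ler_wpM2r // enorm_ge0.
Qed.

(** For step fields the bound is Cauchy-Schwarz on each piece. A general field is approximated
    uniformly by step fields, by cutting its range into cubes of side [1 / N]. *)
Lemma vintegral_le F Phi K : bfield Phi -> 0 <= K -> (forall x, enorm (Phi x) <= K) ->
  vintegral F Phi <= K * vmass F.
Proof.
move=> bPhi K0 PhiK.
have [C C0 CP] : exists2 C : R, 0 <= C & forall Psi e, bfield Psi -> 0 <= e ->
    (forall x i, `|Psi x 0 i| <= e) -> vintegral F Psi <= e * C.
  pose c i := s2val (cid2 (charge_integral_bound (F i))).
  exists (\sum_(i < d) c i).
    by apply: sumr_ge0 => i _; exact: (s2valP (cid2 (charge_integral_bound (F i)))).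
  move=> Psi e bPsi e0 h; rewrite /vintegral mulr_sumr; apply: ler_sum => i _.
  apply: le_trans (ler_norm _) _.
  by apply: (s2valP' (cid2 (charge_integral_bound (F i)))) => // x; exact: h.
apply/ler_addgt0Pr => e e0.
have [n nP] : exists n : nat, C / n.+1%:R <= e.
  exists (Num.truncn (C / e)); rewrite ler_pdivrMr // mulrC -ler_pdivrMr //.
  by apply: ltW; have /andP[] := truncn_itv (divr_ge0 C0 (ltW e0)).
pose N : R := n.+1%:R.
have N0 : 0 < N by rewrite ltr0n.
(* The coordinates of [Phi] lie between [- K] and [K]; shifted by [K] and scaled by [N], they lie
   between 0 and [2 * K * N]. *)
pose M := Num.truncn (2 * K * N).
pose z x i := (Phi x 0 i + K) * N.
have PK x i : - K <= Phi x 0 i <= K.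
  by rewrite -ler_norml (le_trans (coord_le_enorm _ _)).
have z0 x i : 0 <= z x i.
  apply: mulr_ge0; last exact: ltW.
  by rewrite -(addNr K) lerD2r; case/andP: (PK x i).
have zM x i : (Num.truncn (z x i) < M.+1)%N.
  rewrite ltnS; apply: le_truncn; rewrite ler_pM2r // mulrDl mul1r lerD2r.
  by case/andP: (PK x i).
pose J := {ffun 'I_d -> 'I_M.+1}.
pose P (k : J) : set T := [set x | forall i, Num.truncn (z x i) = k i].
have mP k : measurable (P k).
  have -> : P k = \bigcap_(i in [set: 'I_d])
      ((fun x => z x i : R) @^-1` `[(k i)%:R, (k i).+1%:R[).
    apply/seteqP; split => x /= h i.
      by move=> _; rewrite /= in_itv /= -(h i); exact: truncn_itv.
    have := h i I; rewrite /= in_itv /= => /andP[h1 h2].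
    by apply/eqP; rewrite truncn_eq // h1.
  apply: fin_bigcap_measurable => [|i _]; first exact: finite_finset.
  rewrite -[X in measurable X]setTI.
  have mz : measurable_fun setT (fun x : T => z x i).
    apply: measurable_funM; last exact: measurable_cst.
    by apply: measurable_funD; [case: (bPhi i)|exact: measurable_cst].
  exact: mz.
have tP j k : j != k -> P j `&` P k = set0.
  move=> jk; rewrite -subset0 => x /= [hj hk]; case/eqP: jk.
  by apply/ffunP => i; apply/val_inj; rewrite /= -(hj i) -(hk i).
pose kx x : J := [ffun i => inord (Num.truncn (z x i))].
have Pkx x : P (kx x) x by move=> i; rewrite ffunE inordK.
(* A value that [Phi] takes on the piece, rather than a corner of the cube, keeps the norm at most
   [K]. Empty pieces receive 0. *)
pose a k := if pselect (exists x, P k x) is left h then Phi (sval (cid h)) else 0.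
have aK k : enorm (a k) <= K.
  by rewrite /a; case: pselect => // _; rewrite enorm0.
pose S x := \sum_(k : J) (\1_(P k) x : R) *: a k.
have SE x : S x = a (kx x).
  rewrite /S (bigD1 (kx x)) //= indicE mem_set // scale1r big1 ?addr0 // => k kk.
  rewrite indicE memNset ?scale0r // => Pk.
  by have : (P k `&` P (kx x)) x by []; rewrite tP.
have bS : bfield S.
  apply: bfield_sum => k i; have := bmeasZ (a k 0 i) (bmeas_indic (mP k)).
  by congr bmeas; apply/funext => x; rewrite mxE mulrC.
have bPS : bfield (fun x => Phi x - S x).
  by have := bfieldD bPhi (bfieldZ (-1) bS); congr bfield; apply/funext => x; rewrite scaleN1r.
have -> : Phi = (fun x => S x + (Phi x - S x)).
  by apply/funext => x; rewrite addrC subrK.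
rewrite vintegralD //; apply: lerD.
  by apply: vintegral_step_le => // x; exists (kx x).
apply: (@le_trans _ _ (N^-1 * C)); last by rewrite mulrC.
apply: CP => // [|x i]; first by rewrite invr_ge0 ltW.
rewrite SE /a; case: pselect => [h|]; last by case; exists x.
case: (cid h) => y /= Py; rewrite !mxE.
have ty : Num.truncn (z y i) = Num.truncn (z x i) by rewrite Py ffunE inordK.
have /andP[x1 x2] := truncn_itv (z0 x i).
have /andP[y1 y2] := truncn_itv (z0 y i).
rewrite ty -natr1 in y1 y2; rewrite -natr1 in x2.
suff : `|(Phi x 0 i - Phi y 0 i) * N| <= 1.
  by rewrite normrM (ger0_norm (ltW N0)) -ler_pdivlMr // mul1r.
have -> : (Phi x 0 i - Phi y 0 i) * N = z x i - z y i by rewrite /z; ring.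
rewrite ler_norml; move: (z y i) y1 y2 => q; move: (_%:R) x1 x2 => r; move: (z x i) => p *.
by apply/andP; lra.
Qed.

Lemma vintegral_bound F Phi K : bfield Phi -> 0 <= K -> (forall x, enorm (Phi x) <= K) ->
  `|vintegral F Phi| <= K * vmass F.
Proof.
move=> bPhi K0 PhiK; rewrite ler_norml vintegral_le // andbT lerNl -vintegralN //.
apply: vintegral_le => // [|x]; last by rewrite enormN.
by have := bfieldZ (-1) bPhi; congr bfield; apply/funext => x; rewrite scaleN1r.
Qed.

End VectorIntegral.

(** * Vector measures and curves of polygons *)

(** On [D] the measure [mu] is the sum of its restrictions to [D] and to the complement of [D], and
    the second of these is null on [D]. *)
Lemma integral_mrestr_bounded dd (S : measurableType dd) (R : realType)
    (mu : {measure set S -> \bar R}) (D : set S) (mD : measurable D) (f : S -> R) M :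
  (mu D < +oo)%E -> measurable_fun setT f -> (forall x, `|f x| <= M) ->
  (\int[mrestr mu mD]_x (f x)%:E = \int[mu]_(x in D) (f x)%:E)%E.
Proof.
move=> muD mf fM.
have mDc : measurable (~` D) by exact: measurableC.
have bf A : [bounded f x | x in A].
  exists M; split; first exact: num_real.
  by move=> x Mx y _ /=; apply: le_trans (fM _) (ltW Mx).
pose m1 := mrestr mu mD; pose m2 := mrestr mu mDc.
have m1y : (m1 setT < +oo)%E by rewrite /m1 /mrestr setTI.
have m1D : (m1 D < +oo)%E by rewrite /m1 /mrestr setIid.
have m2D : m2 D = 0%E by rewrite /m2 /mrestr setICr measure0.
have i1 : m1.-integrable D (EFin \o f).
  by apply: measurable_bounded_integrable => //; exact: measurable_funTS.
have mfD : measurable_fun D (EFin \o f).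
  by apply/measurable_EFinP; exact: measurable_funTS.
have i2 : m2.-integrable D (EFin \o f) by exact: null_set_integrable.
have -> : (\int[mu]_(x in D) (f x)%:E = \int[measure_add m1 m2]_(x in D) (f x)%:E)%E.
  apply: eq_measure_integral => A mA AD; have e1 : m1 A = mu A by rewrite /m1 /mrestr setIidl.
  have e2 : m2 A = 0%E.
    by rewrite /m2 /mrestr (_ : A `&` ~` D = set0) ?measure0 // disjoints_subset setCK.
  by apply: etrans (esym (measure_addE _ _ A)); rewrite -[X in (X + _)%E]/(m1 A) -[X in (_ + X)%E]/(m2 A) e1 e2 adde0.
rewrite (integral_measure_add mD i1 i2) [X in (_ + X)%E](null_set_integral mD mfD m2D) adde0.
have it : m1.-integrable setT (EFin \o f) by apply: measurable_bounded_integrable.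
have m1c : m1 (~` D) = 0%E by rewrite /m1 /mrestr setICl measure0.
by rewrite (negligible_integral mDc measurableT it m1c) setTD setCK.
Qed.

Lemma itv_int_sum (R : realType) (I : Type) (r : seq I) (f : I -> R -> R) (a b : R) :
  (forall i, continuous (f i)) ->
  itv_int (fun x : R => \sum_(i <- r) f i x) a b = \sum_(i <- r) itv_int (f i) a b.
Proof.
move=> cf; elim: r => [|i r IH].
  have := @itv_intZl R (fun=> 0) a b 0 (@cst_continuous _ _ 0).
  rewrite [RHS]mul0r => H; rewrite big_nil -[RHS]H.
  by congr (itv_int _ a b); apply/funext => t; rewrite big_nil /= mul0r.
rewrite big_cons -IH -itv_intD //.
  by congr (itv_int _ a b); apply/funext => t; rewrite big_cons.
move=> t; apply: cvg_big => [|j _]; first exact: add_continuous.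
exact: cf.
Qed.

Lemma line_int_coord (R : realType) (d : nat) (Phi : 'rV[R]_d -> 'rV[R]_d) a b :
  continuous Phi -> line_int Phi a b =
    \sum_(i < d) dir a b 0 i * itv_int (fun t : R => Phi (edge a b t) 0 i) 0 (enorm (b - a)).
Proof.
move=> cPhi.
have cc i : continuous (fun t : R => Phi (edge a b t) 0 i).
  move=> t; apply: (@continuous_comp _ _ _ (Phi \o edge a b) (fun z : 'rV[R]_d => z 0 i)).
    by apply: continuous_comp; [exact: edge_continuous|exact: cPhi].
  exact: coord_continuous.
rewrite /line_int; move: (enorm (b - a)) => l.
have -> : (fun t : R => dotv (Phi (edge a b t)) (dir a b)) =
    (fun t : R => \sum_(i < d) dir a b 0 i * Phi (edge a b t) 0 i).
  by apply/funext => t; apply: eq_bigr => i _; rewrite mulrC.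
rewrite itv_int_sum => [|i].
  by apply: eq_bigr => i _; rewrite itv_intZl.
by move=> t; apply: cvgM; [exact: cvg_cst|exact: cc].
Qed.

(** * Length measures of edges and vector measures of paths *)

Section EdgeMeasure.
Context (R : realType) (d : nat).
Notation V := 'rV[R]_d.
Notation T := (borel R d).
Implicit Types (a b : V) (s : seq V) (Phi : V -> V).

Lemma edge_preimage_measurable a b (A : set T) : measurable A ->
  measurable (edge a b @^-1` A : set (measurableTypeR R)).
Proof.
move=> mA; have mf : measurable_fun setT (edge a b : measurableTypeR R -> T).
  apply: (@measurability _ _ (measurableTypeR R) T setT (edge a b) (@open V)) => //.
  by move=> _ [B oB <-]; rewrite setTI; exact: edge_preimage_open.
by have := mf measurableT A mA; rewrite setTI.
Qed.

Definition edge_measure a b (A : set T) : \bar R :=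
  lebesgue_measure (`[0, enorm (b - a)] `&` edge a b @^-1` A : set (measurableTypeR R)).

Section EdgeMeasureInstance.
Variables a b : V.

Let edge_measure0 : edge_measure a b set0 = 0%E.
Proof. by rewrite /edge_measure preimage_set0 setI0 measure0. Qed.

Let edge_measure_ge0 A : (0 <= edge_measure a b A)%E.
Proof. exact: measure_ge0. Qed.

Let edge_measure_sigma_additive : semi_sigma_additive (edge_measure a b).
Proof.
move=> F mF tF mUF; rewrite /edge_measure preimage_bigcup setI_bigcupr.
apply: measure_semi_sigma_additive.
- by move=> k; apply: measurableI => //; exact: edge_preimage_measurable.
- apply/trivIsetP => i j _ _ ij.
  have FF : F i `&` F j = set0 by move/trivIsetP : tF; apply.
  rewrite -subset0 => t /= [[_ h1] [_ h2]].
  by have : (F i `&` F j) (edge a b t) by []; rewrite FF.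
- by apply: bigcup_measurable => k _; apply: measurableI => //; exact: edge_preimage_measurable.
Qed.

HB.instance Definition _ := isMeasure.Build _ _ _ (edge_measure a b)
  edge_measure0 edge_measure_ge0 edge_measure_sigma_additive.

Let edge_measure_fin : fin_num_fun (edge_measure a b).
Proof.
move=> A mA; rewrite ge0_fin_numE //.
apply: (@le_lt_trans _ _ (lebesgue_measure (`[0, enorm (b - a)]%classic : set (measurableTypeR R)))).
  apply: le_measure; rewrite ?inE //.
  by apply: measurableI => //; exact: edge_preimage_measurable.
by rewrite lebesgue_measure_itv; case: ifP => //= _; rewrite ltry.
Qed.

HB.instance Definition _ := Measure_isFinite.Build _ _ _ (edge_measure a b) edge_measure_fin.

End EdgeMeasureInstance.

Lemma Rintegral_edge_measure a b (f : V -> R) M : continuous f -> (forall x, `|f x| <= M) ->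
  Rintegral (edge_measure a b) setT (f : T -> R) =
  itv_int (fun t => f (edge a b t)) 0 (enorm (b - a)).
Proof.
move=> cf fM; rewrite /itv_int /Rintegral; congr fine.
pose D := `[0, enorm (b - a)]%classic : set (measurableTypeR R).
have mD : measurable D by exact: measurable_itv.
have mfe : measurable_fun setT (edge a b : measurableTypeR R -> T).
  by move=> _ A mA; rewrite setTI; exact: edge_preimage_measurable.
have mf := continuous_borel_measurable cf.
have leD : (lebesgue_measure D < +oo)%E.
  by rewrite /D lebesgue_measure_itv; case: ifP => //= _; rewrite ltry.
have mfc : measurable_fun setT (fun t : measurableTypeR R => f (edge a b t)).
  exact: (measurableT_comp mf mfe).
rewrite -(integral_mrestr_bounded mD leD mfc (fun t => fM (edge a b t))).
transitivity (\int[pushforward (mrestr lebesgue_measure mD) (edge a b : measurableTypeR R -> T)]_x (f x)%:E)%E.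
  apply: eq_measure_integral => A mA _.
  exact: (congr1 (@lebesgue_measure R) (setIC _ _)).
rewrite (integral_pushforward mfe) //; first exact/measurable_EFinP.
rewrite preimage_setT; apply: measurable_bounded_integrable => //.
  by change (mrestr lebesgue_measure mD setT < +oo)%E; rewrite /mrestr setTI.
by exists M; split; [exact: num_real|move=> x Mx y _ /=; apply: le_trans (fM _) (ltW Mx)].
Qed.

(** The unit tangent times the length measure of the edge. *)
Definition edge_vmeasure a b : vmeasure R d :=
  fun i => cscale (dir a b 0 i) (charge_of_finite_measure (edge_measure a b)).

Fixpoint path_vmeasure a s : vmeasure R d :=
  if s is b :: s' then vadd (edge_vmeasure a b) (path_vmeasure b s') else @vzero R d.

Lemma vintegral_edge a b Phi K : continuous Phi -> (forall x, enorm (Phi x) <= K) ->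
  vintegral (edge_vmeasure a b) Phi = line_int Phi a b.
Proof.
move=> cPhi PhiK.
have bPhi := bfield_continuous cPhi PhiK.
have cc i : continuous (fun x => Phi x 0 i).
  move=> x; apply: (@continuous_comp _ _ _ Phi (fun z : V => z 0 i)); first exact: cPhi.
  exact: coord_continuous.
rewrite line_int_coord //.
apply: eq_bigr => i _.
rewrite [charge_integral _ _]charge_integral_cscale; last exact: (bPhi i).
congr (_ * _).
rewrite charge_integral_finite_measure; last exact: (bPhi i).
apply: (@Rintegral_edge_measure a b (fun x => Phi x 0 i) K (cc i)) => x.
by apply: le_trans (coord_le_enorm _ _) (PhiK x).
Qed.

Lemma vintegral_path a s Phi K : continuous Phi -> (forall x, enorm (Phi x) <= K) ->
  vintegral (path_vmeasure a s) Phi = pint Phi a s.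
Proof.
move=> cPhi PhiK; have bPhi := bfield_continuous cPhi PhiK.
elim: s a => [|b s IH] a; first exact: vintegral_vzero.
by rewrite [LHS]vintegral_vadd // (vintegral_edge a b cPhi PhiK) IH.
Qed.

Lemma ecovE a b (A : set T) : measurable A -> (ecov A a b)%:E = edge_measure a b A.
Proof. by move=> mA; exact: (fineK (fin_num_measure (edge_measure a b) A mA)). Qed.

Lemma enorm_vvalue_path a s (A : set T) : measurable A ->
  enorm (vvalue (path_vmeasure a s) A) <= pcov A a s.
Proof.
move=> mA; elim: s a => [|b s IH] a.
  rewrite (_ : vvalue _ _ = 0) ?enorm0 //.
  by apply/rowP => i; rewrite !mxE.
have -> : vvalue (path_vmeasure a (b :: s)) A =
    ecov A a b *: dir a b + vvalue (path_vmeasure b s) A.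
  apply/rowP => i; rewrite [LHS]mxE [RHS]mxE [X in _ = X + _]mxE [X in _ = _ + X]mxE.
  change (fine (edge_vmeasure a b i A + path_vmeasure b s i A)%E =
    ecov A a b * dir a b 0 i + fine (path_vmeasure b s i A)).
  rewrite fineD; [congr (_ + _)|exact: fin_num_measure|exact: fin_num_measure].
  change (fine ((dir a b 0 i)%:E * edge_measure a b A)%E = ecov A a b * dir a b 0 i).
  by rewrite -ecovE // -EFinM /= mulrC.
apply: le_trans (enormD _ _) _; rewrite pcov_cons; apply: lerD (IH b).
rewrite enormZ ger0_norm ?ecov_ge0 // ler_piMr ?ecov_ge0 //.
exact: enorm_dir_le1.
Qed.

Lemma pcov_sigma_additive a s (P : nat -> set T) : (forall k, measurable (P k)) ->
  trivIset setT P -> (\sum_(0 <= k <oo) (pcov (P k) a s)%:E = (pcov (\bigcup_k P k) a s)%:E)%E.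
Proof.
move=> mP tP; have mU : measurable (\bigcup_k P k) by exact: bigcup_measurable.
elim: s a => [|b s IH] a; first by rewrite eseries0.
have -> : (fun n => \sum_(0 <= k < n) (pcov (P k) a (b :: s))%:E)%E =
   (fun n => \sum_(0 <= k < n) ((ecov (P k) a b)%:E + (pcov (P k) b s)%:E))%E by [].
rewrite nneseriesD; last 2 first.
- by move=> k _ _; rewrite lee_fin ecov_ge0.
- by move=> k _ _; rewrite lee_fin psum_ge0 // => p q; exact: ecov_ge0.
rewrite IH pcov_cons EFinD; congr (_ + _)%E.
rewrite ecovE //; have := @measure_semi_sigma_additive _ _ _ (edge_measure a b) P mP tP mU.
move/cvg_lim => <- //; congr (limn _); apply/funext => n.
by apply: eq_bigr => k _; rewrite ecovE.
Qed.

(** In general only an inequality: edges that overlap in opposite directions cancel in the measure,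
    but not in [pcov]. *)
Lemma vvariation_path_le a s (E : set T) :
  (vvariation (path_vmeasure a s) E <= (pcov E a s)%:E)%E.
Proof.
apply: ge_ereal_sup => _ [P [mP tP PE ->]].
rewrite -PE -pcov_sigma_additive //; apply: lee_nneseries => k _.
  by rewrite lee_fin enorm_ge0.
by rewrite lee_fin; apply: enorm_vvalue_path.
Qed.

Lemma vvariation_path_le_plen a s : (vvariation (path_vmeasure a s) setT <= (plen a s)%:E)%E.
Proof.
apply: le_trans (vvariation_path_le _ _ _) _; rewrite lee_fin.
by apply: pcov_le_plen; exact: openT.
Qed.

Lemma morrey1_path_le a s (K : R) :
  (forall x r, 0 < r -> pcov (eball x r) a s <= K * r) ->
  (morrey1_norm (path_vmeasure a s) <= K%:E)%E.
Proof.
move=> g; apply: ge_ereal_sup => _ [x [r [r0 ->]]].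
have h : (vvariation (path_vmeasure a s) (eball x r) <= (K * r)%:E)%E.
  by apply: le_trans (vvariation_path_le _ _ _) _; rewrite lee_fin; exact: g.
have -> : K%:E = ((K * r)%:E * (r^-1)%:E)%E by rewrite -EFinM mulfK // gt_eqF.
by apply: lee_wpmul2r h; rewrite lee_fin invr_ge0 ltW.
Qed.

Lemma morrey1_good a s : good a s -> (morrey1_norm (path_vmeasure a s) <= 1000%:E)%E.
Proof. by move=> g; apply: morrey1_path_le. Qed.

Lemma vvariation_vzero_le (E : set T) : (vvariation (@vzero R d) E <= 0)%E.
Proof. by have := vvariation_path_le 0 [::] E; rewrite pcov_nil. Qed.

Lemma morrey1_vzero : (morrey1_norm (@vzero R d) <= 1000%:E)%E.
Proof.
have -> : @vzero R d = path_vmeasure 0 [::] by [].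
apply: morrey1_good => x r r0; rewrite pcov_nil.
by apply: mulr_ge0; [exact: ler0n|exact: ltW].
Qed.

End EdgeMeasure.

(** * Gluing integrals over consecutive intervals *)

Section PiecewiseIntegral.
Context (R : realType).
Implicit Types (f g h : R -> R) (a b c I : R).

Let mu := @lebesgue_measure R.

(** The tangent of a polygon jumps at its vertices, so continuity of the integrand is lost.
    Measurability and boundedness are carried along with the value, so that integrals over
    consecutive edges can be joined. *)
Definition has_itv_int h a b I :=
  [/\ measurable_fun `[a, b] h, (exists M, forall x, a <= x <= b -> `|h x| <= M)
    & itv_int h a b = I].

Lemma bounded_itv_integrable h a b M : measurable_fun `[a, b] h ->
  (forall x, a <= x <= b -> `|h x| <= M) -> mu.-integrable `[a, b] (EFin \o h).
Proof.
move=> mh hM; apply: measurable_bounded_integrable => //.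
  have muy : (lebesgue_measure (`[a, b]%classic : set (measurableTypeR R)) < +oo)%E.
    by rewrite lebesgue_measure_itv; case: ifP => //= _; rewrite ltry.
  exact: muy.
exists M; split; first exact: num_real.
by move=> x Mx y /=; rewrite in_itv /= => /hM yM; apply: le_trans yM (ltW Mx).
Qed.

Lemma has_itv_int_continuous h a b : continuous h -> has_itv_int h a b (itv_int h a b).
Proof.
move=> ch; split => //.
  by apply: measurable_funTS; exact: continuous_measurable_fun.
have [M [_ hM]] := compact_bounded (continuous_compact (continuous_subspaceT ch) (@segment_compact _ a b)).
exists (M + 1) => x xab; apply: (hM (M + 1)); first by rewrite ltrDl.
by exists x => //=; rewrite in_itv.
Qed.

(** The two endpoints form a null set; they are left out because the derivative of a polygonal curve
    is not under control at a vertex. *)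
Lemma has_itv_int_eq h g a b I : (forall x, a < x < b -> h x = g x) ->
  has_itv_int g a b I -> has_itv_int h a b I.
Proof.
move=> hg [mg [M gM] <-].
have mgo : measurable_fun `]a, b[ g by apply: measurable_funS mg => //; exact: subset_itv_oo_cc.
have hgo : {in `]a, b[%classic, g =1 h}.
  by move=> x; rewrite inE /= in_itv /= => xab; rewrite hg.
have mho : measurable_fun `]a, b[ h by exact: eq_measurable_fun mgo.
have mh1 f : measurable_fun `]a, b[ f -> measurable_fun `]a, b] f.
  by move/measurable_fun_itv_bndo_bndcP.
have mh2 f : measurable_fun `]a, b] f -> measurable_fun `[a, b] f.
  by move/measurable_fun_itv_obnd_cbndP.
have eI f : measurable_fun `]a, b[ f ->
    (\int[mu]_(x in `[a, b]) (f x)%:E = \int[mu]_(x in `]a, b[) (f x)%:E)%E.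
  move=> mf; rewrite -integral_itv_obnd_cbnd; last by apply/measurable_EFinP; exact: mh1.
  by rewrite -integral_itv_bndo_bndc //; apply/measurable_EFinP.
split; first by apply: mh2; apply: mh1.
- exists (Num.max M (Num.max `|h a| `|h b|)) => x /andP[].
  rewrite le_eqVlt => /predU1P[<- _|ax]; first by rewrite !le_max lexx orbT.
  rewrite le_eqVlt => /predU1P[->|xb]; first by rewrite !le_max lexx !orbT.
  by rewrite hg ?ax // le_max gM // !ltW.
rewrite /itv_int /Rintegral -/mu (eI h) // (eI g) //; congr fine.
by apply: eq_integral => x xab; rewrite hgo.
Qed.

Lemma has_itv_int_cat h a c b I J : a <= c -> c <= b ->
  has_itv_int h a c I -> has_itv_int h c b J -> has_itv_int h a b (I + J).
Proof.
move=> ac cb [m1 [M1 b1] <-] [m2 [M2 b2] <-].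
have ss : `[a, b]%classic = `[a, c] `|` `[c, b].
  apply/seteqP; split => x /=; rewrite !in_itv /=.
    by move=> /andP[-> ->] /=; rewrite andbT; apply/orP; exact: le_total.
  move=> [] /andP[h1 h2]; first by rewrite h1 (le_trans h2).
  by rewrite h2 (le_trans ac).
have mh : measurable_fun `[a, b] h by rewrite ss; apply/measurable_funU.
have bh x : a <= x <= b -> `|h x| <= Num.max M1 M2.
  move=> /andP[ax xb]; rewrite le_max; apply/orP.
  have [xc|cx] := leP x c; [left; apply: b1|right; apply: b2].
    by rewrite ax.
  by rewrite xb ltW.
have ih := bounded_itv_integrable mh bh.
split => //; first by exists (Num.max M1 M2).
have := @Rintegral_itvB R h (BLeft a) (BRight b) c ih.
rewrite !bnd_simp => /(_ ac cb) /eqP.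
rewrite subr_eq addrC => /eqP; rewrite /itv_int => ->; congr (_ + _).
apply: Rintegral_itv_obnd_cbnd.
by apply: integrableS (bounded_itv_integrable m2 b2) => //; exact: subset_itv_oc_cc.
Qed.

Lemma has_itv_intxx h a : has_itv_int h a a 0.
Proof.
split; last exact: itv_intxx.
  by rewrite set_itv1; exact: measurable_fun_set1.
by exists `|h a| => x; rewrite -eq_le => /eqP ->.
Qed.

End PiecewiseIntegral.

(** * Arclength parametrization of polygons *)

Section PolygonalCurve.
Context (R : realType) (d : nat).
Notation V := 'rV[R]_d.
Implicit Types (a b : V) (s : seq V) (t u : R).

Fixpoint pcurve a s (t : R) : V :=
  if s is b :: s' then
    if t <= enorm (b - a) then edge a b t else pcurve b s' (t - enorm (b - a))
  else a.

Fixpoint pbreaks a s : seq R :=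
  if s is b :: s' then
    enorm (b - a) :: [seq enorm (b - a) + t | t <- pbreaks b s']
  else [::].

Definition nondegenerate a s := path (fun x y : V => x != y) a s.

Lemma pcurve_cons a b s t :
  pcurve a (b :: s) t = if t <= enorm (b - a) then edge a b t else pcurve b s (t - enorm (b - a)).
Proof. by []. Qed.

Lemma pcurve0 a s : pcurve a s 0 = a.
Proof. by case: s => //= b s; rewrite enorm_ge0 edge0. Qed.

Lemma plen_gt0 a s : nondegenerate a s -> s != [::] -> 0 < plen a s.
Proof.
case: s => //= b s /andP[ab _] _; rewrite plen_cons ltr_pwDl ?plen_ge0 //.
by rewrite enorm_gt0 subr_eq0 eq_sym.
Qed.

Lemma pcurve_plen a s : nondegenerate a s -> pcurve a s (plen a s) = last a s.
Proof.
elim: s a => //= b s IH a /andP[ab nd]; rewrite plen_cons.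
have [->|s0] := eqVneq s [::]; first by rewrite plen_nil addr0 lexx edge1.
by rewrite leNgt ltrDl plen_gt0 //= addrC addKr IH.
Qed.

Lemma pcurve_lipschitz a s t u : enorm (pcurve a s t - pcurve a s u) <= `|t - u|.
Proof.
elim: s a t u => [|b s IH] a t u; first by rewrite subrr enorm0.
wlog tu : t u / t <= u.
  by move=> H; have [/H //|/ltW /H] := leP t u; rewrite enormC distrC.
rewrite !pcurve_cons; move: (edge1 a b); set l := enorm (b - a) => e1.
have elip x y : enorm (edge a b x - edge a b y) <= `|x - y|.
  by rewrite edgeB enormZ ler_piMr // enorm_dir_le1.
have [ul|lu] := leP u l; first by rewrite (le_trans tu ul).
have [tl|lt] := leP t l; last first.
  apply: le_trans (IH _ _ _) _; rewrite (_ : t - l - (u - l) = t - u) //; ring.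
(* The two times lie on different sides of the vertex [b]. *)
apply: le_trans (enorm_triangle _ b _) _.
have h1 : enorm (edge a b t - b) <= l - t.
  by have := elip t l; rewrite e1 distrC ger0_norm // subr_ge0.
have h2 : enorm (b - pcurve b s (u - l)) <= u - l.
  have := IH b 0 (u - l); rewrite pcurve0 sub0r normrN ger0_norm // subr_ge0.
  exact: ltW.
rewrite distrC ger0_norm ?subr_ge0 //; apply: le_trans (lerD h1 h2) _.
by rewrite addrC addrA subrK.
Qed.

Lemma pcurve_continuous a s : continuous (pcurve a s).
Proof.
move=> t; apply/cvgrPdist_le => e e0; near=> u.
apply: le_trans (norm_le_enorm _) _; apply: le_trans (pcurve_lipschitz _ _ _ _) _.
near: u; apply: cvgr_dist_le => //; exact: cvg_id.
Unshelve. all: by end_near. Qed.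

(** Derivability, continuity of the derivative and unit speed all follow from this local form. *)
Lemma pcurve_affine a s t : nondegenerate a s -> 0 < t < plen a s -> t \notin pbreaks a s ->
  exists2 e : V, enorm e = 1 &
    \forall u \near t, pcurve a s u = pcurve a s t + (u - t) *: e.
Proof.
elim: s a t => [|b s IH] a t nd; first by rewrite plen_nil => /andP[/lt_trans h /h]; rewrite ltxx.
rewrite plen_cons => /andP[t0 tL] /=; rewrite inE negb_or => /andP[tl tb].
move: nd => /= /andP[ab nd].
move: tl tb tL (dirE a b); set l := enorm (b - a) => tl tb tL dE.
have [tl'|lt] := leP t l.
  have {}tl : t < l by rewrite lt_neqAle tl.
  exists (dir a b); first exact: enorm_dir.
  near=> u; rewrite ifT; last by apply: ltW; near: u; exact: lt_nbhsl.
  by rewrite /edge -addrA -scalerDl (addrC t) subrK.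
have [||e e1 he] := IH b (t - l) nd.
- by rewrite subr_gt0 lt ltrBlDl.
- apply: contra tb => h; apply/mapP; exists (t - l) => //.
  by rewrite addrC subrK.
exists e => //.
have he' : \forall u \near t, pcurve b s (u - l) = pcurve b s (t - l) + (u - l - (t - l)) *: e.
  have cl : (fun u => u - l) @ t --> t - l by apply: cvgB; [exact: cvg_id|exact: cvg_cst].
  exact: (cl _ he).
near=> u; rewrite ifF; last by apply/negbTE; rewrite -ltNge; near: u; exact: lt_nbhsr.
have -> : u - t = u - l - (t - l) by ring.
by near: u.
Unshelve. all: by end_near. Qed.

Lemma locally_affine_is_derive (f : R -> V) t e :
  (\forall u \near t, f u = f t + (u - t) *: e) -> is_derive t 1 f e.
Proof.
move=> h.
have c : (fun k : R => k *: (1 : R) + t) @ 0^' --> t.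
  have : (fun k : R => k *: (1 : R) + t) @ 0 --> 0 *: (1 : R) + t.
    by apply: cvgD; [apply: cvgZr_tmp; exact: cvg_id|exact: cvg_cst].
  by rewrite scale0r add0r => c; apply: cvg_within_filter c.
have H : (fun k : R => k^-1 *: ((f \o shift t) (k *: (1 : R)) - f t)) @ 0^' --> e.
  apply: cvg_near_cst; near=> k.
  have -> : (f \o shift t) (k *: (1 : R)) = f t + k *: e.
    rewrite /= (_ : k *: e = (k *: (1 : R) + t - t) *: e); last first.
      by rewrite addrK [k *: 1]mulr1.
    by near: k; exact: (c _ h).
  rewrite addrAC subrr add0r scalerA mulVf ?scale1r //.
  by near: k; exact: nbhs_dnbhs_neq.
apply: DeriveDef; first exact: cvgP H.
exact: cvg_lim H.
Unshelve. all: by end_near. Qed.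

Lemma locally_affine_near (f : R -> V) t e :
  (\forall u \near t, f u = f t + (u - t) *: e) ->
  \forall u \near t, derive1 f u = e.
Proof.
move=> h; have := near_join h; apply: filter_app; move: h; apply: filter_app; near=> u => hu h.
have : is_derive u 1 f e.
  apply: locally_affine_is_derive; apply: filterS h => v ->.
  by rewrite hu -addrA -scalerDl; congr (_ + _ *: _); ring.
by move=> D; rewrite derive1E derive_val.
Unshelve. all: by end_near. Qed.

Lemma derive1_near_eq (f g : R -> V) t : (\forall u \near t, f u = g u) ->
  derive1 f t = derive1 g t.
Proof. by move=> fg; rewrite !derive1E; apply: near_eq_derive. Qed.

Lemma derive1_shift (g : R -> V) (l t : R) :
  derive1 (fun u => g (u - l)) t = derive1 g (t - l).
Proof.
rewrite /derive1 (_ : (fun h : R => h^-1 *: (g (h + t - l) - g (t - l))) =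
  (fun h => h^-1 *: (g (h + (t - l)) - g (t - l)))) //.
by apply/funext => h; rewrite addrA.
Qed.

Lemma derive1_edge a b t : derive1 (edge a b) t = dir a b.
Proof.
have : is_derive t 1 (edge a b) (dir a b).
  have h u : edge a b u = edge a b t + (u - t) *: dir a b.
    by rewrite /edge -addrA -scalerDl (addrC t) subrK.
  by apply: locally_affine_is_derive; exact: (@filterE _ _ (nbhs_filter t) _ h).
by move=> D; rewrite derive1E derive_val.
Qed.

(** The starting time [c] makes the induction possible: after the first edge, the remaining path
    starts at time [c + l]. *)
Lemma pcurve_integral Phi a s c (f : R -> R) : continuous Phi -> nondegenerate a s ->
  (forall t, c < t < c + plen a s ->
    f t = dotv (Phi (pcurve a s (t - c))) (derive1 (pcurve a s) (t - c))) ->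
  has_itv_int f c (c + plen a s) (pint Phi a s).
Proof.
move=> cPhi; elim: s a c => [|b s IH] a c.
  by rewrite plen_nil pint_nil addr0 => _ _; exact: has_itv_intxx.
move=> /andP[ab nd]; rewrite plen_cons pint_cons.
have l0 := enorm_ge0 (b - a); have L0 := plen_ge0 b s.
have lc := @line_continuous R d Phi a b cPhi.
rewrite /line_int; move: l0 lc (pcurve_cons a b s); set l := enorm (b - a) => l0 lc pE fE.
apply: (@has_itv_int_cat _ _ _ (c + l)).
- by rewrite lerDl.
- by rewrite addrA lerDl.
- pose g t := dotv (Phi (edge a b (t - c))) (dir a b).
  have cg : continuous g.
    move=> t; apply: (@continuous_comp _ _ _ (fun t => t - c)
      (fun t : R => dotv (Phi (edge a b t)) (dir a b))); last exact: lc.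
    by apply: cvgB; [exact: cvg_id|exact: cvg_cst].
  have -> : itv_int (fun t : R => dotv (Phi (edge a b t)) (dir a b)) 0 l = itv_int g c (c + l).
    have := itv_int_shift c cg l0; rewrite add0r (addrC l) => <-.
    by congr (itv_int _ 0 l); apply/funext => t; rewrite /g addrK.
  apply: has_itv_int_eq (has_itv_int_continuous c (c + l) cg) => t /andP[ct tc].
  have tl : t - c < l by rewrite ltrBlDl.
  rewrite fE; last by rewrite ct (lt_le_trans tc) // lerD2l lerDl.
  rewrite pE (ltW tl) /g; congr dotv; rewrite -(derive1_edge a b (t - c)).
  apply: derive1_near_eq; near=> u.
  by rewrite pE ifT //; apply: ltW; near: u; exact: lt_nbhsl.
- rewrite addrA; apply: IH => // t /andP[ct tc].
  have lt : l < t - c by rewrite ltrBrDl.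
  rewrite fE; last by rewrite (le_lt_trans _ ct) ?lerDl //= addrA.
  rewrite pE leNgt lt /= opprD addrA; congr dotv.
  rewrite -(derive1_shift (pcurve b s) l).
  apply: (@derive1_near_eq (pcurve a (b :: s)) (fun u => pcurve b s (u - l))); near=> u.
  by rewrite pE ifF //; apply/negbTE; rewrite -ltNge; near: u; exact: lt_nbhsr.
Unshelve. all: by end_near. Qed.

Section Curve.
Variables (a : V) (s : seq V).
Hypotheses (nd : nondegenerate a s) (s0 : s != [::]).

Let curve_aff t : 0 < t < plen a s -> t \notin pbreaks a s ->
  exists2 e : V, enorm e = 1 & is_derive t 1 (pcurve a s) e /\
    \forall u \near t, derive1 (pcurve a s) u = e.
Proof.
move=> tL tb; have [e e1 he] := pcurve_affine nd tL tb.
by exists e => //; split; [exact: locally_affine_is_derive|exact: locally_affine_near].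
Qed.

Let curve_der t : 0 < t < plen a s -> t \notin pbreaks a s -> derivable (pcurve a s) t 1.
Proof. by move=> tL tb; have [e _ [[]]] := curve_aff tL tb. Qed.

Let curve_der_continuous t : 0 < t < plen a s -> t \notin pbreaks a s ->
  {for t, continuous (derive1 (pcurve a s))}.
Proof.
move=> tL tb; have [e _ [_ h]] := curve_aff tL tb.
rewrite /prop_for /continuous_at (nbhs_singleton h); exact: cvg_near_cst.
Qed.

Let curve_unit t : 0 < t < plen a s -> t \notin pbreaks a s ->
  enorm (derive1 (pcurve a s) t) = 1.
Proof. by move=> tL tb; have [e e1 [_ /nbhs_singleton ->]] := curve_aff tL tb. Qed.

Definition polygon_curve : pwC1_curve R d :=
  @PwC1Curve R d (plen a s) (pcurve a s) (pbreaks a s) (plen_gt0 nd s0)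
    (continuous_subspaceT (@pcurve_continuous a s)) curve_der curve_der_continuous curve_unit.

End Curve.

Lemma C0_field_bounded (Phi : V -> V) : C0_field Phi ->
  exists2 K : R, 0 <= K & forall x, enorm (Phi x) <= K.
Proof.
move=> [cPhi /(_ 1 ltr01) [M PhiM]].
have cE := @compact_enorm_ball R d M.
have cn : continuous (fun x => enorm (Phi x)).
  by move=> x; apply: (@continuous_comp _ _ _ Phi (@enorm R d)); [exact: cPhi|exact: enorm_continuous].
have [N [_ hN]] := compact_bounded (continuous_compact (continuous_subspaceT cn) cE).
exists (Num.max 1 (N + 1)); first by rewrite le_max ler01.
move=> x; have [xM|/PhiM] := leP (enorm x) M; last by rewrite le_max => /ltW ->.
rewrite le_max -[enorm (Phi x)]ger0_norm ?enorm_ge0 // orbC (hN (N + 1)) ?ltrDl //.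
by exists x.
Qed.

Lemma polygon_curve_induced a s (nd : nondegenerate a s) (s0 : s != [::]) :
  induced_measure (polygon_curve nd s0) (path_vmeasure a s).
Proof.
move=> Phi C0; have [K _ PhiK] := C0_field_bounded C0; have [cPhi _] := C0.
rewrite (vintegral_path a s cPhi PhiK) /=.
have := @pcurve_integral Phi a s 0 (fun t => dotv (Phi (pcurve a s t)) (derive1 (pcurve a s) t)) cPhi nd.
rewrite add0r => -[|_ _ <-] //.
by move=> t _; rewrite subr0.
Qed.

Lemma polygon_curve_closed a s (nd : nondegenerate a s) (s0 : s != [::]) :
  last a s = a -> closed_curve (polygon_curve nd s0).
Proof. by move=> cl; rewrite /closed_curve /= pcurve0 pcurve_plen. Qed.

End PolygonalCurve.

(** * Test functions and lattice partitions of unity *)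

Section SmoothOneVariable.
Context (R : realType).
Implicit Types (f g : R -> R) (x y : R) (n k : nat).

Fixpoint nder n f : Prop :=
  if n is n'.+1 then (forall x, derivable f x 1) /\ nder n' (derive1 f) else True.

Definition smooth1 f := forall n, nder n f.

Lemma smooth1_derivable f x : smooth1 f -> derivable f x 1.
Proof. by move=> /(_ 1%N) []. Qed.

Lemma smooth1_derive f : smooth1 f -> smooth1 (derive1 f).
Proof. by move=> sf n; case: (sf n.+1). Qed.

Lemma derivable_continuous f : (forall x, derivable f x 1) -> continuous f.
Proof. by move=> df x; apply: differentiable_continuous; apply/derivable1_diffP. Qed.

Lemma smooth1_continuous f : smooth1 f -> continuous f.
Proof. by move=> sf; apply: derivable_continuous => x; exact: smooth1_derivable. Qed.

Lemma nderW n f : nder n.+1 f -> nder n f.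
Proof. by elim: n f => // n IH f [df nf]; split => //; exact: IH. Qed.

Lemma nder_cst n (c : R) : nder n (cst c).
Proof.
elim: n c => // n IH c; split => [x|]; first exact: derivable_cst.
have -> : derive1 (cst c) = cst 0 by apply/funext => x; rewrite derive1_cst.
exact: IH.
Qed.

Lemma nderD n f g : nder n f -> nder n g -> nder n (fun x => f x + g x).
Proof.
elim: n f g => // n IH f g [df nf] [dg ng]; split => [x|]; first exact: derivableD.
have -> : derive1 (fun x => f x + g x) = (fun x => derive1 f x + derive1 g x).
  by apply/funext => x; rewrite !derive1E deriveD.
exact: IH.
Qed.

Lemma nderM n f g : nder n f -> nder n g -> nder n (fun x => f x * g x).
Proof.
elim: n f g => // n IH f g nf ng.
have [[df nf'] [dg ng']] := (nf, ng).
split => [x|]; first exact: derivableM.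
have -> : derive1 (fun x => f x * g x) = (fun x => f x * derive1 g x + g x * derive1 f x).
  by apply/funext => x; rewrite !derive1E deriveM.
by apply: nderD; apply: IH => //; exact: nderW.
Qed.

Lemma nderV n f : (forall x, f x != 0) -> nder n f -> nder n (fun x => (f x)^-1).
Proof.
move=> f0; elim: n => // n IH nf; have [df nf'] := nf.
split => [x|]; first exact: derivableV.
have -> : derive1 (fun x => (f x)^-1) =
    (fun x => (-1 * ((f x)^-1 * (f x)^-1)) * derive1 f x).
  apply/funext => x; rewrite !derive1E deriveV // [LHS]mulNr mulN1r mulNr.
  by rewrite expr2 invfM.
apply: nderM => //; apply: nderM; first exact: nder_cst.
by apply: nderM; apply: IH; exact: nderW.
Qed.

Lemma is_derive_affine (a b x : R) : is_derive x 1 (fun x => a * x + b) a.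
Proof.
have D : is_derive x 1 (a \*: (id : R -> R) + cst b) (a *: (1 : R) + 0) by exact: is_deriveD.
by rewrite addr0 [a *: 1]mulr1 in D.
Qed.

Lemma is_derive1_affine f (a b x : R) : derivable f (a * x + b) 1 ->
  is_derive x 1 (fun x => f (a * x + b)) (a * derive1 f (a * x + b)).
Proof.
move=> df; rewrite mulrC; apply: is_derive1_comp; last exact: is_derive_affine.
by rewrite derive1E; apply: DeriveDef.
Qed.

Lemma derive1_affine f (a b : R) : (forall x, derivable f x 1) ->
  derive1 (fun x => f (a * x + b)) = (fun x => a * derive1 f (a * x + b)).
Proof.
move=> df; apply/funext => x; have := @is_derive1_affine f a b x (df _).
by move=> D; rewrite derive1E derive_val.
Qed.

Lemma nder_affine n f (a b : R) : nder n f -> nder n (fun x => f (a * x + b)).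
Proof.
elim: n f => // n IH f [df nf]; split => [x|].
  by have [] := @is_derive1_affine f a b x (df _).
by rewrite derive1_affine //; apply: nderM; [exact: nder_cst|exact: IH].
Qed.

(** The derivative of each of these functions is a combination of two others from the same family,
    so smoothness of all of them follows by one induction. *)
Definition expinv k (s : R) : R := if 0 < s then s^-1 ^+ k * expR (- s^-1) else 0.

Lemma expinv_ge0 k s : 0 <= expinv k s.
Proof.
rewrite /expinv; case: ifP => // s0.
by rewrite mulr_ge0 ?expR_ge0 // exprn_ge0 // invr_ge0 ltW.
Qed.

(** From [expR y >= y ^+ k.+1 / (k.+1)!] at [y = s^-1]. This settles the derivative at zero, where
    the difference quotient of [expinv k] from the right is [expinv k.+1]. *)
Lemma expinv_le k s : 0 < s -> expinv k s <= (k.+1)`!%:R * s.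
Proof.
move=> s0; rewrite /expinv s0 expRN ler_pdivrMr ?expR_gt0 //.
have y0 : 0 < s^-1 by rewrite invr_gt0.
have := @expR_ge1Dxn R s^-1 k (ltW y0).
have f0 : 0 < (k.+1)`!%:R :> R by rewrite ltr0n fact_gt0.
move=> h; apply: (@le_trans _ _ ((k.+1)`!%:R * s * (s^-1 ^+ k.+1 / (k.+1)`!%:R))).
  rewrite exprS; move: (_ ^+ k) (_%:R) f0 => z F F0.
  by rewrite le_eqVlt; apply/orP; left; apply/eqP; field; rewrite !gt_eqF.
rewrite ler_wpM2l //; first by rewrite mulr_ge0 // ltW.
by apply: le_trans h; rewrite lerDr.
Qed.

Lemma is_derive_expinv k (s : R) :
  is_derive s 1 (expinv k) (- k%:R * expinv k.+1 s + expinv k.+2 s).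
Proof.
have [s0|s0|->] := ltgtP s 0.
- have e0 j : expinv j s = 0 by rewrite /expinv ltNge (ltW s0).
  rewrite !e0 mulr0 addr0.
  have D : is_derive s 1 (cst 0 : R -> R) 0 by exact: is_derive_cst.
  apply: near_eq_is_derive D.
  near=> t; rewrite /expinv ltNge ifF //; apply/negbTE; rewrite negbK ltW //.
  by near: t; exact: lt_nbhsl.
- have D : is_derive s 1 (fun s : R => s^-1 ^+ k * expR (- s^-1))
    (- k%:R * expinv k.+1 s + expinv k.+2 s).
    have s0' : s != 0 by rewrite gt_eqF.
    have d1 : is_derive s 1 (fun s : R => s^-1) (- s^-1 ^+ 2).
      apply: DeriveDef; first exact: (@derivableV _ _ id).
      by rewrite (@deriveV _ _ id) // derive_id [LHS]mulr1 exprVn.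
    have d2 : is_derive s 1 (fun s : R => expR (- s^-1)) (expR (- s^-1) * s^-1 ^+ 2).
      apply: (@is_derive1_comp R expR (fun s : R => - s^-1)).
      by have := is_deriveN d1; rewrite opprK.
    have d3 := is_deriveX k d1.
    have d4 := is_deriveM d3 d2.
    have -> : (fun s : R => s^-1 ^+ k * expR (- s^-1)) =
        (fun s : R => s^-1) ^+ k * (fun s : R => expR (- s^-1)).
      by apply/funext => t; rewrite [RHS]/GRing.mul /= exprfctE.
    apply: (is_derive_eq d4); rewrite /expinv s0.
    have -> : ((fun s : R => s^-1) ^+ k) s = s^-1 ^+ k by rewrite exprfctE.
    move=> {d1 d2 d3 d4}; move: (expR _) => e; rewrite /GRing.scale /=; move: (s^-1) => y.
    by case: k => [|j]; rewrite ?exprS /=; ring.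
  apply: near_eq_is_derive D; near=> t; rewrite /expinv ifT //.
  by near: t; exact: lt_nbhsr.
- have e0 j : expinv j 0 = 0 by rewrite /expinv ltxx.
  rewrite !e0 mulr0 addr0.
  have H : (fun h : R => h^-1 *: ((expinv k \o shift 0) (h *: (1 : R)) - expinv k 0)) @ 0^' --> (0 : R).
    apply/cvgrPdist_le => e e0'; near=> h.
    rewrite sub0r normrN /= addr0 e0 subr0 [h *: 1]mulr1.
    have [h0|h0] := ltP 0 h; last by rewrite /expinv ltNge h0 /= scaler0 normr0 ltW.
    have -> : h^-1 *: expinv k h = expinv k.+1 h.
      by rewrite /expinv h0 exprS -mulrA.
    rewrite ger0_norm ?expinv_ge0 //; apply: le_trans (expinv_le _ h0) _.
    rewrite -ler_pdivlMl ?ltr0n ?fact_gt0 //.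
    apply: le_trans (ler_norm _) _.
    near: h; apply: dnbhs0_le; rewrite mulr_gt0 // invr_gt0 ltr0n fact_gt0 //.
  by apply: DeriveDef; [exact: cvgP H|exact: cvg_lim H].
Unshelve. all: by end_near. Qed.

Lemma smooth1_expinv k : smooth1 (expinv k).
Proof.
move=> n; elim: n k => // n IH k; split => [s|]; first by have [] := is_derive_expinv k s.
have -> : derive1 (expinv k) = (fun s => - k%:R * expinv k.+1 s + expinv k.+2 s).
  by apply/funext => s; have D := is_derive_expinv k s; rewrite derive1E derive_val.
by apply: nderD => //; apply: nderM => //; exact: nder_cst.
Qed.

(** The usual smooth transition from 0 to 1. The term [1 - s] is spelled in the affine form to which
    [nder_affine] applies. *)
Definition smooth_step (s : R) : R :=
  expinv 0 s * (expinv 0 s + expinv 0 (-1 * s + 1))^-1.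

Lemma expinv0_gt0 s : 0 < s -> 0 < expinv 0 s.
Proof. by move=> s0; rewrite /expinv s0 expr0 mul1r expR_gt0. Qed.

Lemma expinv0_le0 s : s <= 0 -> expinv 0 s = 0.
Proof. by move=> s0; rewrite /expinv ltNge s0. Qed.

Lemma smooth_step_den s : 0 < expinv 0 s + expinv 0 (-1 * s + 1).
Proof.
have [s0|s0] := ltP 0 s; first by rewrite ltr_pwDl ?expinv0_gt0 ?expinv_ge0.
by rewrite expinv0_le0 // add0r expinv0_gt0 //; lra.
Qed.

Lemma smooth1_smooth_step : smooth1 smooth_step.
Proof.
move=> n; apply: nderM; first exact: smooth1_expinv.
apply: nderV; first by move=> s; rewrite gt_eqF // smooth_step_den.
apply: nderD; first exact: smooth1_expinv.
by apply: nder_affine; exact: smooth1_expinv.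
Qed.

Lemma smooth_step_le0 s : s <= 0 -> smooth_step s = 0.
Proof. by move=> s0; rewrite /smooth_step expinv0_le0 // mul0r. Qed.

Lemma smooth_step_ge1 s : 1 <= s -> smooth_step s = 1.
Proof.
move=> s1; have h := smooth_step_den s; move: h; rewrite /smooth_step.
have -> : expinv 0 (-1 * s + 1) = 0 by apply: expinv0_le0; lra.
by rewrite addr0 => h; rewrite mulfV // gt_eqF.
Qed.

Lemma expinv0_mono s t : s <= t -> expinv 0 s <= expinv 0 t.
Proof.
move=> st; have [s0|s0] := leP s 0; first by rewrite (expinv0_le0 s0) expinv_ge0.
have t0 := lt_le_trans s0 st.
by rewrite /expinv s0 t0 !expr0 !mul1r ler_expR lerN2 lef_pV2.
Qed.

Lemma smooth_step_mono s t : s <= t -> smooth_step s <= smooth_step t.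
Proof.
move=> st; rewrite /smooth_step ler_pdivrMr ?smooth_step_den //.
rewrite mulrAC ler_pdivlMr ?smooth_step_den //.
have h1 := expinv0_mono st.
have h2 : expinv 0 (-1 * t + 1) <= expinv 0 (-1 * s + 1) by apply: expinv0_mono; lra.
have := expinv_ge0 0 s; have := expinv_ge0 0 (-1 * t + 1).
move: (expinv 0 s) (expinv 0 t) (expinv 0 (-1 * t + 1)) (expinv 0 (-1 * s + 1)) h1 h2.
by move=> a b c e ab ce c0 a0; rewrite !mulrDr [b * a]mulrC lerD2l ler_pM.
Qed.

End SmoothOneVariable.

Section OneVariableBounds.
Context (R : realType).
Implicit Types (f : R -> R).

Lemma lipschitz_of_derive f C x y : (forall t, derivable f t 1) ->
  (forall t, `|derive1 f t| <= C) -> `|f x - f y| <= C * `|x - y|.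
Proof.
move=> df fC; wlog xy : x y / x < y.
  move=> H; have [/H //|/H|->] := ltgtP x y; last by rewrite !subrr normr0 mulr0.
  by rewrite distrC [X in _ * X]distrC.
have [c _] := @MVT R f (derive1 f) x y xy
  (fun t _ => DeriveDef (df t) (esym (derive1E f t)))
  (continuous_subspaceT (derivable_continuous df)).
rewrite distrC => ->; rewrite normrM [X in _ <= _ * X]distrC.
by rewrite ler_wpM2r.
Qed.

Lemma bounded_of_support f a b : continuous f -> (forall t, t < a -> f t = 0) ->
  (forall t, b < t -> f t = 0) -> exists2 C : R, 0 <= C & forall t, `|f t| <= C.
Proof.
move=> cf fa fb.
have [M [_ hM]] := compact_bounded (continuous_compact (continuous_subspaceT cf) (@segment_compact R a b)).
exists (Num.max 0 (M + 1)); first by rewrite le_max lexx.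
move=> t; rewrite le_max; apply/orP.
have [ta|ta] := ltP t a; first by left; rewrite fa // normr0.
have [bt|tb] := ltP b t; first by left; rewrite fb // normr0.
right; apply: (hM (M + 1)); first by rewrite ltrDl.
by exists t => //=; rewrite in_itv /= ta.
Qed.

Lemma derive1_const_left f a c : (forall t, t < a -> f t = c) ->
  forall t, t < a -> derive1 f t = 0.
Proof.
move=> fc t ta; rewrite derive1E (@near_eq_derive _ _ _ f (cst c)) ?derive_cst //.
by near=> u; rewrite fc //; near: u; exact: lt_nbhsl.
Unshelve. all: by end_near. Qed.

Lemma derive1_const_right f b c : (forall t, b < t -> f t = c) ->
  forall t, b < t -> derive1 f t = 0.
Proof.
move=> fc t bt; rewrite derive1E (@near_eq_derive _ _ _ f (cst c)) ?derive_cst //.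
by near=> u; rewrite fc //; near: u; exact: lt_nbhsr.
Unshelve. all: by end_near. Qed.

(** The derivatives vanish outside [[0, 1]]. Bounds of order one, two and three control the
    differences of [smooth_step] and of its first two derivatives, that is, the cells of the lattice
    below and their first two derivatives. *)
Lemma smooth_step_derivatives_bounded : exists2 C : R, 0 <= C &
  [/\ forall t, `|derive1 (@smooth_step R) t| <= C,
      forall t, `|derive1 (derive1 (@smooth_step R)) t| <= C
    & forall t, `|derive1 (derive1 (derive1 (@smooth_step R))) t| <= C].
Proof.
have s0 := @smooth1_smooth_step R; have s1 := smooth1_derive s0.
have s2 := smooth1_derive s1; have s3 := smooth1_derive s2.
have l0 (t : R) : t < 0 -> smooth_step t = 0 by move=> /ltW; exact: smooth_step_le0.
have r0 (t : R) : 1 < t -> smooth_step t = 1 by move=> /ltW; exact: smooth_step_ge1.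
have l1 := derive1_const_left l0; have r1 := derive1_const_right r0.
have l2 := derive1_const_left l1; have r2 := derive1_const_right r1.
have l3 := derive1_const_left l2; have r3 := derive1_const_right r2.
have [C1 C10 h1] := bounded_of_support (smooth1_continuous s1) l1 r1.
have [C2 C20 h2] := bounded_of_support (smooth1_continuous s2) l2 r2.
have [C3 C30 h3] := bounded_of_support (smooth1_continuous s3) l3 r3.
exists (C1 + C2 + C3); first by rewrite !addr_ge0.
split=> t; [apply: le_trans (h1 t) _|apply: le_trans (h2 t) _|apply: le_trans (h3 t) _].
- by rewrite -addrA lerDl addr_ge0.
- by rewrite addrAC lerDr addr_ge0.
- by rewrite lerDr addr_ge0.
Qed.

End OneVariableBounds.

Section TensorProducts.
Context (R : realType) (d : nat).
Notation V := 'rV[R]_d.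
Implicit Types (g : 'I_d -> R -> R) (x : V) (j : 'I_d).

Definition tens g x : R := \prod_(i < d) g i (x 0 i).

Definition dtens j g : 'I_d -> R -> R := fun i => if i == j then derive1 (g i) else g i.

Lemma is_derive_tens g j x : (forall i t, derivable (g i) t 1) ->
  is_derive x (delta_mx 0 j : V) (tens g) (tens (dtens j g) x).
Proof.
move=> dg.
pose C := \prod_(i < d | i != j) g i (x 0 i).
have tE (h : R) : tens g (h *: delta_mx 0 j + x) = g j (h *: (1 : R) + x 0 j) * C.
  rewrite /tens (bigD1 j) //= !mxE !eqxx; congr (_ * _).
  by apply: eq_bigr => i ij; rewrite !mxE (negPf ij) andbF mulr0 add0r.
have t0 : tens g x = g j (x 0 j) * C.
  by have := tE 0; rewrite !scale0r !add0r.
have dE : tens (dtens j g) x = 'D_1 (g j) (x 0 j) * C.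
  rewrite /tens (bigD1 j) //= /dtens eqxx derive1E; congr (_ * _).
  by apply: eq_bigr => i ij; rewrite (negPf ij).
have H : (fun h : R => h^-1 *: ((tens g \o shift x) (h *: (delta_mx 0 j : V)) - tens g x)) @ 0^' -->
    tens (dtens j g) x.
  have -> : (fun h : R => h^-1 *: ((tens g \o shift x) (h *: (delta_mx 0 j : V)) - tens g x)) =
      (fun h => (h^-1 *: ((g j \o shift (x 0 j)) (h *: (1 : R)) - g j (x 0 j))) * C).
    by apply/funext => h; rewrite /= tE t0 -mulrBl [LHS]mulrA.
  by rewrite dE; apply: cvgMl; exact: (dg j (x 0 j)).
by apply: DeriveDef; [exact: cvgP H|exact: cvg_lim H].
Qed.

Lemma tens_continuous g : (forall i, continuous (g i)) -> continuous (tens g).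
Proof.
move=> cg.
apply: (@continuous_big _ _ _ _ _ _ _ _ (fun i x => g i (x 0 i))) => [|i _ x].
  exact: mul_continuous.
apply: (@continuous_comp _ _ _ (fun z : V => z 0 i) (g i)); last exact: cg.
exact: coord_continuous.
Qed.

(** Finite combinations of products of functions of one variable form a class that is closed under
    partial derivatives, so smoothness is reduced to one variable. *)
Definition tsum (I : Type) (r : seq I) (c : I -> R) (g : I -> 'I_d -> R -> R) x : R :=
  \sum_(k <- r) c k * tens (g k) x.

Section Tsum.
Variables (I : Type) (r : seq I) (c : I -> R).
Implicit Types G : I -> 'I_d -> R -> R.

Lemma is_derive_tsum G j x : (forall k i t, derivable (G k i) t 1) ->
  is_derive x (delta_mx 0 j : V) (tsum r c G) (tsum r c (fun k => dtens j (G k)) x).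
Proof.
move=> dG; rewrite /tsum; elim: r => [|k s IH].
  rewrite big_nil; have -> : (fun x : V => \sum_(k <- [::]) c k * tens (G k) x) = cst 0.
    by apply/funext => y; rewrite big_nil.
  exact: is_derive_cst.
rewrite big_cons; have -> : (fun x : V => \sum_(k0 <- k :: s) c k0 * tens (G k0) x) =
    (c k \*: tens (G k)) + (fun x => \sum_(k0 <- s) c k0 * tens (G k0) x).
  by apply/funext => y; rewrite big_cons.
apply: is_deriveD; apply: is_deriveZ; exact: is_derive_tens.
Qed.

Lemma partial_tsum G j : (forall k i t, derivable (G k i) t 1) ->
  partial j (tsum r c G) = tsum r c (fun k => dtens j (G k)).
Proof.
move=> dG; apply/funext => x.
by have D := is_derive_tsum j x dG; rewrite /partial derive_val.
Qed.

Lemma tsum_continuous G : (forall k i, continuous (G k i)) -> continuous (tsum r c G).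
Proof.
move=> cG.
apply: (@continuous_big _ _ _ _ _ _ _ _ (fun k x => c k * tens (G k) x)) => [|k _ x].
  exact: add_continuous.
by apply: continuousM; [exact: cst_continuous|exact: tens_continuous].
Qed.

Lemma smooth1_dtens j g : (forall i, smooth1 (g i)) -> forall i, smooth1 (dtens j g i).
Proof. by move=> sg i; rewrite /dtens; case: ifP => // _; exact: smooth1_derive. Qed.

Lemma smooth_tsum G : (forall k i, smooth1 (G k i)) -> smooth (tsum r c G).
Proof.
move=> sG s; elim: s G sG => [|j s IH] G sG /=.
  split; first by apply: tsum_continuous => k i; exact: smooth1_continuous.
  move=> i x; have [] // := @is_derive_tsum G i x _.
  by move=> k l t; exact: smooth1_derivable.
rewrite partial_tsum; last by move=> k l t; exact: smooth1_derivable.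
by apply: IH => k; exact: smooth1_dtens.
Qed.

End Tsum.

Lemma test_function_bounded_support (f : V -> R) (B : R) : smooth f ->
  (forall x, f x != 0 -> enorm x <= B) -> test_function f.
Proof.
move=> sf fB; split => //.
apply: bounded_closed_compact; last exact: closed_closure.
exists B; split; first exact: num_real.
move=> y By x /= cx; apply: le_trans (norm_le_enorm _) _; apply: le_trans (ltW By).
have sub : [set x | f x != 0] `<=` [set x : V | enorm x <= B] by move=> z; exact: fB.
by have := closure_subset sub cx; rewrite -(closure_id _).1 //; exact: closed_enorm_ball.
Qed.

End TensorProducts.

(** Allows a lattice sum to be computed over any finite box that contains its support. *)
Lemma eq_big_support (R : zmodType) (K : eqType) (r1 r2 : seq K) (F : K -> R) :
  uniq r1 -> uniq r2 -> (forall k, F k != 0 -> (k \in r1) && (k \in r2)) ->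
  \sum_(k <- r1) F k = \sum_(k <- r2) F k.
Proof.
move=> u1 u2 h.
have E r : \sum_(k <- r) F k = \sum_(k <- [seq k <- r | F k != 0]) F k.
  rewrite big_filter [LHS](bigID (fun k => F k != 0)) /= [X in _ + X]big1 ?addr0 //.
  by move=> k /negPn/eqP.
rewrite (E r1) (E r2); apply: perm_big; apply: uniq_perm; rewrite ?filter_uniq // => k.
by rewrite !mem_filter; case: eqP => //= /eqP /h /andP[-> ->].
Qed.

(** The same [c] bounds the factors and their rate of change, so every term of the telescoped
    difference carries the full power of [c]. For [c] of the order of the mesh this compensates the
    number of lattice points. *)
Lemma prod_lipschitz (R : realFieldType) (I : Type) (r : seq I) (a b : I -> R) (c e : R) :
  0 <= c -> (forall i, `|a i| <= c) -> (forall i, `|b i| <= c) ->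
  (forall i, `|a i - b i| <= c * e) ->
  `|\prod_(i <- r) a i - \prod_(i <- r) b i| <= (size r)%:R * c ^+ size r * e.
Proof.
move=> c0 ac bc abc; elim: r => [|i r IH].
  by rewrite !big_nil subrr normr0 !mul0r.
rewrite !big_cons /=.
have pc : `|\prod_(j <- r) a j| <= c ^+ size r.
  elim: r {IH} => [|j r IHr]; first by rewrite big_nil normr1 expr0.
  by rewrite big_cons /= normrM exprS ler_pM.
have -> : a i * \prod_(j <- r) a j - b i * \prod_(j <- r) b j =
   (a i - b i) * \prod_(j <- r) a j + b i * (\prod_(j <- r) a j - \prod_(j <- r) b j).
  by ring.
apply: le_trans (ler_normD _ _) _; rewrite !normrM.
apply: (@le_trans _ _ (c * e * c ^+ size r + c * ((size r)%:R * c ^+ size r * e))).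
  by apply: lerD; apply: ler_pM.
by rewrite exprS -natr1 le_eqVlt; apply/orP; left; apply/eqP; ring.
Qed.

(** * Lattice points and smooth partitions of unity *)

Section LatticeBox.
Context (d : nat).
Notation K := 'rV[int]_d.

Definition box_elt (L : nat) (f : {ffun 'I_d -> 'I_(2 * L).+1}) : K :=
  \row_i (Posz (f i) - Posz L).

Definition box (L : nat) : seq K := map (@box_elt L) (enum {ffun 'I_d -> 'I_(2 * L).+1}).

Lemma box_uniq L : uniq (box L).
Proof.
rewrite map_inj_uniq ?enum_uniq // => f g /rowP fg; apply/ffunP => i.
by have := fg i; rewrite !mxE => /addIr [] /val_inj.
Qed.

Lemma size_box L : size (box L) = ((2 * L).+1 ^ d)%N.
Proof. by rewrite size_map -cardE card_ffun !card_ord. Qed.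

Lemma mem_box L (k : K) : (forall i, `|k 0 i| <= Posz L) -> k \in box L.
Proof.
move=> kL; apply/mapP.
exists [ffun i => inord (absz (k 0 i + Posz L))]; first by rewrite mem_enum.
apply/rowP => i; rewrite !mxE ffunE inordK.
  by have := kL i; rewrite ler_norml; move: (k 0 i) => z; lia.
by have := kL i; rewrite ler_norml; move: (k 0 i) => z; lia.
Qed.

End LatticeBox.

Section Lattice.
Context (R : realType) (d n M : nat).
Notation V := 'rV[R]_d.
Notation K := 'rV[int]_d.
Implicit Types (f : R -> R) (k l : int) (s : R).

(* The lattice has mesh [1 / (N m)], the bumps have width about [1 / N]. *)
Let N : R := n.+1%:R.
Let m : R := M.+1%:R.

Let N0 : 0 < N. Proof. by rewrite ltr0n. Qed.
Let m0 : 0 < m. Proof. by rewrite ltr0n. Qed.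

Definition mesh : R := (N * m)^-1.

Lemma mesh_gt0 : 0 < mesh.
Proof. by rewrite invr_gt0 mulr_gt0. Qed.

(** Differences of consecutive shifts of [f], so that sums over [k] telescope; for the smooth step
    the cells add up to 1. A general [f] is allowed because the derivative of a cell of [f] is [N]
    times a cell of the derivative of [f]. *)
Definition cellf f k s := f (N * s + (1 - k%:~R) / m) - f (N * s + (- k%:~R) / m).

Definition cell := cellf (@smooth_step R).

Lemma smooth1_cellf f k : smooth1 f -> smooth1 (cellf f k).
Proof.
move=> sf j; have -> : cellf f k = (fun s => f (N * s + (1 - k%:~R) / m) +
    cst (-1) s * f (N * s + (- k%:~R) / m)).
  by apply/funext => s; rewrite /cellf mulN1r.
apply: nderD; first exact: nder_affine.
by apply: nderM; [exact: nder_cst|exact: nder_affine].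
Qed.

Lemma derive1_cellf f k : (forall s, derivable f s 1) ->
  derive1 (cellf f k) = (fun s => N * cellf (derive1 f) k s).
Proof.
move=> df; apply/funext => s.
have d1 := @is_derive1_affine R f N ((1 - k%:~R) / m) s (df _).
have d2 := @is_derive1_affine R f N ((- k%:~R) / m) s (df _).
have D := is_deriveB d1 d2.
by rewrite derive1E (@derive_val _ _ _ _ _ _ _ D) /cellf mulrBr.
Qed.

Lemma cellf_bound f k s C : (forall t, derivable f t 1) ->
  (forall t, `|derive1 f t| <= C) -> `|cellf f k s| <= C / m.
Proof.
move=> df fC; apply: le_trans (lipschitz_of_derive _ _ df fC) _.
rewrite opprD addrACA subrr add0r -mulrBl opprK subrK.
by rewrite mul1r ger0_norm // invr_ge0 ltW.
Qed.

Lemma cell_ge0 k s : 0 <= cell k s.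
Proof.
rewrite subr_ge0; apply: smooth_step_mono.
by rewrite lerD2l ler_pM2r ?invr_gt0 // lerDr.
Qed.

(** Farther away, both arguments of the step are at least 1 or both are at most 0, since they differ
    by [m^-1 <= 1]. *)
Lemma cell_support k s : cell k s != 0 -> `|s - mesh * k%:~R| <= N^-1.
Proof.
apply: contraNT; rewrite -ltNge => h; apply/eqP; rewrite /cell /cellf.
have e : N * s + - k%:~R / m = N * (s - mesh * k%:~R).
  by rewrite /mesh; field; rewrite !gt_eqF.
have e' : N * s + (1 - k%:~R) / m = N * (s - mesh * k%:~R) + m^-1.
  by rewrite -e; field; rewrite !gt_eqF.
rewrite e e'; move: (s - _) h => t.
have m1 : m^-1 <= 1 by rewrite invf_le1 // ler1n.
have mi0 : 0 < m^-1 by rewrite invr_gt0.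
have [t0|t0] := leP 0 t.
  rewrite ger0_norm // => h.
  have Nt : 1 < N * t by rewrite -ltr_pdivrMl // mulr1.
  by rewrite !smooth_step_ge1 ?subrr // ltW // (lt_le_trans Nt) // lerDl ltW.
rewrite ltr0_norm // => h.
have Nt : 1 < N * - t by rewrite -ltr_pdivrMl // mulr1.
rewrite mulrN in Nt.
by rewrite !smooth_step_le0 ?subrr //; move: (N * t) (m^-1) Nt m1 => A B; lra.
Qed.

Lemma cell_shift k l s : cell k (s + mesh * l%:~R) = cell (k - l) s.
Proof.
rewrite /cell /cellf /mesh intrD mulrNz; congr (smooth_step _ - smooth_step _);
  by field; rewrite !gt_eqF.
Qed.

Definition node (k : K) : V := mesh *: map_mx intr k.

Definition bump (k : K) : V -> R := tens (fun i => cell (k 0 i)).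

Lemma nodeD (k1 k2 : K) : node (k1 + k2) = node k1 + node k2.
Proof. by rewrite /node -scalerDr -map_mxD. Qed.

(** Lattice translations permute the bumps. This is how a lattice sum inherits a bound on the
    increments of its coefficients. *)
Lemma bump_shift (k1 k2 : K) x : bump k1 (x + node k2) = bump (k1 - k2) x.
Proof. by apply: eq_bigr => i _; rewrite !mxE cell_shift. Qed.

Lemma bump_ge0 (k : K) x : 0 <= bump k x.
Proof. by apply: prodr_ge0 => i _; exact: cell_ge0. Qed.

Lemma bump_support (k : K) x : bump k x != 0 -> enorm (x - node k) <= d%:R / N.
Proof.
move=> /prodf_neq0 h; apply: le_trans (enorm_le_sum _) _.
apply: (@le_trans _ _ (\sum_(i < d) N^-1)).
  by apply: ler_sum => i _; rewrite !mxE; apply: cell_support; exact: h.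
by rewrite sumr_const card_ord mulr_natl.
Qed.

(** The sum telescopes to the difference of two steps: by the choice of [L], the argument of the
    first is at least 1 and that of the last is at most 0. *)
Lemma sum_cell (L : nat) s : m * (N * `|s| + 1) <= L%:R ->
  \sum_(j < (2 * L).+1) cell (Posz j - Posz L) s = 1.
Proof.
move=> sL.
pose y (j : nat) : R := smooth_step (N * s + (L%:R + 1 - j%:R) / m).
have cE (j : nat) : cell (Posz j - Posz L) s = y j - y j.+1.
  rewrite /cell /cellf /y intrD mulrNz -natr1.
  by congr (smooth_step (_ + _ / _) - smooth_step (_ + _ / _)); ring.
rewrite (eq_bigr (fun j : 'I_(2 * L).+1 => y j - y j.+1)); last by move=> j _; exact: cE.
rewrite -(big_mkord xpredT (fun j => y j - y j.+1)) (telescope_sumr_eq (fun j => - y j)) //; last first.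
  by move=> j _; rewrite opprK addrC.
have sl := ler_norm s; have sl' : - s <= `|s| by rewrite -normrN ler_norm.
have Lm : N * `|s| + 1 <= L%:R / m by rewrite ler_pdivlMr // mulrC.
have m1 : 0 < m^-1 by rewrite invr_gt0.
have Ns : N * s <= N * `|s| by rewrite ler_pM2l.
have Ns' : - (N * s) <= N * `|s| by rewrite -mulrN ler_pM2l.
rewrite /y smooth_step_le0; last first.
  rewrite -natr1 natrM (_ : (L%:R + 1 - (2 * L%:R + 1)) / m = - (L%:R / m)); last by ring.
  by move: Ns Lm; move: (L%:R / m) (N * s) (N * `|s|) => A B C; lra.
rewrite smooth_step_ge1; first by rewrite oppr0 sub0r opprK.
rewrite subr0 mulrDl mul1r.
by move: Ns' Lm m1; move: (L%:R / m) (N * s) (N * `|s|) (m^-1) => A B C D; lra.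
Qed.

Lemma sum_bump L (x : V) : (forall i, m * (N * `|x 0 i| + 1) <= L%:R) ->
  \sum_(k <- box d L) bump k x = 1.
Proof.
move=> xL; rewrite /box big_map big_enum /=.
transitivity (\prod_(i < d) \sum_(j < (2 * L).+1) cell (Posz j - Posz L) (x 0 i)).
  rewrite bigA_distr_bigA /=; apply: eq_bigr => f _.
  by apply: eq_bigr => i _; rewrite mxE.
by rewrite big1 // => i _; exact: sum_cell.
Qed.

Lemma bump_box L (k : K) (x : V) : (forall i, m * (N * `|x 0 i| + 1) <= L%:R) ->
  bump k x != 0 -> k \in box d L.
Proof.
move=> xL /prodf_neq0 h; apply: mem_box => i.
have := cell_support (h i isT); have := xL i.
rewrite -(ler_int R) intr_norm /mesh => h1 h2.
have e : (k 0 i)%:~R = m * (N * x 0 i) - m * N * (x 0 i - (N * m)^-1 * (k 0 i)%:~R).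
  by field; rewrite !gt_eqF.
rewrite e; apply: le_trans (ler_normB _ _) _; rewrite !normrM (ger0_norm (ltW m0)) (ger0_norm (ltW N0)).
rewrite mulrDr mulr1 in h1; apply: le_trans h1; rewrite lerD2l // -mulrA ler_piMr ?(ltW m0) //.
by rewrite -ler_pdivlMl // mulr1.
Qed.

Lemma smooth_lattice_sum L (w : K -> R) : smooth (tsum (box d L) w (fun (k : K) i => cell (k 0 i))).
Proof. by apply: smooth_tsum => k i; apply: smooth1_cellf; exact: smooth1_smooth_step. Qed.

End Lattice.

(** * Smoothing a function by lattice sums *)

Section Smoothing.
Context (R : realType) (d : nat).
Notation V := 'rV[R]_d.
Notation K := 'rV[int]_d.

Variables (w : V -> R) (Phi : V -> V) (W LPhi kappa : R) (R1 : nat).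
Hypothesis W0 : 0 <= W.
Hypothesis LPhi0 : 0 <= LPhi.
Hypothesis kappa0 : 0 <= kappa.
Hypothesis wW : forall x, `|w x| <= W.
Hypothesis w_supp : forall x, R1%:R < enorm x -> w x = 0.
Hypothesis Phi_lip : forall x y, enorm (Phi x - Phi y) <= LPhi * enorm (x - y).
Hypothesis w_incr : forall x v : V, enorm v <= 1 ->
  w (x + v) - w x <= kappa * enorm v - dotv (Phi x) v + LPhi * enorm v * enorm v.

Section FixedScale.
Variable n : nat.
Let N : R := n.+1%:R.
Let N0 : 0 < N. Proof. by rewrite ltr0n. Qed.

Definition box_size (M : nat) := (R1 * n.+1 * M.+1)%N.

(** A discrete convolution of [w] at width [1 / N]; the box contains all nodes at which [w] does not
    vanish. *)
Definition lattice_sum (M : nat) : V -> R :=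
  tsum (box d (box_size M)) (fun k : K => w (@node R d n M k)) (fun (k : K) i => @cell R n M (k 0 i)).

Lemma lattice_sum_box M (k : K) : w (@node R d n M k) != 0 -> k \in box d (box_size M).
Proof.
move=> wk; apply: mem_box => i.
have : enorm (@node R d n M k) <= R1%:R by rewrite leNgt; apply: contra wk => /w_supp ->.
move/(le_trans (coord_le_enorm _ i)); rewrite !mxE normrM gtr0_norm ?(mesh_gt0 R n M) //.
rewrite -ler_pdivlMl ?(mesh_gt0 R n M) // invrK -intr_norm => h.
rewrite -(ler_int R); apply: le_trans h _.
by rewrite /box_size -[X in _ <= X]/((R1 * n.+1 * M.+1)%:R) !natrM mulrC mulrA.
Qed.

(** Along a lattice vector the increment is the average of increments of [w] at nodes, with the
    bumps at [x] as weights. These nodes are within [d / N] of [x], and this accounts for the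
    additional error from [Phi]. *)
Lemma lattice_sum_incr M x (l : K) : enorm (@node R d n M l : V) <= 1 ->
  lattice_sum M (x + @node R d n M l) - lattice_sum M x <=
  kappa * enorm (@node R d n M l : V) - dotv (Phi x) (@node R d n M l) +
  LPhi * (d%:R / N + enorm (@node R d n M l : V)) * enorm (@node R d n M l : V).
Proof.
move=> v1; set v : V := @node R d n M l.
have [L xL] : exists L : nat, forall i, (M.+1%:R : R) * (N * `|x 0 i| + 1) <= L%:R.
  exists (Num.truncn ((M.+1%:R : R) * (N * enorm x + 1))).+1 => i; apply: ltW.
  apply: le_lt_trans (truncnS_gt _).
  by rewrite ler_pM2l ?ltr0n // lerD2r ler_pM2l // coord_le_enorm.
have E1 : lattice_sum M x = \sum_(k <- box d L) w (@node R d n M k) * @bump R d n M k x.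
  rewrite /lattice_sum /tsum; apply: eq_big_support; rewrite ?box_uniq // => k.
  rewrite mulf_eq0 negb_or => /andP[h1 h2].
  by rewrite lattice_sum_box // (bump_box xL).
have E2 : lattice_sum M (x + v) = \sum_(k <- box d L) w (@node R d n M k + v) * @bump R d n M k x.
  rewrite /lattice_sum /tsum.
  (* Translating the index by [l] moves the shift from the bumps to the nodes. *)
  transitivity (\sum_(k <- [seq k - l | k <- box d (box_size M)]) w (@node R d n M k + v) * @bump R d n M k x).
    rewrite [RHS]big_map; apply: eq_bigr => k _.
    by rewrite -[tens _ _]/(@bump R d n M k (x + v)) bump_shift /v -nodeD subrK.
  apply: eq_big_support; rewrite ?box_uniq //.
    by rewrite map_inj_uniq ?box_uniq //; exact: addIr.
  move=> k; rewrite mulf_eq0 negb_or => /andP[h1 h2].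
  rewrite (bump_box xL) // andbT; apply/mapP; exists (k + l); last by rewrite addrK.
  by apply: lattice_sum_box; rewrite nodeD.
have S1 := sum_bump xL.
rewrite E1 E2 -sumrB; set U := (X in _ <= X).
rewrite -[U]mul1r -S1 mulr_suml; apply: ler_sum => k _.
rewrite -mulrBl [leRHS]mulrC.
have [->|b0] := eqVneq (@bump R d n M k x) 0; first by rewrite !mulr0.
rewrite ler_wpM2r ?bump_ge0 //.
have xk := bump_support b0.
apply: le_trans (w_incr _ v1) _; rewrite /U -/v.
have h1 : dotv (Phi x - Phi (@node R d n M k)) v <= LPhi * (d%:R / N) * enorm v.
  apply: le_trans (dotv_le _ _) _; rewrite ler_wpM2r ?enorm_ge0 //.
  by apply: le_trans (Phi_lip _ _) _; rewrite ler_wpM2l.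
rewrite dotvDl dotvNl in h1.
move: h1; rewrite mulrDr mulrDl; move: (dotv _ _) (dotv _ _) (kappa * _) (LPhi * _ * _) (LPhi * _ * _).
by move=> a b c e f; lra.
Qed.

Lemma partial_lattice_sum M i : partial i (lattice_sum M) =
  tsum (box d (box_size M)) (fun k : K => w (@node R d n M k))
    (fun k => dtens i (fun j => @cell R n M (k 0 j))).
Proof.
apply: partial_tsum => k j t; apply: smooth1_derivable; apply: smooth1_cellf.
exact: smooth1_smooth_step.
Qed.

(** The constant is independent of [M]: the box has of the order of [m ^+ d] lattice points, and
    each term is of the order of [m^-1 ^+ d]. So the mesh can be refined after [C] is known. *)
Lemma partial_lattice_sum_lipschitz : exists2 C : R, 0 <= C &
  forall M i x y, `|partial i (lattice_sum M) x - partial i (lattice_sum M) y| <= C * enorm (x - y).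
Proof.
have [C C0 [h1 h2 h3]] := smooth_step_derivatives_bounded R.
have s0 := @smooth1_smooth_step R; have s1 := smooth1_derive s0; have s2 := smooth1_derive s1.
have N1 : 1 <= N by rewrite ler1n.
pose B := C * N ^+ 2.
have B0 : 0 <= B by rewrite mulr_ge0 // exprn_ge0 // ltW.
(* [D * m] bounds the number of lattice points along a side of the box. *)
pose D : R := 2 * R1%:R * N + 1.
have D0 : 0 <= D by rewrite addr_ge0 // !mulr_ge0 // ltW.
exists ((D * B) ^+ d * W * d%:R); first by rewrite !mulr_ge0 // exprn_ge0 // mulr_ge0.
move=> M i x y; rewrite partial_lattice_sum /tsum -sumrB.
pose m : R := M.+1%:R; have m0 : 0 < m by rewrite ltr0n.
have m1 : 1 <= m by rewrite ler1n.
pose c := B / m; have c0 : 0 <= c by rewrite mulr_ge0 // invr_ge0 ltW.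
have cellc k t : `|@cellf R n M (@smooth_step R) k t| <= C / m.
  by apply: cellf_bound => // u; exact: smooth1_derivable.
have cellc' k t : `|derive1 (@cellf R n M (@smooth_step R) k) t| <= C * N / m.
  rewrite derive1_cellf => [|u]; last exact: smooth1_derivable.
  rewrite normrM (gtr0_norm N0) (_ : C * N / m = N * (C / m)); last by ring.
  rewrite ler_pM2l //.
  by apply: cellf_bound => // u; exact: smooth1_derivable.
have cellc'' k t : `|derive1 (derive1 (@cellf R n M (@smooth_step R) k)) t| <= c.
  rewrite derive1_cellf => [|u]; last exact: smooth1_derivable.
  have -> : derive1 (fun s => N * @cellf R n M (derive1 (@smooth_step R)) k s) t =
      N * derive1 (@cellf R n M (derive1 (@smooth_step R)) k) t.
    have dd : derivable (@cellf R n M (derive1 (@smooth_step R)) k) t 1.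
      by apply: smooth1_derivable; exact: smooth1_cellf.
    by rewrite !derive1E (@deriveZ _ _ _ (@cellf R n M (derive1 (@smooth_step R)) k) N).
  rewrite derive1_cellf => [|u]; last exact: smooth1_derivable.
  rewrite !normrM (gtr0_norm N0) /c /B.
  have -> : C * N ^+ 2 / m = N * (N * (C / m)) by ring.
  rewrite !ler_pM2l //.
  by apply: cellf_bound => // u; exact: smooth1_derivable.
have le1 : C / m <= c.
  by rewrite ler_pM2r ?invr_gt0 // ler_peMr // exprn_ege1.
have le2 : C * N / m <= c.
  by rewrite ler_pM2r ?invr_gt0 // ler_wpM2l // expr2 ler_peMr // ltW.
have bnd (k : K) j t : `|dtens i (fun j => @cell R n M (k 0 j)) j t| <= c.
  rewrite /dtens; case: ifP => _; first exact: le_trans (cellc' _ _) le2.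
  exact: le_trans (cellc _ _) le1.
have lip (k : K) j t u : `|dtens i (fun j => @cell R n M (k 0 j)) j t -
    dtens i (fun j => @cell R n M (k 0 j)) j u| <= c * `|t - u|.
  have sc : smooth1 (@cell R n M (k 0 j)) by exact: smooth1_cellf.
  rewrite /dtens; case: ifP => _; apply: lipschitz_of_derive => v.
  - by apply: smooth1_derivable; exact: smooth1_derive.
  - exact: cellc''.
  - exact: smooth1_derivable.
  - exact: le_trans (cellc' _ _) le2.
apply: le_trans (ler_norm_sum _ _ _) _.
have term (k : K) : `|w (@node R d n M k) * tens (dtens i (fun j => @cell R n M (k 0 j))) x -
    w (@node R d n M k) * tens (dtens i (fun j => @cell R n M (k 0 j))) y| <=
    W * (d%:R * c ^+ d * enorm (x - y)).
  rewrite -mulrBr normrM; apply: ler_pM => //.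
  have := @prod_lipschitz R _ (index_enum 'I_d)
    (fun j => dtens i (fun j => @cell R n M (k 0 j)) j (x 0 j))
    (fun j => dtens i (fun j => @cell R n M (k 0 j)) j (y 0 j)) c (enorm (x - y)) c0.
  have -> : size (index_enum 'I_d) = d by rewrite -sum1_size big_const_ord iter_addn_0 mul1n.
  apply => j //; apply: le_trans (lip _ _ _ _) _; rewrite ler_wpM2l //.
  by have := coord_le_enorm (x - y) j; rewrite !mxE.
apply: (@le_trans _ _ (\sum_(k <- box d (box_size M)) W * (d%:R * c ^+ d * enorm (x - y)))).
  by apply: ler_sum => k _; exact: term.
rewrite big_const_seq count_predT size_box iter_addr_0 -[_ *+ (_ ^ d)]mulr_natr.
have -> : W * (d%:R * c ^+ d * enorm (x - y)) * ((2 * box_size M).+1 ^ d)%:R =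
  ((2 * box_size M).+1%:R * c) ^+ d * W * d%:R * enorm (x - y).
  rewrite natrX [(_ * c) ^+ d]exprMn; move: (c ^+ d) (_%:R ^+ d) (enorm _) (d%:R : R) => p q e D'.
  by ring.
rewrite ler_wpM2r ?enorm_ge0 // ler_wpM2r // ler_wpM2r //.
have key : (2 * box_size M).+1%:R * c <= D * B.
  have -> : (2 * box_size M).+1%:R * c = (2 * box_size M).+1%:R / m * B.
    by rewrite /c mulrA mulrAC.
  rewrite ler_wpM2r // ler_pdivrMr // /box_size -natr1 !natrM /D mulrDl mul1r.
  have -> : (2 * R1%:R * N + 1) * m = R1%:R * N * m + R1%:R * N * m + m by ring.
  by rewrite lerD2l.
by apply: lerXn2r key; rewrite nnegrE mulr_ge0.
Qed.

End FixedScale.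

End Smoothing.

(** * Potentials and their smoothing *)

Section CoordinateTaylor.
Context (R : realType) (d : nat).
Notation V := 'rV[R]_d.
Variables (f : V -> R) (C : R).
Hypothesis C0 : 0 <= C.
Hypothesis df : forall (i : 'I_d) (y : V), derivable f y (delta_mx 0 i).
Hypothesis lf : forall i y z, `|partial i f y - partial i f z| <= C * enorm (y - z).

Lemma is_derive_line (i : 'I_d) (y : V) (t : R) :
  is_derive t 1 (fun t : R => f (y + t *: delta_mx 0 i)) (partial i f (y + t *: delta_mx 0 i)).
Proof.
have H : (fun h : R => h^-1 *: (((fun t : R => f (y + t *: delta_mx 0 i)) \o shift t) (h *: (1 : R)) -
    f (y + t *: delta_mx 0 i))) @ 0^' --> partial i f (y + t *: delta_mx 0 i).
  have -> : (fun h : R => h^-1 *: (((fun t : R => f (y + t *: delta_mx 0 i)) \o shift t) (h *: (1 : R)) -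
      f (y + t *: delta_mx 0 i))) =
    (fun h : R => h^-1 *: ((f \o shift (y + t *: delta_mx 0 i)) (h *: (delta_mx 0 i : V)) -
      f (y + t *: delta_mx 0 i))).
    apply/funext => h /=; congr (_ *: (f _ - _)).
    by rewrite [h *: 1]mulr1 scalerDl addrCA.
  exact: df.
by apply: DeriveDef; [exact: cvgP H|exact: cvg_lim H].
Qed.

(** The segment is parametrized over [[0, 1]], which treats both signs of [c] and [c = 0] at
    once. *)
Lemma line_increment (i : 'I_d) (y : V) (c : R) : exists2 u : R, `|u| <= `|c| &
  f (y + c *: delta_mx 0 i) - f y = c * partial i f (y + u *: delta_mx 0 i).
Proof.
pose g (t : R) := f (y + t *: delta_mx 0 i).
have dg (t : R) : derivable g t 1 by have [] := is_derive_line i y t.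
have dgE (t : R) : derive1 g t = partial i f (y + t *: delta_mx 0 i).
  by have D := is_derive_line i y t; rewrite derive1E (@derive_val _ _ _ _ _ _ _ D).
have D (t : R) : is_derive t 1 (fun t => g (c * t + 0)) (c * partial i f (y + (c * t + 0) *: delta_mx 0 i)).
  by rewrite -dgE; exact: is_derive1_affine.
have cont : continuous (fun t => g (c * t + 0)).
  by apply: derivable_continuous => t; have [] := D t.
have [u] := @MVT R _ _ 0 1 ltr01 (fun t _ => D t) (continuous_subspaceT cont).
rewrite in_itv /= => /andP[u0 u1] E.
exists (c * u + 0).
  by rewrite addr0 normrM (gtr0_norm u0) ler_piMr // ltW.
move: E; rewrite subr0 mulr1 !addr0 mulr1 mulr0 => <-.
by rewrite /g scale0r addr0.
Qed.

(** The way from [x] to [x + v] is a staircase along the coordinate axes, with the mean value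
    theorem on each step. All points met are at most the sum of the [|v 0 i|] away from [x]. *)
Lemma coord_increment (x v : V) :
  `|f (x + v) - f x - dotv (gradient f x) v| <= C * (\sum_(i < d) `|v 0 i|) ^+ 2.
Proof.
rewrite [v in f (x + v)]row_sum_delta /dotv.
have -> : \sum_(i < d) gradient f x 0 i * v 0 i = \sum_(i < d) v 0 i * partial i f x.
  by apply: eq_bigr => i _; rewrite mxE mulrC.
have S0 (s : seq 'I_d) : 0 <= \sum_(i <- s) `|v 0 i| by exact: sumr_ge0.
suff H (s : seq 'I_d) : enorm (\sum_(i <- s) v 0 i *: (delta_mx 0 i : V)) <= \sum_(i <- s) `|v 0 i| /\
  `|f (x + \sum_(i <- s) v 0 i *: (delta_mx 0 i : V)) - f x - \sum_(i <- s) v 0 i * partial i f x| <=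
    C * (\sum_(i <- s) `|v 0 i|) ^+ 2 by case: (H (index_enum 'I_d)).
elim: s => [|i s [IH1 IH2]].
  split; first by rewrite !big_nil enorm0.
  by rewrite !big_nil addr0 !subrr normr0 expr0n mulr0.
rewrite !big_cons; split.
  apply: le_trans (enormD _ _) (lerD _ IH1).
  by rewrite enormZ ler_piMr // enorm_delta.
set y := \sum_(j <- s) v 0 j *: _ in IH1 IH2 *.
have [u uc E] := line_increment i (x + y) (v 0 i).
have hu : `|partial i f (x + y + u *: delta_mx 0 i) - partial i f x| <=
    C * (`|v 0 i| + \sum_(j <- s) `|v 0 j|).
  apply: le_trans (lf _ _ _) _; rewrite ler_wpM2l //.
  rewrite addrAC [x + y]addrC addrK addrC.
  apply: le_trans (enormD _ _) (lerD _ IH1).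
  by rewrite enormZ; apply: le_trans uc; rewrite ler_piMr // enorm_delta.
have hc : `|v 0 i * partial i f (x + y + u *: delta_mx 0 i) - v 0 i * partial i f x| <=
    `|v 0 i| * (C * (`|v 0 i| + \sum_(j <- s) `|v 0 j|)).
  by rewrite -mulrBr normrM; exact: (ler_wpM2l (normr_ge0 _) hu).
have -> : f (x + (v 0 i *: delta_mx 0 i + y)) = f (x + y + v 0 i *: delta_mx 0 i).
  by rewrite [_ + y]addrC addrA.
have -> : f (x + y + v 0 i *: delta_mx 0 i) =
  f (x + y) + v 0 i * partial i f (x + y + u *: delta_mx 0 i) by rewrite -E [f (x + y) + _]addrC subrK.
move: hc IH2 (S0 s) (normr_ge0 (v 0 i)).
move: (v 0 i * partial _ _ _) (v 0 i * partial _ _ _) => q p.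
move: (\sum_(j <- s) v 0 j * _) (\sum_(j <- s) `|_|) (`|v 0 i|) (f (x + y)) (f x) => A S a b c.
move=> h1 h2 S0' a0.
have -> : b + p - c - (q + A) = (p - q) + (b - c - A) by ring.
apply: le_trans (ler_normD _ _) _; apply: le_trans (lerD h1 h2) _.
have : 0 <= C * (a * S) by rewrite !mulr_ge0.
by nra.
Qed.

End CoordinateTaylor.

(** * A test function whose gradient nearly calibrates the field *)

Section Corrector.
Context (R : realType) (d : nat).
Notation V := 'rV[R]_d.
Notation K := 'rV[int]_d.

Lemma lattice_sum_test (w : V -> R) (R1 n M : nat) :
  (forall x, R1%:R < enorm x -> w x = 0) -> test_function (lattice_sum w R1 n M).
Proof.
move=> ws; apply: (@test_function_bounded_support _ _ _ (d%:R / n.+1%:R + R1%:R)).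
  exact: smooth_lattice_sum.
move=> x fx.
have [k wk bk] : exists2 k : K, w (@node R d n M k) != 0 & @bump R d n M k x != 0.
  apply: contrapT => h; case/eqP: fx; apply: big1_seq => k _.
  have [->|wk] := eqVneq (w (@node R d n M k)) 0; first by rewrite mul0r.
  have [e|bk] := eqVneq (@bump R d n M k x) 0; last by case: h; exists k.
  by rewrite -[tens _ _]/(@bump R d n M k x) e mulr0.
rewrite -[x](subrK (@node R d n M k)).
apply: le_trans (enormD _ _) (lerD (bump_support bk) _).
by rewrite leNgt; apply: contra wk => /ws ->.
Qed.

(* The direction of [g] is approached by lattice vectors, whose length is taken
   small first and then large compared with the mesh. *)
Lemma exists_corrector (w : V -> R) (Phi : V -> V) (W LPhi kappa : R) (R1 : nat) (delta : R) :
  0 <= W -> 0 <= LPhi -> 0 <= kappa ->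
  (forall x, `|w x| <= W) -> (forall x, R1%:R < enorm x -> w x = 0) ->
  (forall x y, enorm (Phi x - Phi y) <= LPhi * enorm (x - y)) ->
  (forall x v : V, enorm v <= 1 ->
    w (x + v) - w x <= kappa * enorm v - dotv (Phi x) v + LPhi * enorm v * enorm v) ->
  0 < delta ->
  exists2 f, test_function f & forall x, enorm (Phi x + gradient f x) <= kappa + delta.
Proof.
move=> W0 L0 k0 wW ws Pl wi delta0.
pose e := delta / 8.
have e0 : 0 < e by rewrite divr_gt0.
have d0 : 0 <= d%:R :> R by [].
have [n nP] : exists n : nat, LPhi * (d%:R / n.+1%:R) <= e.
  exists (Num.truncn (LPhi * d%:R / e)); rewrite mulrA ler_pdivrMr // [e * _]mulrC -ler_pdivrMr //.
  by apply: ltW; exact: truncnS_gt.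
have [C C0 fC] := @partial_lattice_sum_lipschitz R d w W R1 W0 wW n.
(* As [enorm v] will be at most [2 * tau], the second-order errors stay below [D * tau * tau], hence
   below [e * tau]. *)
pose D := 4 * LPhi + 4 * (C * d%:R ^+ 2).
have D0 : 0 <= D by rewrite addr_ge0 // mulr_ge0 // mulr_ge0 // exprn_ge0.
have [tau [tau0 tau1 tauD]] : exists tau : R, [/\ 0 < tau, 2 * tau <= 1 & D * tau <= e].
  have D1 : 0 < D + 1 by rewrite ltr_wpDl.
  exists (Num.min (1 / 2) (e / (D + 1))); split.
  - by rewrite lt_min !divr_gt0.
  - by rewrite mulrC -ler_pdivlMr // ge_min lexx.
  - apply: (@le_trans _ _ (D * (e / (D + 1)))).
      by rewrite ler_wpM2l // ge_min lexx orbT.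
    by rewrite mulrA ler_pdivrMr // mulrC ler_pM2l // lerDl.
(* The final inequality yields [delta - 2 * e <= sigma * (2 * kappa + delta + e)]. Its left side is
   [3 / 4 * delta], while [sigma * (kappa + delta) = delta / 4] makes its right side at most
   [delta / 2]. *)
pose sigma := delta / (4 * (kappa + delta)).
have kd0 : 0 < kappa + delta by rewrite ltr_wpDl.
have s0 : 0 < sigma by rewrite divr_gt0 // mulr_gt0.
have sE : sigma * (4 * (kappa + delta)) = delta by rewrite mulfVK // gt_eqF // mulr_gt0.
have s1 : sigma <= 1.
  by rewrite ler_pdivrMr ?mulr_gt0 // mul1r; lra.
have st0 : 0 < sigma * tau by rewrite mulr_gt0.
have [M MP] : exists M : nat, d%:R * mesh R n M <= sigma * tau.
  exists (Num.truncn (d%:R / (sigma * tau))); set M := Num.truncn _.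
  rewrite /mesh invfM mulrA ler_pdivrMr //.
  apply: (@le_trans _ _ d%:R).
    by rewrite ler_piMr // invf_le1 // ler1n.
  by rewrite mulrC -ler_pdivrMr // ltW // truncnS_gt.
have ft := @lattice_sum_test w R1 n M ws.
exists (lattice_sum w R1 n M) => // x.
rewrite leNgt; apply/negP => gbig.
set f := lattice_sum w R1 n M in gbig ft *; set g := Phi x + gradient f x in gbig.
have g0 : 0 < enorm g by apply: lt_trans gbig.
have mesh0 := mesh_gt0 R n M; set h := mesh R n M in mesh0 MP.
pose y : V := (tau / enorm g) *: g.
pose l : K := \row_i Num.floor (y 0 i / h).
pose v : V := @node R d n M l.
have yv i : `|(y - v) 0 i| <= h.
  have -> : (y - v) 0 i = y 0 i - h * (Num.floor (y 0 i / h))%:~R.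
    by rewrite !mxE.
  have /andP[f1 f2] := floor_itv (y 0 i / h).
  move: f1 f2; rewrite ler_pdivlMr // ltr_pdivrMr // intrD mulrDl mul1r [h * _]mulrC.
  by move: (y 0 i) (_ * h) => a b f1 f2; rewrite ler_norml; apply/andP; split; lra.
have yvn : enorm (y - v) <= sigma * tau.
  apply: le_trans MP; apply: le_trans (enorm_le_sum _) _.
  apply: (@le_trans _ _ (\sum_(i < d) h)); first by apply: ler_sum => i _.
  by rewrite sumr_const card_ord mulr_natl.
have yn : enorm y = tau.
  by rewrite enormZ ger0_norm ?divr_ge0 ?ltW // mulfVK // gt_eqF.
have vn : enorm v <= tau + sigma * tau.
  rewrite -[v](subKr y); apply: le_trans (enormD _ _) _.
  by rewrite enormN yn lerD2l.
have vn2 : enorm v <= 2 * tau.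
  apply: le_trans vn _; have : sigma * tau <= tau by rewrite ler_piMl // ltW.
  by move: (sigma * tau) => q; lra.
have v1 : enorm v <= 1 by apply: le_trans vn2 _.
have inc := @lattice_sum_incr R d w Phi LPhi kappa R1 L0 ws Pl wi n M x l v1.
have tay : `|f (x + v) - f x - dotv (gradient f x) v| <= C * (\sum_(i < d) `|v 0 i|) ^+ 2.
  apply: coord_increment => //.
    by move=> i z; case: ft => sf _; case: (sf [::]) => _; exact.
  by move=> i a b; exact: fC.
have sv : (\sum_(i < d) `|v 0 i|) ^+ 2 <= d%:R ^+ 2 * (enorm v * enorm v).
  rewrite -expr2 -exprMn; apply: lerXn2r; rewrite ?nnegrE ?sumr_ge0 ?mulr_ge0 ?enorm_ge0 //.
  apply: (@le_trans _ _ (\sum_(i < d) enorm v)).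
    by apply: ler_sum => i _; exact: coord_le_enorm.
  by rewrite sumr_const card_ord mulr_natl.
have gv : tau * enorm g - enorm g * (sigma * tau) <= dotv g v.
  have -> : dotv g v = dotv g y - dotv g (y - v) by rewrite (dotvDr y) dotvNr subKr.
  have -> : dotv g y = tau * enorm g.
    by rewrite dotvZr -sqr_enorm expr2 mulrA mulfVK // gt_eqF.
  rewrite lerD2l lerN2; apply: le_trans (dotv_le _ _) _.
  by rewrite ler_pM2l.
have gE : dotv g v = dotv (Phi x) v + dotv (gradient f x) v by rewrite dotvDl.
(* The increment of [f] along [v] is bounded above by [lattice_sum_incr] and below by its
   first-order expansion. *)
have key : dotv g v <= (kappa + e) * enorm v + (LPhi + C * d%:R ^+ 2) * (enorm v * enorm v).
  have t1 : - (C * (d%:R ^+ 2 * (enorm v * enorm v))) <= f (x + v) - f x - dotv (gradient f x) v.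
    rewrite lerNl; apply: (@le_trans _ _ (C * (\sum_(i < d) `|v 0 i|) ^+ 2)); last exact: ler_wpM2l.
    by apply: le_trans tay; rewrite -normrN ler_norm.
  have t2 : LPhi * (d%:R / n.+1%:R) * enorm v <= e * enorm v.
    by rewrite ler_wpM2r // enorm_ge0.
  rewrite gE; move: t1 t2 inc; rewrite -/v -/f mulrDr !mulrDl !mulrA.
  move: (kappa * enorm v) (e * enorm v) (dotv (Phi x) v) (dotv (gradient f x) v) (f (x + v) - f x).
  move: (LPhi * d%:R / _ * enorm v) (LPhi * enorm v * enorm v) (C * d%:R ^+ 2 * enorm v * enorm v).
  by move=> *; lra.
have q1 : (kappa + e) * enorm v <= (kappa + e) * (tau + sigma * tau).
  by rewrite ler_wpM2l // addr_ge0 // ltW.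
have q2 : (LPhi + C * d%:R ^+ 2) * (enorm v * enorm v) <= e * tau.
  apply: (@le_trans _ _ (D * tau * tau)); last by rewrite ler_pM2r.
  have -> : D * tau * tau = (LPhi + C * d%:R ^+ 2) * ((2 * tau) * (2 * tau)).
    by rewrite /D; ring.
  rewrite ler_wpM2l ?ler_pM ?enorm_ge0 //.
  by rewrite addr_ge0 // mulr_ge0 // exprn_ge0.
have fin : enorm g * (1 - sigma) * tau <= ((kappa + e) * (1 + sigma) + e) * tau.
  move: gv key q1 q2; move: (dotv g v) (_ * enorm v) (_ * (enorm v * enorm v)) => A B E.
  by nra.
rewrite ler_pM2r // in fin.
have s1' : 0 <= 1 - sigma by rewrite subr_ge0.
have : (kappa + delta) * (1 - sigma) <= (kappa + e) * (1 + sigma) + e.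
  by apply: le_trans fin; rewrite ler_wpM2r // ltW.
have se : sigma * e <= sigma * delta by rewrite ler_pM2l // /e; lra.
have eE : 8 * e = delta by rewrite /e mulrC mulfVK.
move: se eE sE delta0; move: (sigma) (e) (kappa) (delta) => s' e' k' dl se eE sE dl0.
by nra.
Qed.

End Corrector.

(** * The potential as a minimal cost of paths *)

Section Potential.
Context (R : realType) (d : nat).
Notation V := 'rV[R]_d.
Variables (Phi : V -> V) (LPhi K R0 kappa : R).
Hypothesis LPhi0 : 0 <= LPhi.
Hypothesis K0 : 0 <= K.
Hypothesis R00 : 0 <= R0.
Hypothesis kappa0 : 0 < kappa.
Hypothesis cPhi : continuous Phi.
Hypothesis Phi_lip : forall x y, enorm (Phi x - Phi y) <= LPhi * enorm (x - y).
Hypothesis PhiK : forall x, enorm (Phi x) <= K.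
Hypothesis Phi_supp : forall x, R0 < enorm x -> Phi x = 0.
Hypothesis closed_le_len : forall a s, last a s = a -> pint Phi a s <= kappa * plen a s.

Definition cost (a : V) (s : seq V) : R := kappa * plen a s - pint Phi a s.

Lemma cost_cons a b s : cost a (b :: s) =
  kappa * enorm (b - a) - line_int Phi a b + cost b s.
Proof. by rewrite /cost plen_cons pint_cons mulrDr opprD addrACA. Qed.

Lemma cost_rcons a s b : cost a (rcons s b) =
  cost a s + (kappa * enorm (b - last a s) - line_int Phi (last a s) b).
Proof.
rewrite /cost -cats1 plen_cat pint_cat plen_nil pint_nil !addr0 mulrDr.
by rewrite opprD addrACA.
Qed.

(* Edges of length at most 1 cannot jump over the support of [Phi]; this makes the
   infimum of the costs below vanish far away from that support. *)
Definition short (a : V) (s : seq V) := path (fun x y : V => enorm (y - x) <= 1) a s.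

Definition far (v : V) := R0 + 1 < enorm v.

Lemma line_int_le a b : `|line_int Phi a b| <= K * enorm (b - a).
Proof.
have := @line_int_near R d Phi a b 0 K cPhi; rewrite dotv0l subr0; apply => t _.
rewrite subr0; apply: le_trans (normr_dotv_le _ _) _.
by rewrite -[leRHS]mulr1 ler_pM ?enorm_ge0 ?enorm_dir_le1.
Qed.

Lemma line_int_far a b : enorm (b - a) <= 1 -> far a \/ far b -> line_int Phi a b = 0.
Proof.
move=> ab fab; apply/eqP; rewrite -normr_le0.
have := @line_int_near R d Phi a b 0 0 cPhi; rewrite dotv0l subr0 mul0r; apply => t /andP[t0 tl].
suff -> : Phi (edge a b t) = 0 by rewrite subr0 dotv0l normr0.
apply: Phi_supp.
have ha : enorm (a - edge a b t) <= 1.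
  rewrite -{1}(edge0 a b) edgeB enormZ sub0r normrN ger0_norm //.
  by apply: le_trans (le_trans tl ab); rewrite ler_piMr // enorm_dir_le1.
have hb : enorm (b - edge a b t) <= 1.
  rewrite -{1}(edge1 a b) edgeB enormZ ger0_norm ?subr_ge0 //.
  apply: (@le_trans _ _ (enorm (b - a) - t)); first by rewrite ler_piMr ?subr_ge0 // enorm_dir_le1.
  by apply: le_trans ab; rewrite lerBlDr lerDl.
have lower c : far c -> enorm (c - edge a b t) <= 1 -> R0 < enorm (edge a b t).
  move=> fc hc; have := enormB c (c - edge a b t); rewrite subKr.
  move: fc hc; rewrite /far; move: (enorm c) (enorm (c - _)) (enorm (edge a b t)) => x y z.
  lra.
by case: fab => /lower; apply.
Qed.

(** Bounds the cost of a single edge that closes a path with both ends in the ball of radius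
    [R0 + 1]. *)
Definition cost_bound : R := (kappa + K) * (2 * (R0 + 1)).

Lemma cost_bound_ge0 : 0 <= cost_bound.
Proof. by rewrite mulr_ge0 ?addr_ge0 ?mulr_ge0 ?addr_ge0 // ltW. Qed.

Lemma cost_near z s : short z s -> ~ far (last z s) -> - cost_bound <= cost z s.
Proof.
elim: s z => [|b s IH] z sh nf.
  by rewrite /cost plen_nil pint_nil mulr0 subr0 oppr_le0 cost_bound_ge0.
have [fz|nz] := pselect (far z).
  move: sh => /= /andP[sb sh]; rewrite cost_cons line_int_far //; last by left.
  rewrite subr0; apply: le_trans (IH b sh nf) _.
  by rewrite lerDr mulr_ge0 ?enorm_ge0 // ltW.
move: (b :: s) sh nf => {b IH} s sh nf.
have : 0 <= cost z (rcons s z).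
  by rewrite subr_ge0; apply: closed_le_len; rewrite last_rcons.
rewrite cost_rcons.
have le_dist : enorm (z - last z s) <= 2 * (R0 + 1).
  apply: le_trans (enormD _ _) _; rewrite enormN.
  move: nz nf; rewrite /far => /negP; rewrite -leNgt => nz /negP; rewrite -leNgt => nf.
  by rewrite mulr_natl mulr2n lerD.
have := line_int_le (last z s) z; rewrite ler_norml => /andP[h _].
have : (kappa + K) * enorm (z - last z s) <= cost_bound.
  by rewrite ler_wpM2l // addr_ge0 // ltW.
move: h; move: (cost z s) (line_int _ _ _) (enorm _) => A B D.
by rewrite mulrDl; lra.
Qed.

(** A path that is always far meets no field and has nonnegative cost. Otherwise, after its last
    near vertex, it pays [kappa] for each unit of length, at least up to its final distance from the
    origin. *)
Lemma cost_far z s : short z s -> far (last z s) ->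
  0 <= cost z s \/ kappa * (enorm (last z s) - R0 - 1) - cost_bound <= cost z s.
Proof.
elim/last_ind: s => [|s x IH]; first by left; rewrite /cost plen_nil pint_nil mulr0 subr0.
rewrite /short rcons_path last_rcons => /andP[sh sx] fx.
rewrite cost_rcons line_int_far //; last by right.
rewrite subr0; set y := last z s in IH sx *.
have xy : enorm x <= enorm y + enorm (x - y).
  by rewrite -[x in enorm x](subrK y) addrC enormD.
have k := ltW kappa0.
have kxy : kappa * enorm x <= kappa * enorm y + kappa * enorm (x - y).
  by rewrite -mulrDr ler_wpM2l.
have e0 : 0 <= kappa * enorm (x - y) by rewrite mulr_ge0 ?enorm_ge0.
have [fy|ny] := pselect (far y).
  case: (IH sh fy) => h; first by left; rewrite addr_ge0.
  right; move: h kxy; rewrite !mulrBr.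
  by move: (kappa * enorm x) (kappa * enorm y) (kappa * enorm (x - y)) (cost z s) => A B D E; lra.
right; have h := cost_near sh ny; move/negP: ny; rewrite -leNgt => ny.
have : kappa * enorm y <= kappa * (R0 + 1) by rewrite ler_wpM2l.
move: h kxy; rewrite !mulrBr mulrDr.
by move: (kappa * enorm x) (kappa * enorm y) (kappa * enorm (x - y)) (cost z s) => A B D E; lra.
Qed.

Lemma cost_ge z s : short z s -> - cost_bound <= cost z s.
Proof.
move=> sh; have [f|nf] := pselect (far (last z s)); last exact: cost_near.
case: (cost_far sh f) => h; first by apply: le_trans h; rewrite oppr_le0 cost_bound_ge0.
apply: le_trans h; rewrite lerDr mulr_ge0 //; first exact: ltW.
by move: f; rewrite /far => f; lra.
Qed.

Definition path_costs (x : V) : set R :=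
  [set c | exists z s, [/\ short z s, last z s = x & c = cost z s]].

Definition potential (x : V) : R := inf (path_costs x).

Lemma path_costs0 x : path_costs x 0.
Proof. by exists x, [::]; split => //; rewrite /cost plen_nil pint_nil mulr0 subr0. Qed.

Lemma path_costs_lbound x : lbound (path_costs x) (- cost_bound).
Proof. by move=> _ [z [s [sh _ ->]]]; exact: cost_ge. Qed.

Lemma potential_le x c : path_costs x c -> potential x <= c.
Proof. by move=> pc; apply: ge_inf => //; exists (- cost_bound); exact: path_costs_lbound. Qed.

Lemma le_potential x c : lbound (path_costs x) c -> c <= potential x.
Proof. by move=> h; apply: lb_le_inf => //; exists 0; exact: path_costs0. Qed.

Lemma potential_bounded x : `|potential x| <= cost_bound.
Proof.
rewrite ler_norml (le_potential (@path_costs_lbound x)) /=.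
exact: le_trans (potential_le (path_costs0 x)) cost_bound_ge0.
Qed.

(** So far out, the way from the near region costs more than [cost_bound] can refund, so no path
    beats the trivial one. *)
Lemma potential_supp x : R0 + 1 + cost_bound / kappa < enorm x -> potential x = 0.
Proof.
move=> xbig.
have fx : far x.
  by apply: le_lt_trans xbig; rewrite lerDl divr_ge0 ?cost_bound_ge0 // ltW.
apply/le_anti/andP; split; first exact: (potential_le (path_costs0 x)).
apply: le_potential => _ [z [s [sh ls ->]]].
have fl : far (last z s) by rewrite ls.
case: (cost_far sh fl); rewrite // ls => h; apply: le_trans h.
by rewrite subr_ge0 -ler_pdivrMl // mulrC; move: xbig; lra.
Qed.

(** A path ending at [x] may be continued by the edge to [x + v], which is short; along this edge
    [Phi] differs from [Phi x] by at most [LPhi * enorm v]. *)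
Lemma potential_incr (x v : V) : enorm v <= 1 ->
  potential (x + v) - potential x <=
  kappa * enorm v - dotv (Phi x) v + LPhi * enorm v * enorm v.
Proof.
move=> v1; have xv : x + v - x = v by rewrite addrC addKr.
have h1 : potential (x + v) - (kappa * enorm v - line_int Phi x (x + v)) <= potential x.
  apply: le_potential => _ [z [s [sh ls ->]]]; rewrite lerBlDr.
  apply: potential_le; exists z, (rcons s (x + v)); split.
  - by rewrite /short rcons_path ls xv v1 andbT.
  - by rewrite last_rcons.
  - by rewrite cost_rcons ls xv.
have := @line_int_near R d Phi x (x + v) (Phi x) (LPhi * enorm v) cPhi; rewrite xv.
have -> : (forall t : R, 0 <= t <= enorm v ->
    `|dotv (Phi (edge x (x + v) t) - Phi x) (dir x (x + v))| <= LPhi * enorm v) = True.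
  apply/propT => t /andP[t0 tv]; apply: le_trans (normr_dotv_le _ _) _.
  rewrite -[leRHS]mulr1 ler_pM ?enorm_ge0 ?enorm_dir_le1 //.
  apply: le_trans (Phi_lip _ _) _; rewrite ler_wpM2l //.
  have -> : edge x (x + v) t - x = t *: dir x (x + v) by rewrite /edge addrC addKr.
  rewrite enormZ ger0_norm //.
  by apply: le_trans tv; rewrite ler_piMr // enorm_dir_le1.
move=> /(_ I); rewrite ler_norml => /andP[h2 _].
move: h1 h2; move: (potential _) (potential _) (line_int _ _ _) (dotv _ _) (kappa * _) (LPhi * _ * _).
by move=> *; lra.
Qed.

Lemma vintegral_le_closed F delta : divergence_free F -> 0 < delta ->
  vintegral F Phi <= (kappa + delta) * vmass F.
Proof.
move=> divF delta0.
pose R1 := (Num.truncn (R0 + 1 + cost_bound / kappa)).+1.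
have supp x : R1%:R < enorm x -> potential x = 0.
  by move=> xb; apply: potential_supp; apply: lt_trans xb; exact: truncnS_gt.
have [f ft fP] := exists_corrector cost_bound_ge0 LPhi0 (ltW kappa0)
  potential_bounded supp Phi_lip potential_incr delta0.
have bPhi := bfield_continuous cPhi PhiK.
have bg : bfield (gradient f).
  move=> i; split.
    have -> : (fun x : borel R d => gradient f x 0 i) = partial i f.
      by apply/funext => x; rewrite mxE.
    by apply: continuous_borel_measurable; case: ft => sf _; case: (sf [:: i]).
  exists (kappa + delta + K) => x; apply: le_trans (coord_le_enorm _ _) _.
  rewrite -[gradient f x](addKr (Phi x)) addrC.
  by apply: le_trans (enormD _ _) _; rewrite enormN lerD.
have := vintegralD F bPhi bg; rewrite divF // addr0 => <-.
apply: vintegral_le fP; first exact: bfieldD.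
by rewrite addr_ge0 // ltW.
Qed.

End Potential.

Theorem vintegral_le_of_good (R : realType) (d : nat) (F : vmeasure R d)
    (Phi : 'rV[R]_d -> 'rV[R]_d) (LPhi K R0 lam : R) :
  divergence_free F -> 0 <= LPhi -> 0 <= K -> 0 <= R0 -> 0 <= lam -> continuous Phi ->
  (forall x y, enorm (Phi x - Phi y) <= LPhi * enorm (x - y)) ->
  (forall x, enorm (Phi x) <= K) -> (forall x, R0 < enorm x -> Phi x = 0) ->
  (forall a s, last a s = a -> good a s -> pint Phi a s <= lam * plen a s) ->
  vintegral F Phi <= 3 * lam * vmass F.
Proof.
move=> divF L0 K0 R00 lam0 cPhi Plip PhiK Psupp gl.
apply/ler_addgt0Pr => e e0.
(* [delta] is spent twice: once to make the rate positive even when [lam = 0], and once for the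
   smoothing. *)
pose delta := e / (2 * (vmass F + 1)).
have m0 := vmass_ge0 F.
have m1 : 0 < 2 * (vmass F + 1) by rewrite mulr_gt0 // ltr_wpDl.
have delta0 : 0 < delta by rewrite divr_gt0.
have k0 : 0 < 3 * lam + delta by rewrite ltr_wpDl // mulr_ge0.
have cl a s : last a s = a -> pint Phi a s <= (3 * lam + delta) * plen a s.
  move=> la; apply: le_trans (closed_pint_le cPhi lam0 gl la) _.
  by rewrite ler_wpM2r ?plen_ge0 // lerDl ltW.
apply: le_trans (vintegral_le_closed L0 K0 R00 k0 cPhi Plip PhiK Psupp cl divF delta0) _.
rewrite -addrA mulrDl lerD2l.
have <- : delta * (2 * (vmass F + 1)) = e by rewrite mulfVK // gt_eqF.
have -> : (delta + delta) * vmass F = delta * (2 * vmass F) by ring.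
by rewrite ler_pM2l // ler_pM2l // lerDl.
Qed.

(** * Approximation by good loops *)

Section Separation.
Context (R : realType) (J : finType) (X : Type).
Variables (ev : X -> J -> R) (len : X -> R) (f : J -> R) (B C : R).
Implicit Types (l : seq (R * X)) (c : J -> R) (t : R).

Definition nonneg_weights l := all (fun p => 0 <= p.1) l.
Definition weighted (g : X -> R) l : R := \sum_(p <- l) p.1 * g p.2.

Lemma weighted_cat g l1 l2 : weighted g (l1 ++ l2) = weighted g l1 + weighted g l2.
Proof. exact: big_cat. Qed.

Lemma weighted_scale g t l : weighted g [seq (t * p.1, p.2) | p <- l] = t * weighted g l.
Proof.
rewrite /weighted big_map mulr_sumr; apply: eq_bigr => p _ /=; exact: esym (mulrA _ _ _).
Qed.

Lemma nonneg_weights_scale t l : 0 <= t -> nonneg_weights l ->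
  nonneg_weights [seq (t * p.1, p.2) | p <- l].
Proof.
by move=> t0; rewrite /nonneg_weights all_map; apply: sub_all => p /= p0; exact: mulr_ge0.
Qed.

Lemma ler_weighted_norm (g h : X -> R) l : nonneg_weights l ->
  (forall x, `|g x| <= h x) -> `|weighted g l| <= weighted h l.
Proof.
move=> l0 gh; apply: le_trans (ler_norm_sum _ _ _) _.
elim: l l0 => [_|p l IH /= /andP[p0 l0]]; first by rewrite /weighted !big_nil.
rewrite /weighted !big_cons lerD ?IH //.
by rewrite normrM ger0_norm // ler_wpM2l.
Qed.

Lemma weightedZ t g l : weighted (fun x => t * g x) l = t * weighted g l.
Proof. by rewrite /weighted mulr_sumr; apply: eq_bigr => p _; rewrite mulrCA. Qed.

Hypotheses (len0 : forall x, 0 <= len x) (B0 : 0 <= B) (C0 : 0 < C).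
Hypothesis evB : forall x j, `|ev x j| <= B * len x.
Hypothesis dual : forall c t, 0 <= t ->
  (forall x, \sum_j c j * ev x j <= t * len x) -> \sum_j c j * f j <= C * t.

Let feasible l := nonneg_weights l /\ weighted len l <= C.
Let val l j := weighted (ev^~ j) l.
Let gap l : R := \sum_j (f j - val l j) ^+ 2.

Let gap_ge0 l : 0 <= gap l.
Proof. by apply: sumr_ge0 => j _; exact: sqr_ge0. Qed.

Let val_le l j : feasible l -> `|val l j| <= B * C.
Proof.
move=> [l0 lC]; apply: le_trans (ler_weighted_norm (h := fun x => B * len x) l0 _) _ => //.
by rewrite weightedZ ler_wpM2l.
Qed.

Let mix t l1 l2 := [seq ((1 - t) * p.1, p.2) | p <- l1] ++ [seq (t * p.1, p.2) | p <- l2].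

Let feasible_mix t l1 l2 : 0 <= t <= 1 -> feasible l1 -> feasible l2 -> feasible (mix t l1 l2).
Proof.
move=> /andP[t0 t1] [n1 w1] [n2 w2]; split.
  by rewrite /nonneg_weights all_cat; apply/andP; split; apply: nonneg_weights_scale; rewrite ?subr_ge0.
rewrite weighted_cat !weighted_scale (_ : C = (1 - t) * C + t * C); last by ring.
by rewrite lerD // ler_wpM2l ?subr_ge0.
Qed.

Let val_mix t l1 l2 j : val (mix t l1 l2) j = val l1 j + t * (val l2 j - val l1 j).
Proof. by rewrite /val weighted_cat !weighted_scale; ring. Qed.

(* A feasible combination almost minimizing the distance to [f] would otherwise
   give a functional separating [f] from all of them, contradicting [dual]. *)
Lemma exists_near_combination e : 0 < e -> exists l,
  [/\ nonneg_weights l, weighted len l <= C & forall j, `|weighted (ev^~ j) l - f j| <= e].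
Proof.
move=> e0.
pose S := [set gap l | l in feasible].
have S0 : S !=set0.
  by exists (gap [::]), [::] => //; split => //; rewrite /weighted big_nil ltW.
have lS : lbound S 0 by move=> _ [l _ <-]; exact: gap_ge0.
have hS : has_inf S by split => //; exists 0.
pose D := inf S.
have D0 : 0 <= D by apply: lb_le_inf.
have lD l : feasible l -> D <= gap l by move=> fl; apply: ge_inf; [exists 0|exists l].
have appr eta : 0 < eta -> exists2 l, feasible l & gap l < D + eta.
  by move=> eta0; have [_ [l fl <-] h] := inf_adherent eta0 hS; exists l.
have [Dp|] := ltP 0 D; last first.
  move=> Dn; have {Dn}DE : D = 0 by apply/eqP; rewrite eq_le Dn.
  have [l fl] := appr (e ^+ 2) (exprn_gt0 _ e0); rewrite DE add0r => gl.
  exists l; case: (fl) => l0 lC; split => // j.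
  rewrite -(@ler_pXn2r R 2) ?nnegrE ?normr_ge0 ?(ltW e0) // real_normK ?num_real //.
  apply: le_trans (ltW gl); rewrite -sqrrN opprB /gap (bigD1 j) //= lerDl.
  by apply: sumr_ge0 => k _; exact: sqr_ge0.
exfalso.
pose M : R := \sum_(j : J) (2 * (B * C)) ^+ 2.
have M0 : 0 <= M by apply: sumr_ge0 => j _; exact: sqr_ge0.
(* A step from [q] towards [l] so short that its quadratic term is at most [t * D / 2]; the defect
   of optimality of [q] is chosen of the same size. *)
pose t := D / (2 * (M + D)).
have MD : 0 < 2 * (M + D) by rewrite mulr_gt0 // ltr_wpDl.
have t0 : 0 < t by rewrite divr_gt0.
have tE : t * (2 * (M + D)) = D by rewrite mulfVK // gt_eqF.
have t1 : t <= 1.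
  by rewrite ler_pdivrMr // mul1r; move: M0 Dp; move: (D) (M) => x y; lra.
have tM : 2 * (t * M) <= D.
  have := mulr_ge0 (ltW t0) D0; move: tE; move: (t) (D) (M) => x y z; lra.
have [q fq gq] := appr (t * D / 2) (divr_gt0 (mulr_gt0 t0 Dp) (ltr0n _ 2)).
pose c j := f j - val q j.
(* First-order optimality: moving from [q] towards [l] cannot bring the gap below [D], so the
   product of [c] with the displacement is at most [D / 2], whereas its product with [f - val q] is
   the gap of [q], at least [D]. *)
have cq l : feasible l -> \sum_j c j * val l j <= \sum_j c j * f j - D / 2.
  move=> fl.
  have := lD _ (@feasible_mix t q l _ fq fl).
  rewrite (ltW t0) t1 => /(_ isT).
  have -> : gap (mix t q l) = gap q - 2 * t * (\sum_j c j * (val l j - val q j)) +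
      t ^+ 2 * \sum_j (val l j - val q j) ^+ 2.
    rewrite /gap !mulr_sumr -sumrB -big_split /=; apply: eq_bigr => j _.
    by rewrite val_mix /c; ring.
  have h1 : \sum_j (val l j - val q j) ^+ 2 <= M.
    apply: ler_sum => j _; rewrite -[leLHS]real_normK ?num_real // ler_pXn2r ?nnegrE //.
      apply: le_trans (ler_normB _ _) _.
      by rewrite mulr_natl mulr2n lerD // val_le.
    by rewrite !mulr_ge0 // ltW.
  have h2 : gap q = \sum_j c j * f j - \sum_j c j * val q j.
    by rewrite /gap -sumrB; apply: eq_bigr => j _; rewrite /c; ring.
  have -> : \sum_j c j * (val l j - val q j) = \sum_j c j * val l j - \sum_j c j * val q j.
    by rewrite -sumrB; apply: eq_bigr => j _; rewrite mulrBr.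
  move: gq (lD q fq) h1 h2; move: (gap q) (\sum_j c j * val l j) (\sum_j c j * val q j)
    (\sum_j c j * f j) (\sum_j _) => g x y z s gq Dg sM gE h.
  have h3 : t ^+ 2 * s <= t * (D / 2).
    rewrite expr2 -mulrA; apply: ler_wpM2l; first exact: ltW.
    apply: (@le_trans _ _ (t * M)); first by apply: ler_wpM2l => //; exact: ltW.
    by move: tM; move: (t * M) (D) => y' D'; lra.
  have h4 : t * (2 * (x - y)) <= t * D.
    have <- : 2 * t * (x - y) = t * (2 * (x - y)) by ring.
    move: h3 h gq; move: (2 * t * (x - y)) (t ^+ 2 * s) => u v.
    rewrite -[t * D / 2]mulrA; have -> : t * D = t * (D / 2) + t * (D / 2) by rewrite -mulrDr -splitr.
    by move: (t * (D / 2)) => w; lra.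
  move: h4; rewrite ler_pM2l //; move: Dg gE; move: (D) => D'; lra.
(* The rate for which [dual] would bound the value at [f] by itself minus [D / 2]. *)
pose lam := (\sum_j c j * f j - D / 2) / C.
have lamC : C * lam = \sum_j c j * f j - D / 2 by rewrite mulrC mulfVK // gt_eqF.
have lam0 : 0 <= lam.
  apply: divr_ge0; last exact: ltW.
  have f0 : feasible [::] by split => //; rewrite /weighted big_nil ltW.
  apply: le_trans (cq _ f0).
  by rewrite big1 // => j _; rewrite /val /weighted big_nil mulr0.
have : \sum_j c j * f j <= C * lam.
  apply: dual lam0 _ => x.
  have [l0|] := ltP 0 (len x); last first.
    move=> ln; have {ln} lx : len x = 0 by apply/eqP; rewrite eq_le ln len0.
    rewrite lx mulr0 big1 // => j _; apply/eqP; rewrite mulf_eq0; apply/orP; right.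
    by rewrite -normr_le0; have := evB x j; rewrite lx mulr0.
  (* The whole length budget is spent on [x] alone. *)
  have fx : feasible [:: (C / len x, x)].
    split; first by rewrite /nonneg_weights /= andbT divr_ge0 // ltW.
    by rewrite /weighted big_seq1 /= mulfVK // gt_eqF.
  have := cq _ fx.
  have -> : \sum_j c j * val [:: (C / len x, x)] j = C / len x * \sum_j c j * ev x j.
    by rewrite mulr_sumr; apply: eq_bigr => j _; rewrite /val /weighted big_seq1 mulrCA.
  by rewrite -lamC mulrAC -mulrA ler_pM2l // ler_pdivrMr.
by rewrite lamC; move: Dp; move: (\sum_j _) (D) => x D'; lra.
Qed.

End Separation.

(* The multiplicities are the integer parts of [N * a / T]. *)
Lemma exists_rounding (R : realType) (X : Type) (l : seq (R * X)) (T N : R) :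
  0 < T -> 0 < N -> nonneg_weights l -> exists Q : seq X,
    forall g h : X -> R, (forall x, `|g x| <= h x) ->
      `|T / N * (\sum_(x <- Q) g x) - weighted g l| <= T / N * \sum_(p <- l) h p.2.
Proof.
move=> T0 N0 l0.
exists (flatten [seq nseq (Num.truncn (N * p.1 / T)) p.2 | p <- l]) => g h gh.
have TN : 0 < T / N by rewrite divr_gt0.
elim: l l0 => [_|p l IH /= /andP[p0 l0]].
  by rewrite /weighted !big_nil mulr0 subrr normr0.
have {}IH := IH l0.
rewrite big_cat /weighted !big_cons mulrDr big_nseq.
have -> : iter (Num.truncn (N * p.1 / T)) (+%R (g p.2)) 0 = (Num.truncn (N * p.1 / T))%:R * g p.2.
  by rewrite mulr_natl; elim: (Num.truncn _) => //= n ->; rewrite mulrS.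
have n0 : 0 <= N * p.1 / T by rewrite !mulr_ge0 // ?invr_ge0 ltW.
have /andP[b1 b2] := truncn_itv n0.
move: b1 b2 IH; move: (Num.truncn _) => b.
rewrite mulrDr /weighted; move: (\sum_(x <- flatten _) g x) (\sum_(j <- l) _) (\sum_(j <- l) _) => x y z.
rewrite ler_pdivlMr // ltr_pdivrMr // => b1 b2 IH.
have h1 : T / N * b%:R <= p.1.
  by rewrite mulrAC ler_pdivrMr // [leLHS]mulrC [leRHS]mulrC.
have h2 : p.1 <= T / N * b%:R + T / N.
  have -> : T / N * b%:R + T / N = (b%:R + 1) * T / N by ring.
  by rewrite ler_pdivlMr // mulrC -natr1 in b2 *; exact: ltW.
rewrite opprD addrACA; apply: le_trans (ler_normD _ _) _; rewrite lerD //.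
rewrite mulrA -mulrBl normrM; apply: ler_pM => //.
by rewrite ler_norml; move: h1 h2 TN; move: (T / N) => u; move: (u * b%:R) => v; lra.
Qed.

Lemma compact_sequence_cluster (T : topologicalType) (A : set T) (x : nat -> T) :
  compact A -> (forall n, A (x n)) -> exists2 p, A p &
    forall U, nbhs p U -> forall N, exists2 n, (N <= n)%N & U (x n).
Proof.
move=> cA xA.
have [|p [Ap clp]] := cA (x @ \oo) _; first by exists 0%N => // n _; exact: xA.
exists p => // U pU N.
have [|z [[n Nn <-] Uz]] := clp [set x n | n in [set n | (N <= n)%N]] U _ pU.
  by exists N => // n /= Nn; exists n.
by exists n.
Qed.

(** * Uniform continuity and Lipschitz fields of bounded support *)

Section NiceFields.
Context (R : realType) (d : nat).
Notation V := 'rV[R]_d.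
Implicit Types (Phi Psi : V -> V) (a b x y : V) (s : seq V).

Lemma continuous_enormP Phi x (e : R) : continuous Phi -> 0 < e ->
  exists2 r : R, 0 < r & forall y, enorm (y - x) < r -> enorm (Phi y - Phi x) < e.
Proof.
move=> cPhi e0.
have c : continuous (fun y => enorm (Phi y - Phi x)).
  move=> y; apply: (@continuous_comp _ _ _ (fun y => Phi y - Phi x) (@enorm R d)).
    by apply: (@cvgB _ _ _ (nbhs y) (nbhs_filter y) Phi (fun=> Phi x)); [exact: cPhi|exact: cvg_cst].
  exact: enorm_continuous.
have : \forall y \near x, enorm (Phi y - Phi x) < e.
  apply: (c x [set t : R | t < e]); rewrite /= subrr enorm0; exact: lt_nbhsl.
move=> /nbhs_ballP [r r0 h]; exists r => // y yr; apply: h.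
rewrite /= -ball_normE /= -normrN opprB.
by apply: le_lt_trans yr; exact: norm_le_enorm.
Qed.

(** Pairs of ever closer points with values more than [e] apart would stay in a ball, because [Phi]
    is small outside, and would cluster at a point, against continuity there. *)
Lemma C0_field_uniformly_continuous Phi (e : R) : C0_field Phi -> 0 < e ->
  exists2 r : R, 0 < r & forall x y, enorm (x - y) <= r -> enorm (Phi x - Phi y) <= e.
Proof.
move=> [cPhi van] e0; apply: contrapT => no.
have e20 : 0 < e / 2 by rewrite divr_gt0.
have bad n : exists p : V * V, enorm (p.1 - p.2) <= n.+1%:R^-1 /\ e < enorm (Phi p.1 - Phi p.2).
  apply: contrapT => h; apply: no; exists n.+1%:R^-1 => [|x y xy].
    by rewrite invr_gt0.
  by rewrite leNgt; apply/negP => exy; apply: h; exists (x, y).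
have [p hp] := choice bad.
have [M hM] := van _ e20.
have pM n : enorm (p n).1 <= M + 1.
  rewrite leNgt; apply/negP => h.
  have [h1 h2] := hp n.
  have : enorm (Phi (p n).1) < e / 2 by apply: hM; apply: lt_trans h; rewrite ltrDl.
  have : enorm (Phi (p n).2) < e / 2.
    apply: hM; have : enorm (p n).1 <= enorm (p n).2 + enorm ((p n).1 - (p n).2).
      by rewrite -[X in enorm X](subrK (p n).2) addrC enormD.
    have : n.+1%:R^-1 <= (1 : R) by rewrite invf_le1 // ler1n.
    move: h h1; move: (n.+1%:R^-1 : R) (enorm _) (enorm _) (enorm _) => u v w z.
    move=> a1 a2 a3 a4; rewrite -(ltrD2r 1); apply: lt_le_trans a1 (le_trans a4 _).
    by rewrite lerD2l (le_trans a2).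
  have := enormD (Phi (p n).1) (- Phi (p n).2); rewrite enormN => h3 h4 h5.
  by move: (lt_le_trans h2 h3); rewrite ltNge (splitr e) lerD // ltW.
have [q _ hq] := @compact_sequence_cluster _ _ (fun n => (p n).1) (@compact_enorm_ball R d (M + 1)) pM.
have [r r0 hr] := continuous_enormP q cPhi e20.
have r20 : 0 < r / 2 by rewrite divr_gt0.
have Uq : nbhs q [set y | enorm (y - q) < r / 2].
  by apply: open_nbhs_nbhs; split; [exact: eball_open|rewrite /= subrr enorm0].
have [n nN /= xq] := hq _ Uq (Num.truncn (r / 2)^-1).
have [h1 h2] := hp n.
have nr : n.+1%:R^-1 <= r / 2.
  rewrite invf_ple ?posrE //; apply: ltW; apply: lt_le_trans (truncnS_gt _) _.
  by rewrite ler_nat.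
have h3 : enorm (Phi (p n).1 - Phi q) < e / 2 by apply: hr; move: xq r0; lra.
have h4 : enorm (Phi (p n).2 - Phi q) < e / 2.
  apply: hr; apply: le_lt_trans (enorm_triangle _ (p n).1 _) _.
  by rewrite enormC; move: h1 nr xq; move: (n.+1%:R^-1 : R) => u; lra.
have := enorm_triangle (Phi (p n).1) (Phi q) (Phi (p n).2).
by rewrite [enorm (Phi q - _)]enormC; move: h2 h3 h4; lra.
Qed.

(** The fields to which [vintegral_le_of_good] applies. The separation argument uses that they form
    a vector space. *)
Definition nice Phi := continuous Phi /\ exists L K R0 : R,
  [/\ [/\ 0 <= L, 0 <= K & 0 <= R0], forall x y, enorm (Phi x - Phi y) <= L * enorm (x - y),
      forall x, enorm (Phi x) <= K & forall x, R0 < enorm x -> Phi x = 0].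

Lemma nice0 : nice (fun=> 0).
Proof.
split; first exact: cst_continuous.
exists 0, 0, 0; split => // [x y|x]; last by rewrite enorm0.
by rewrite subrr enorm0 mul0r.
Qed.

Lemma niceD Phi Psi : nice Phi -> nice Psi -> nice (fun x => Phi x + Psi x).
Proof.
move=> [c1 [L1 [K1 [R1 [[L10 K10 R10] l1 k1 s1]]]]].
move=> [c2 [L2 [K2 [R2 [[L20 K20 R20] l2 k2 s2]]]]].
split; first by move=> x; apply: (@cvgD _ _ _ (nbhs x) (nbhs_filter x) Phi Psi); [exact: c1|exact: c2].
exists (L1 + L2), (K1 + K2), (R1 + R2); split => [|x y|x|x xR].
- by split; apply: addr_ge0.
- by rewrite opprD addrACA mulrDl; apply: le_trans (enormD _ _) (lerD _ _).
- by apply: le_trans (enormD _ _) (lerD _ _).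
rewrite s1 ?s2 ?addr0 //; apply: le_lt_trans xR; first by rewrite lerDr.
by rewrite lerDl.
Qed.

Lemma niceZ (c : R) Phi : nice Phi -> nice (fun x => c *: Phi x).
Proof.
move=> [c1 [L1 [K1 [R1 [[L10 K10 R10] l1 k1 s1]]]]].
split; first by move=> x; exact: (@cvgZl_tmp R V V (nbhs x) (nbhs_filter x) c Phi _ (c1 x)).
exists (`|c| * L1), (`|c| * K1), R1; split => [|x y|x|x xR].
- by split => //; apply: mulr_ge0.
- by rewrite -scalerBr enormZ -mulrA ler_wpM2l.
- by rewrite enormZ ler_wpM2l.
by rewrite s1 ?scaler0.
Qed.

Lemma nice_sum (I : Type) (r : seq I) (P : I -> V -> V) :
  (forall i, nice (P i)) -> nice (fun x => \sum_(i <- r) P i x).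
Proof.
move=> nP; elim: r => [|i r IH].
  by rewrite (_ : (fun _ => _) = (fun=> 0)); [exact: nice0|apply/funext => x; rewrite big_nil].
rewrite (_ : (fun _ => _) = (fun x => P i x + \sum_(j <- r) P j x)); first exact: niceD.
by apply/funext => x; rewrite big_cons.
Qed.

Lemma nice_bfield Phi : nice Phi -> bfield Phi.
Proof. by move=> [cPhi [L [K [R0 [_ _ PhiK _]]]]]; exact: bfield_continuous PhiK. Qed.

Lemma C0_bfield Phi : C0_field Phi -> bfield Phi.
Proof. by move=> C0; have [K _ PhiK] := C0_field_bounded C0; case: C0 => c _; exact: bfield_continuous PhiK. Qed.

End NiceFields.

(** * Good loops and finitely many test fields *)

Section Loops.
Context (R : realType) (d : nat).
Notation V := 'rV[R]_d.
Implicit Types (Phi Psi : V -> V) (a b x y : V) (s : seq V).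

(** Removing edges of length zero changes neither lengths nor integrals, and turns a good closed
    polygon into a [loop] or a single point. *)
Fixpoint dedup a s : seq V :=
  if s is b :: s' then if a == b then dedup a s' else b :: dedup b s' else [::].

Lemma psum_dedup f a s : (forall b, f b b = 0) -> psum f a (dedup a s) = psum f a s.
Proof.
move=> f0; elim: s a => //= b s IH a.
by have [->|_] /= := eqVneq a b; rewrite IH // f0 add0r.
Qed.

Lemma last_dedup a s : last a (dedup a s) = last a s.
Proof. by elim: s a => //= b s IH a; have [->|_] /= := eqVneq a b; rewrite IH. Qed.

Lemma nondegenerate_dedup a s : nondegenerate a (dedup a s).
Proof.
rewrite /nondegenerate; elim: s a => //= b s IH a.
by have [->|ab] /= := eqVneq a b; rewrite ?ab IH.
Qed.

Lemma ecovxx (x : V) (r : R) b : ecov (eball x r) b b = 0.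
Proof.
apply/eqP; rewrite eq_le ecov_ge0 andbT.
have -> : 0 = enorm (b - b) by rewrite subrr enorm0.
by apply: ecov_le_len; apply: edge_preimage_open; exact: eball_open.
Qed.

Definition is_loop (p : V * seq V) :=
  [/\ last p.1 p.2 = p.1, nondegenerate p.1 p.2, p.2 != [::] & good p.1 p.2].

Definition loop := {p : V * seq V | is_loop p}.
Definition loop_measure (p : loop) : vmeasure R d := path_vmeasure (sval p).1 (sval p).2.
Definition loop_len (p : loop) : R := plen (sval p).1 (sval p).2.

Lemma vintegral_loop_le (p : loop) Phi (K : R) : bfield Phi -> 0 <= K ->
  (forall x, enorm (Phi x) <= K) -> `|vintegral (loop_measure p) Phi| <= K * loop_len p.
Proof.
move=> bPhi K0 PhiK; apply: le_trans (vintegral_bound _ bPhi K0 PhiK) _.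
apply: ler_wpM2l => //; have := vvariation_path_le_plen (sval p).1 (sval p).2.
have := vvariation_lty (loop_measure p); have := vvariation_ge0 (loop_measure p).
by rewrite /vmass /loop_measure; case: (vvariation _ _) => //= r _ _; rewrite lee_fin.
Qed.

Lemma exists_near_loops (F : vmeasure R d) (J : finType) (Phi : J -> V -> V) (e : R) :
  divergence_free F -> (forall j, nice (Phi j)) -> 0 < e ->
  exists l : seq (R * loop), [/\ nonneg_weights l, weighted loop_len l <= 3 * vmass F
    & forall j, `|weighted (fun p => vintegral (loop_measure p) (Phi j)) l -
        vintegral F (Phi j)| <= e].
Proof.
move=> divF nPhi e0.
have [Kf Kf0 PhiK] : exists2 Kf : J -> R, forall j, 0 <= Kf j & forall j x, enorm (Phi j x) <= Kf j.
  have h j : exists K : R, 0 <= K /\ forall x, enorm (Phi j x) <= K.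
    by have [_ [_ [K [_ [[_ K0 _] _ PhiK _]]]]] := nPhi j; exists K.
  by have [Kf hK] := choice h; exists Kf => j; case: (hK j).
have bPhi j := nice_bfield (nPhi j).
(* The separation works with a positive budget; if [F] has no mass, the empty combination is
   exact. *)
have := vmass_ge0 F; rewrite le_eqVlt => /predU1P[F0|Fp].
  exists [::]; split => // [|j]; first by rewrite /weighted big_nil -F0 mulr0.
  rewrite /weighted big_nil sub0r normrN; apply: le_trans (vintegral_bound F (bPhi j) (Kf0 j) (PhiK j)) _.
  by rewrite -F0 mulr0 ltW.
have len0 (p : loop) : 0 <= loop_len p by exact: plen_ge0.
pose B := \sum_j Kf j.
have B0 : 0 <= B by apply: sumr_ge0.
have KB j : Kf j <= B by rewrite /B (bigD1 j) //= lerDl; apply: sumr_ge0.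
apply: (@exists_near_combination R J loop (fun p j => vintegral (loop_measure p) (Phi j))
  loop_len (fun j => vintegral F (Phi j)) B (3 * vmass F)) => //.
- by rewrite mulr_gt0.
- by move=> p j; apply: vintegral_loop_le => // x; apply: le_trans (PhiK j x) (KB j).
(* The dual condition is [vintegral_le_of_good] for the combination [Psi] of the given fields. *)
move=> c t t0 h.
pose Psi x := \sum_j c j *: Phi j x.
have nc j : nice (fun x => c j *: Phi j x) by exact: niceZ.
have nPsi : nice Psi by exact: nice_sum.
have PsiE mu : vintegral mu Psi = \sum_j c j * vintegral mu (Phi j).
  rewrite vintegral_sum; last by move=> j; exact: nice_bfield.
  by apply: eq_bigr => j _; rewrite vintegralZ.
rewrite -PsiE.
have [cPsi [L [K [R0 [[L0 K0 R00] Psil PsiK Psis]]]]] := nPsi.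
rewrite mulrAC; apply: (vintegral_le_of_good divF L0 K0 R00 t0 cPsi Psil PsiK Psis).
move=> a s cl gs.
have [s0|s0] := eqVneq (dedup a s) [::].
  have p0 : pint Psi a s = 0.
    by rewrite /pint -psum_dedup ?s0 // => b; exact: line_intxx.
  by rewrite p0 mulr_ge0 // plen_ge0.
have il : is_loop (a, dedup a s).
  split => //=; [by rewrite last_dedup|exact: nondegenerate_dedup|].
  by move=> x r r0; rewrite /pcov psum_dedup; [exact: gs|move=> b; exact: ecovxx].
have := h (exist _ _ il); rewrite -PsiE /loop_measure /loop_len /=.
rewrite (vintegral_path _ _ cPsi PsiK) /pint /plen !psum_dedup // => b.
  by rewrite subrr enorm0.
exact: line_intxx.
Qed.

End Loops.

(** * Interpolation of fields on lattices *)

Section Interpolation.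
Context (R : realType) (d : nat).
Notation V := 'rV[R]_d.
Notation K := 'rV[int]_d.
Implicit Types (Phi Psi : V -> V) (x y : V) (n : nat).

Notation bmp n k := (@bump R d n 0 k).
Notation nd n k := (@node R d n 0 k).

Lemma exists_box n x : exists L : nat, forall i, 1%:R * (n.+1%:R * `|x 0 i| + 1) <= L%:R :> R.
Proof.
exists (Num.truncn (n.+1%:R * enorm x + 1)).+1 => i; rewrite mul1r.
apply: ltW; apply: le_lt_trans (truncnS_gt _).
by rewrite lerD2r ler_wpM2l // coord_le_enorm.
Qed.

Lemma sum_bump_le1 n L x : \sum_(k <- box d L) bmp n k x <= 1.
Proof.
have [L' hL] := exists_box n x.
rewrite -(sum_bump hL).
have -> : \sum_(k <- box d L) bmp n k x = \sum_(k <- box d L) (if k \in box d L then bmp n k x else 0).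
  by rewrite [LHS]big_seq [RHS]big_seq; apply: eq_bigr => k ->.
rewrite (@eq_big_support R K (box d L) (box d L')) ?box_uniq //; last first.
  by move=> k; case: (k \in box d L) => [b0|]; rewrite ?eqxx //= (bump_box hL b0).
by apply: ler_sum => k _; case: ifP => // _; exact: bump_ge0.
Qed.

Lemma bump_le1 n (k : K) x : bmp n k x <= 1.
Proof.
have [->//|b0] := eqVneq (bmp n k x) 0.
have [L hL] := exists_box n x.
rewrite -(sum_bump hL) (bigD1_seq k) ?box_uniq ?(bump_box hL b0) //= lerDl.
by apply: sumr_ge0 => j _; exact: bump_ge0.
Qed.

Lemma bump_lipschitz n (k : K) : exists2 C : R, 0 <= C &
  forall x y, `|bmp n k x - bmp n k y| <= C * enorm (x - y).
Proof.
have [C C0 [h1 h2 _]] := smooth_step_derivatives_bounded R.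
have s0 := @smooth1_smooth_step R.
pose c : R := n.+1%:R * C.
have c0 : 0 <= c by rewrite mulr_ge0.
have Cc : C <= c by rewrite ler_peMl // ler1n.
exists (d%:R * c ^+ d) => [|x y]; first by rewrite mulr_ge0 // exprn_ge0.
have cellC j t : `|@cell R n 0 j t| <= c.
  apply: le_trans Cc; rewrite -[C]divr1; apply: cellf_bound => // u.
  exact: smooth1_derivable.
have lip j t u : `|@cell R n 0 j t - @cell R n 0 j u| <= c * `|t - u|.
  apply: lipschitz_of_derive => v.
    by apply: smooth1_derivable; exact: smooth1_cellf.
  rewrite derive1_cellf => [|w]; last exact: smooth1_derivable.
  rewrite normrM ger0_norm // ler_wpM2l // -[C]divr1.
  by apply: cellf_bound => // w; apply: smooth1_derivable; exact: smooth1_derive.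
have := @prod_lipschitz R _ (index_enum 'I_d) (fun j => @cell R n 0 (k 0 j) (x 0 j))
  (fun j => @cell R n 0 (k 0 j) (y 0 j)) c (enorm (x - y)) c0.
have -> : size (index_enum 'I_d) = d by rewrite -sum1_size big_const_ord iter_addn_0 mul1n.
apply => j //; apply: le_trans (lip _ _ _) _; rewrite ler_wpM2l //.
by have := coord_le_enorm (x - y) j; rewrite !mxE.
Qed.

Definition bump_field n (k : K) (i : 'I_d) : V -> V := fun x => bmp n k x *: delta_mx 0 i.

Lemma lipschitz_continuous Phi (L : R) : 0 <= L ->
  (forall x y, enorm (Phi x - Phi y) <= L * enorm (x - y)) -> continuous Phi.
Proof.
move=> L0 lip x; apply/(@cvgrPdist_lt _ _ _ (nbhs x) (nbhs_filter x)) => e e0.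
have L1 : 0 < L + 1 by rewrite ltr_wpDl.
have r0 : 0 < e / (L + 1) by rewrite divr_gt0.
have Ux : nbhs x [set y | enorm (y - x) < e / (L + 1)].
  by apply: open_nbhs_nbhs; split; [exact: eball_open|rewrite /= subrr enorm0].
apply: filterS Ux => y /= yx; apply: le_lt_trans (norm_le_enorm _) _.
apply: le_lt_trans (lip _ _) _; rewrite enormC.
move: yx; rewrite ltr_pdivlMr // mulrDr mulr1; apply: le_lt_trans.
by rewrite mulrC lerDl enorm_ge0.
Qed.

Lemma nice_bump_field n (k : K) i : nice (bump_field n k i).
Proof.
have [C C0 lip] := bump_lipschitz n k.
have flip x y : enorm (bump_field n k i x - bump_field n k i y) <= C * enorm (x - y).
  by rewrite /bump_field -scalerBl enormZ enorm_delta mulr1.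
split; first exact: lipschitz_continuous flip.
exists C, 1, (enorm (nd n k) + d%:R / n.+1%:R); split => //.
- by split => //; rewrite addr_ge0 ?enorm_ge0 // divr_ge0.
- by move=> x; rewrite enormZ enorm_delta mulr1 ger0_norm ?bump_ge0 // bump_le1.
move=> x xR; rewrite /bump_field; have [->|b0] := eqVneq (bmp n k x) 0; first by rewrite scale0r.
have := le_trans (enormD (x - nd n k) (nd n k)) (lerD (bump_support b0) (lexx _)).
by rewrite subrK addrC leNgt xR.
Qed.

(* Large enough for the bumps of scale [n] to form a partition of unity on the
   ball of radius [n]. *)
Definition box_radius n : nat := (n.+1 * n).+1.

Definition interp n Phi x : V :=
  \sum_(k <- box d (box_radius n)) \sum_(i < d) Phi (nd n k) 0 i *: bump_field n k i x.

Lemma interpE n Phi x :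
  interp n Phi x = \sum_(k <- box d (box_radius n)) bmp n k x *: Phi (nd n k).
Proof.
apply: eq_bigr => k _; rewrite [in RHS](row_sum_delta (Phi (nd n k))) scaler_sumr.
by apply: eq_bigr => i _; rewrite /bump_field !scalerA mulrC.
Qed.

(** With [S] the sum of the bumps at [x], the error is [(1 - S) *: Phi x] plus the average of
    [Phi x - Phi (node k)] weighted by the bumps. The first term vanishes where the bumps add up to
    1, and [Phi] is small elsewhere; the second is controlled by uniform continuity. *)
Lemma interp_close Phi (e : R) : C0_field Phi -> 0 < e -> exists N : nat,
  forall n, (N <= n)%N -> forall x, enorm (Phi x - interp n Phi x) <= e.
Proof.
move=> C0 e0; have [r r0 uc] := C0_field_uniformly_continuous C0 e0.
have [_ /(_ _ e0) [M hM]] := C0.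
exists (maxn (Num.truncn (d%:R / r)) (Num.truncn M).+1) => n; rewrite geq_max => /andP[n1 n2] x.
have dn : d%:R / n.+1%:R <= r.
  rewrite ler_pdivrMr // mulrC -ler_pdivrMr //; apply: ltW.
  by apply: lt_le_trans (truncnS_gt _) _; rewrite ler_nat.
have Mn : M <= n%:R.
  by apply: ltW; apply: lt_le_trans (truncnS_gt _) _; rewrite ler_nat.
set S := \sum_(k <- box d (box_radius n)) bmp n k x.
have S1 : S <= 1 by exact: sum_bump_le1.
have -> : Phi x - interp n Phi x =
    (1 - S) *: Phi x + \sum_(k <- box d (box_radius n)) bmp n k x *: (Phi x - Phi (nd n k)).
  have -> : \sum_(k <- box d (box_radius n)) bmp n k x *: (Phi x - Phi (nd n k)) =
      S *: Phi x - interp n Phi x.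
    by rewrite interpE scaler_suml -sumrB; apply: eq_bigr => k _; rewrite scalerBr.
  by rewrite scalerBl scale1r addrA subrK.
apply: le_trans (enormD _ _) _.
have h2 : enorm (\sum_(k <- box d (box_radius n)) bmp n k x *: (Phi x - Phi (nd n k))) <= S * e.
  apply: le_trans (enorm_sum _ _ _) _; rewrite mulr_suml; apply: ler_sum => k _.
  rewrite enormZ ger0_norm ?bump_ge0 //.
  have [->|b0] := eqVneq (bmp n k x) 0; first by rewrite !mul0r.
  rewrite ler_wpM2l ?bump_ge0 // uc //; apply: le_trans (bump_support b0) dn.
have h1 : enorm ((1 - S) *: Phi x) <= (1 - S) * e.
  rewrite enormZ ger0_norm ?subr_ge0 //.
  have [xM|xM] := ltP M (enorm x); first by rewrite ler_wpM2l ?subr_ge0 // ltW // hM.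
  have -> : S = 1.
    apply: sum_bump => i; rewrite mul1r /box_radius -[leRHS]natr1 natrM lerD2r ler_wpM2l //.
    by apply: le_trans (coord_le_enorm _ _) _; exact: le_trans xM Mn.
  by rewrite subrr !mul0r.
by apply: le_trans (lerD h1 h2) _; rewrite -mulrDl subrK mul1r.
Qed.

End Interpolation.

(** * From weighted loops to a sequence of unweighted ones *)

Section LoopApproximation.
Context (R : realType) (d : nat) (F : vmeasure R d).
Hypothesis divF : divergence_free F.
Notation V := 'rV[R]_d.
Notation K := 'rV[int]_d.
Notation loops := (loop R d).
Implicit Types (Phi Psi : V -> V) (x y : V) (l : seq (R * loops)).

Definition weighted_int Phi l : R := weighted (fun p => vintegral (loop_measure p) Phi) l.

Lemma weighted_int_bound l Phi (C : R) : nonneg_weights l -> bfield Phi -> 0 <= C ->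
  (forall x, enorm (Phi x) <= C) ->
  `|weighted_int Phi l| <= C * weighted (@loop_len R d) l.
Proof.
move=> l0 bPhi C0 PhiC; rewrite -weightedZ; apply: ler_weighted_norm => // p.
exact: vintegral_loop_le.
Qed.

Lemma weighted_sum (I : Type) (r : seq I) (g : I -> loops -> R) l :
  weighted (fun p => \sum_(i <- r) g i p) l = \sum_(i <- r) weighted (g i) l.
Proof.
rewrite /weighted [RHS]exchange_big /=; apply: eq_bigr => p _.
by rewrite mulr_sumr.
Qed.

Lemma vintegral_interp (mu : vmeasure R d) n Phi : vintegral mu (interp n Phi) =
  \sum_(k <- box d (box_radius n)) \sum_(i < d)
    Phi (@node R d n 0 k) 0 i * vintegral mu (@bump_field R d n k i).
Proof.
have nc (k : K) i : nice (fun x => Phi (@node R d n 0 k) 0 i *: @bump_field R d n k i x).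
  by apply: niceZ; exact: nice_bump_field.
rewrite vintegral_sum => [|k]; last by apply: nice_bfield; apply: nice_sum.
apply: eq_bigr => k _; rewrite vintegral_sum => [|i]; last exact: nice_bfield.
by apply: eq_bigr => i _; rewrite vintegralZ //; apply: nice_bfield; exact: nice_bump_field.
Qed.

Lemma nice_interp n Phi : nice (interp n Phi).
Proof. by apply: nice_sum => k; apply: nice_sum => i; apply: niceZ; exact: nice_bump_field. Qed.

Definition bump_count n : nat := (size (box d (box_radius n)) * d)%N.

(** Interpolants are combinations of finitely many bump fields with values of [Phi] as coefficients.
    Matching [F] on these fields therefore gives one list of loops that serves all [Phi] at once. *)
Lemma exists_bump_loops n : exists l : seq (R * loops),
  [/\ nonneg_weights l, weighted (@loop_len R d) l <= 3 * vmass F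
    & forall Phi (C : R), 0 <= C -> (forall x, enorm (Phi x) <= C) ->
      `|weighted_int (interp n Phi) l - vintegral F (interp n Phi)| <= C / n.+1%:R].
Proof.
pose t := in_tuple (box d (box_radius n)).
(* The interpolant has [bump_count n] coefficients, each at most [C] in absolute value. *)
pose e : R := (n.+1%:R * (bump_count n).+1%:R)^-1.
have e0 : 0 < e by rewrite invr_gt0 mulr_gt0.
have [l [l0 lm le]] := @exists_near_loops R d F ('I_(size (box d (box_radius n))) * 'I_d)%type
  (fun j => @bump_field R d n (tnth t j.1) j.2) e divF (fun j => nice_bump_field R n _ _) e0.
exists l; split => // Phi C C0 PhiC.
have -> : weighted_int (interp n Phi) l = \sum_(k <- box d (box_radius n)) \sum_(i < d)
    Phi (@node R d n 0 k) 0 i * weighted_int (@bump_field R d n k i) l.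
  rewrite /weighted_int; under [in LHS]eq_fun do rewrite vintegral_interp.
  rewrite weighted_sum; apply: eq_bigr => k _; rewrite weighted_sum; apply: eq_bigr => i _.
  by rewrite weightedZ.
rewrite vintegral_interp -sumrB.
apply: (@le_trans _ _ (\sum_(k <- box d (box_radius n)) \sum_(i < d) C * e)).
  apply: le_trans (ler_norm_sum _ _ _) _; rewrite !(big_tnth _ _ (box _ _)).
  apply: ler_sum => j _; rewrite -sumrB.
  apply: le_trans (ler_norm_sum _ _ _) _; apply: ler_sum => i _.
  rewrite -mulrBr normrM; apply: ler_pM => //.
    exact: le_trans (coord_le_enorm _ _) (PhiC _).
  exact: (le (j, i)).
rewrite big_const_seq count_predT iter_addr_0 big_const_ord iter_addr_0 -mulrnA mulnC -/(bump_count n).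
rewrite -[leLHS]mulr_natr -mulrA; apply: ler_wpM2l => //.
rewrite /e invfM -mulrA ler_piMr ?invr_ge0 // mulrC ler_pdivrMr // mul1r ler_nat.
exact: leqnSn.
Qed.

Lemma exists_loop_approximation : exists l : nat -> seq (R * loops),
  [/\ forall n, nonneg_weights (l n), forall n, weighted (@loop_len R d) (l n) <= 3 * vmass F
    & forall Phi (e : R), C0_field Phi -> 0 < e -> exists N : nat, forall n, (N <= n)%N ->
      `|weighted_int Phi (l n) - vintegral F Phi| <= e].
Proof.
have [l hl] := choice exists_bump_loops.
exists l; split => [n|n|Phi e C0 e0]; try by case: (hl n).
have [C C00 PhiC] := C0_field_bounded C0.
have m0 := vmass_ge0 F.
have m1 : 0 < 2 * (4 * vmass F + 1) by rewrite mulr_gt0 // ltr_wpDl // mulr_ge0.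
(* The interpolation error [eta] counts against the loops, of total length at most [3 * vmass F],
   and against [F]. *)
pose eta := e / (2 * (4 * vmass F + 1)).
have eta0 : 0 < eta by rewrite divr_gt0.
have etaE : eta * (2 * (4 * vmass F + 1)) = e by rewrite mulfVK // gt_eqF.
have [N hN] := interp_close C0 eta0.
exists (maxn N (Num.truncn (C / (e / 2)))) => n; rewrite geq_max => /andP[nN nC].
have e20 : 0 < e / 2 by rewrite divr_gt0.
have Cn : C / n.+1%:R <= e / 2.
  rewrite ler_pdivrMr // mulrC -ler_pdivrMr //; apply: ltW.
  by apply: lt_le_trans (truncnS_gt _) _; rewrite ler_nat.
have [l0 lm lint] := hl n.
have hn := hN n nN.
have bI := nice_bfield (nice_interp n Phi).
have bPhi := C0_bfield C0.
have bD : bfield (fun x => Phi x - interp n Phi x).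
  have -> : (fun x => Phi x - interp n Phi x) = (fun x => Phi x + -1 *: interp n Phi x).
    by apply/funext => x; rewrite scaleN1r.
  by apply: bfieldD => //; exact: bfieldZ.
have split_int mu : vintegral mu Phi = vintegral mu (interp n Phi) +
    vintegral mu (fun x => Phi x - interp n Phi x).
  rewrite -vintegralD //; congr vintegral; apply/funext => x.
  by rewrite addrC subrK.
have split_wint : weighted_int Phi (l n) = weighted_int (interp n Phi) (l n) +
    weighted_int (fun x => Phi x - interp n Phi x) (l n).
  rewrite /weighted_int /weighted -big_split; apply: eq_bigr => p _ /=.
  by rewrite split_int mulrDr.
rewrite split_wint split_int.
have h1 := lint Phi C C00 PhiC.
have h2 := weighted_int_bound l0 bD (ltW eta0) hn.
have h3 := vintegral_bound F bD (ltW eta0) hn.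
have h4 : eta * weighted (@loop_len R d) (l n) <= eta * (3 * vmass F) by rewrite ler_wpM2l // ltW.
rewrite opprD addrACA; apply: le_trans (ler_normD _ _) _.
apply: (@le_trans _ _ (e / 2 + (eta * (3 * vmass F) + eta * vmass F))).
  apply: lerD; first exact: le_trans h1 Cn.
  apply: le_trans (ler_normB _ _) _; apply: lerD => //; exact: le_trans h2 h4.
rewrite -mulrDr [leRHS]splitr lerD2l -[X in _ <= X / 2]etaE.
have -> : eta * (2 * (4 * vmass F + 1)) / 2 = eta * (4 * vmass F + 1) by field.
apply: ler_wpM2l; first exact: ltW.
move: (vmass F) => m; lra.
Qed.

(** Possibly smaller than [loop_len], because overlapping edges may cancel. *)
Definition loop_mass (p : loops) : R := vmass (loop_measure p).

Lemma vvariation_loop (p : loops) : vvariation (loop_measure p) setT = (loop_mass p)%:E.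
Proof. by rewrite /loop_mass /vmass fineK // ge0_fin_numE ?vvariation_lty ?vvariation_ge0. Qed.

Lemma loop_mass_le (p : loops) : loop_mass p <= loop_len p.
Proof. by rewrite -lee_fin -vvariation_loop; exact: vvariation_path_le_plen. Qed.

(** Convergence of the integrals holds along every sequence of scales tending to infinity. This
    freedom is used to make the masses converge too, and the freedom in [n k] makes the rounding
    error negligible. *)
Lemma exists_loop_sequence : exists (n : nat -> nat) (Q : nat -> seq loops),
  [/\ forall k, (0 < n k)%N,
      forall Phi, C0_field Phi ->
        (fun k => vmass F / (n k * k)%:R * \sum_(p <- Q k) vintegral (loop_measure p) Phi) @ \oo
          --> vintegral F Phi
    & exists2 M : R, M <= 3 &
        (fun k => (n k * k)%:R^-1 * \sum_(p <- Q k) loop_mass p) @ \oo --> M].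
Proof.
have := vmass_ge0 F; rewrite le_eqVlt => /predU1P[F0|Fp].
  exists (fun=> 1%N), (fun=> [::]); split => //.
    move=> Phi C0; have [C C00 PhiC] := C0_field_bounded C0.
    have : `|vintegral F Phi| <= C * vmass F by exact: vintegral_bound (C0_bfield C0) C00 PhiC.
    rewrite -F0 mulr0 normr_le0 => /eqP ->.
    by under eq_fun do rewrite big_nil mulr0; exact: cvg_cst.
  exists 0 => //; by under eq_fun do rewrite big_nil mulr0; exact: cvg_cst.
have [l [l0 lm lint]] := exists_loop_approximation.
have mass0 (p : loops) : 0 <= loop_mass p by exact: vmass_ge0.
have mlen (p : loops) : `|loop_mass p| <= 1 * loop_len p.
  by rewrite ger0_norm // mul1r loop_mass_le.
have mass_itv n : `[0, 3 * vmass F]%classic (weighted loop_mass (l n)).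
  rewrite /= in_itv /=; apply/andP; split.
    rewrite /weighted; elim: (l n) (l0 n) => [|p s IH /= /andP[p0 s0]]; rewrite ?big_nil //.
    by rewrite big_cons addr_ge0 ?mulr_ge0 // IH.
  apply: le_trans (ler_norm _) _; apply: le_trans (ler_weighted_norm (l0 n) mlen) _.
  by rewrite weightedZ mul1r.
(* A cluster value of the masses, approached at arbitrarily late scales; [sig k] picks a scale
   beyond [k]. *)
have [M M3 near_M] : exists2 M : R, M <= 3 * vmass F & forall N : nat,
    exists n, (N <= n)%N /\ `|weighted loop_mass (l n) - M| <= N.+1%:R^-1.
  have [M /=] := @compact_sequence_cluster _ _ _ (@segment_compact R 0 (3 * vmass F)) mass_itv.
  rewrite in_itv /= => /andP[_ M3] hM; exists M => // N.
  have U : nbhs M [set x | `|x - M| <= N.+1%:R^-1].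
    apply/nbhs_ballP; exists N.+1%:R^-1 => [|y] /=; first by rewrite invr_gt0 ltr0n.
    by rewrite -ball_normE /= distrC => /ltW.
  by have [n Nn nU] := hM _ U N; exists n.
have [sig hsig] := choice near_M.
pose S (L : seq (R * loops)) : R := \sum_(p <- L) loop_len p.2.
have S0 L : 0 <= S L by apply: sumr_ge0 => p _; exact: plen_ge0.
(* Large enough to bring the rounding error, at most [vmass F / (n k * k)] times
   [C * S (l (sig k))], below [C / k.+1]. *)
pose n (k : nat) := (Num.truncn (vmass F * S (l (sig k)) * k.+1%:R)).+1.
have rounding k : exists Q : seq loops, (0 < k)%N -> forall (g : loops -> R) (C : R), 0 <= C ->
    (forall p, `|g p| <= C * loop_len p) ->
    `|vmass F / (n k * k)%:R * (\sum_(p <- Q) g p) - weighted g (l (sig k))| <= C / k.+1%:R.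
  have [k0|kp] := posnP k; first by exists [::]; rewrite k0.
  have N0 : 0 < (n k * k)%:R :> R by rewrite ltr0n muln_gt0.
  have [Q hQ] := exists_rounding Fp N0 (l0 (sig k)).
  exists Q => _ g C C0 gC; apply: le_trans (hQ g _ gC) _.
  rewrite -mulr_sumr mulrCA ler_wpM2l // -/(S _) mulrAC ler_pdivrMr // [leRHS]mulrC.
  rewrite ler_pdivlMr //; apply: ltW; apply: lt_le_trans (truncnS_gt _) _.
  by rewrite ler_nat leq_pmulr.
have [Q hQ] := choice rounding.
have inv_small (C e : R) : 0 <= C -> 0 < e -> exists N : nat, forall k, (N <= k)%N -> C / k.+1%:R <= e.
  move=> C0 e0; exists (Num.truncn (C / e)) => k Nk.
  rewrite ler_pdivrMr // mulrC -ler_pdivrMr //; apply: ltW.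
  by apply: lt_le_trans (truncnS_gt _) _; rewrite ler_nat.
exists n, Q; split => [k //|Phi C0|].
  apply/cvgrPdist_le => e e0.
  have [C C00 PhiC] := C0_field_bounded C0.
  have e20 : 0 < e / 2 by rewrite divr_gt0.
  have [N1 h1] := lint Phi (e / 2) C0 e20.
  have [N2 h2] := inv_small C (e / 2) C00 e20.
  (* At [k = 0] the denominator [n k * k] vanishes, and nothing is known about the rounding. *)
  exists (maxn 1 (maxn N1 N2)) => // k /=; rewrite !geq_max => /and3P[k1 kN1 kN2].
  have := hQ k k1 (fun p => vintegral (loop_measure p) Phi) C C00
    (fun p => vintegral_loop_le p (C0_bfield C0) C00 PhiC).
  have [/(leq_trans kN1) /h1 + _] := hsig k; have := h2 k kN2.
  rewrite /weighted_int; move: (weighted _ _) (vmass F / _ * _) (vintegral F Phi) (C / _).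
  move=> w x y c ce; rewrite !ler_norml => /andP[a1 a2] /andP[a3 a4].
  by apply/andP; split; move: ce a1 a2 a3 a4 (splitr e); move: (e / 2) => e'; lra.
exists (M / vmass F); first by rewrite ler_pdivrMr.
apply/cvgrPdist_le => e e0.
have me0 : 0 < vmass F * e / 2 by rewrite divr_gt0 // mulr_gt0.
have [N hN] := inv_small 1 _ ler01 me0.
exists (maxn 1 N) => // k /=; rewrite geq_max => /andP[k1 kN].
have := hQ k k1 loop_mass 1 ler01 mlen; have [_] := hsig k; have := hN k kN.
rewrite mul1r -[_ / _ * (\sum_(p <- Q k) _)]mulrA; set x := _^-1 * (\sum_(p <- Q k) _).
move=> h1 h2 h3.
have -> : M / vmass F - x = (M - vmass F * x) * (vmass F)^-1 by field; rewrite gt_eqF.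
rewrite normrM normfV (gtr0_norm Fp) ler_pdivrMr // [e * _]mulrC.
move: h1 h2 h3.
move: (weighted _ _) (vmass F * x) (k.+1%:R^-1 : R) (vmass F * e) => w y u v.
rewrite !ler_norml => h1 /andP[a1 a2] /andP[a3 a4].
by apply/andP; split; move: h1 a1 a2 a3 a4 (splitr v); move: (v / 2) => v'; lra.
Qed.

End LoopApproximation.

(** * The theorem *)

Section Items.
Context (R : realType) (d : nat).
Notation V := 'rV[R]_d.

Definition item := (pwC1_curve R d * vmeasure R d)%type.

Definition valid_item (x : item) :=
  [/\ closed_curve x.1, induced_measure x.1 x.2 & (morrey1_norm x.2 <= 1000%:E)%E].

Definition loop_item (p : loop R d) : item :=
  let: And4 _ nd s0 _ := svalP p in (polygon_curve nd s0, loop_measure p).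

Lemma loop_item_valid p : valid_item (loop_item p).
Proof.
rewrite /loop_item; case: (svalP p) => cl nd s0 gd; split.
- exact: polygon_curve_closed.
- exact: polygon_curve_induced.
- exact: morrey1_good.
Qed.

Lemma loop_item_measure p : (loop_item p).2 = loop_measure p.
Proof. by rewrite /loop_item; case: (svalP p). Qed.

Lemma exists_null_item : (0 < d)%N -> exists2 x : item, valid_item x & x.2 = @vzero R d.
Proof.
(* A segment traversed back and forth. *)
move=> d0; pose e : V := delta_mx 0 (Ordinal d0).
have e0 : e != 0.
  by apply/eqP => /rowP /(_ (Ordinal d0)); rewrite !mxE !eqxx => /eqP; rewrite oner_eq0.
have nd : nondegenerate 0 [:: e; 0] by rewrite /nondegenerate /= eq_sym e0.
exists (polygon_curve (a := 0) (s := [:: e; 0]) nd isT, @vzero R d) => //; split => /=.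
- exact: polygon_curve_closed.
- move=> Phi C0; have [K _ PhiK] := C0_field_bounded C0; have [cPhi _] := C0.
  rewrite -(polygon_curve_induced nd isT C0) (vintegral_path _ _ cPhi PhiK).
  rewrite !pint_cons pint_nil addr0 (line_int_rev e 0 cPhi) addNr.
  exact: vintegral_vzero (C0_bfield C0).
- exact: morrey1_vzero.
Qed.

End Items.

Lemma sum_first_row (S T : Type) (idx : S) (op : Monoid.law idx) (n : nat) (L : seq T)
    (x0 : T) (f : T -> S) : (0 < n)%N -> f x0 = idx ->
  \big[op/idx]_(1 <= i < n.+1) \big[op/idx]_(1 <= j < (size L).+1)
     f (if i == 1%N then nth x0 L j.-1 else x0) = \big[op/idx]_(x <- L) f x.
Proof.
move=> n0 fx0; rewrite big_ltn ?ltnS //= [X in op _ X]big_nat_cond [X in op _ X]big1.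
  by rewrite Monoid.mulm1 big_add1 [RHS](big_nth x0).
move=> i; rewrite andbT => /andP[i1 _].
by rewrite big1 // => j _; rewrite ifF // gtn_eqF.
Qed.

Theorem theorem1p5 (R : realType) (d : nat) (d_gt0 : (0 < d)%N)
    (F : vmeasure R d) (divF : divergence_free F) :
  exists (n : nat -> nat) (k : nat -> nat -> nat)
         (G : nat -> nat -> nat -> pwC1_curve R d)
         (mu : nat -> nat -> nat -> vmeasure R d),
    [/\ (forall l, (1 <= l)%N -> (1 <= n l)%N) /\
        (forall l i, (1 <= l)%N -> (1 <= i <= n l)%N -> (1 <= k i l)%N),
        forall i l j, (1 <= l)%N -> (1 <= i <= n l)%N -> (1 <= j <= k i l)%N ->
          closed_curve (G i l j) /\ induced_measure (G i l j) (mu i l j),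
        weak_star_cvg
          (fun l => vscale (fine (vvariation F setT) / (n l * l)%:R)
             (\big[@vadd R d/@vzero R d]_(1 <= i < (n l).+1)
                \big[@vadd R d/@vzero R d]_(1 <= j < (k i l).+1) mu i l j))
          F,
        (let u : nat -> \bar R := fun l =>
           (((n l * l)%:R^-1)%:E *
              \sum_(1 <= i < (n l).+1) \sum_(1 <= j < (k i l).+1)
                vvariation (mu i l j) setT)%E in
         cvgn u /\ (limn u <= 10%:E)%E)
      & forall i l j, (1 <= l)%N -> (1 <= i <= n l)%N -> (1 <= j <= k i l)%N ->
          (morrey1_norm (mu i l j) <= 1000%:E)%E].
Proof.
have [n [Q [n0 wQ [M M3 mQ]]]] := exists_loop_sequence divF.
have [x0 vx0 x0E] := exists_null_item R d_gt0.
(* The additional null curve keeps the first row nonempty even when [Q l] is empty. *)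
pose L l := rcons (map (@loop_item R d) (Q l)) x0.
pose it i l j := if i == 1%N then nth x0 (L l) j.-1 else x0.
have itv i l j : valid_item (it i l j).
  rewrite /it; case: (i == 1%N); last exact: vx0.
  rewrite /L; elim: (Q l) j.-1 => [|p s IH] [|m] /=.
  - exact: vx0.
  - by rewrite nth_nil; exact: vx0.
  - exact: loop_item_valid.
  - exact: IH.
have LE (S : Type) (idx : S) (op : Monoid.law idx) (f : vmeasure R d -> S) l :
    f (@vzero R d) = idx -> \big[op/idx]_(x <- L l) f x.2 = \big[op/idx]_(p <- Q l) f (loop_measure p).
  move=> f0; rewrite /L -cats1 big_cat big_seq1 x0E f0 Monoid.mulm1 big_map.
  by apply: eq_bigr => p _; rewrite loop_item_measure.
exists n, (fun i l => size (L l)), (fun i l j => (it i l j).1), (fun i l j => (it i l j).2).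
split.
- by split => // l i _ _; rewrite size_rcons.
- by move=> i l j _ _ _; have [] := itv i l j.
- move=> Phi C0; have bPhi := C0_bfield C0.
  rewrite [X in X @ _ --> _](_ : _ = fun k => vmass F / (n k * k)%:R *
    \sum_(p <- Q k) vintegral (loop_measure p) Phi); first exact: wQ.
  apply/funext => l.
  rewrite vintegral_vscale //; congr (_ * _).
  (* Sums of measures are first turned into sums of reals, and only these are regrouped. *)
  have mor := @big_morph _ _ (fun mu => vintegral mu Phi) 0 +%R (@vzero R d) (@vadd R d)
    (fun mu nu => vintegral_vadd mu nu bPhi) (vintegral_vzero bPhi).
  rewrite mor -(LE _ _ _ (fun mu => vintegral mu Phi)) ?vintegral_vzero //.
  rewrite -(@sum_first_row _ _ _ _ (n l) (L l) x0 (fun x => vintegral x.2 Phi)) ?x0E ?vintegral_vzero //.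
  by apply: eq_bigr => i _; rewrite mor.
- have v0 : vvariation (@vzero R d) setT = 0%E.
    by apply/eqP; rewrite eq_le vvariation_vzero_le vvariation_ge0.
  have uE l : (((n l * l)%:R^-1)%:E * \sum_(1 <= i < (n l).+1) \sum_(1 <= j < (size (L l)).+1)
      vvariation (it i l j).2 setT)%E = ((n l * l)%:R^-1 * \sum_(p <- Q l) loop_mass p)%:E.
    rewrite EFinM; congr (_ * _)%E.
    rewrite (@sum_first_row _ _ _ _ (n l) (L l) x0 (fun x => vvariation x.2 setT)) ?x0E //.
    rewrite (LE _ _ _ (fun mu => vvariation mu setT)) // -sumEFin.
    by apply: eq_bigr => p _; exact: vvariation_loop.
  have cu : (fun l => ((n l * l)%:R^-1 * \sum_(p <- Q l) loop_mass p)%:E) @ \oo --> M%:E.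
    by apply: cvg_EFin; [exact: nearW|exact: mQ].
  move=> u; have -> : u = (fun l => ((n l * l)%:R^-1 * \sum_(p <- Q l) loop_mass p)%:E).
    by apply/funext => l; exact: uE.
  split; first exact: cvgP cu.
  rewrite (cvg_lim _ cu) // lee_fin; apply: le_trans M3 _; lra.
- by move=> i l j _ _ _; have [] := itv i l j.
Qed.
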